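(* Let $X$ be an $\mathbb R^d$-valued step process with respect to $\mathbb F$ and let $\tau:\Omega\to(0,+\infty]$ be a random time satisfying both of the following conditions: $(\mathcal A)$ (avoidance) $\mathbb P[\tau=\sigma<+\infty]=0$ for every $\mathbb F$-stopping time $\sigma$; $(\mathcal H)$ (immersion) every $\mathbb F$-martingale is a $\mathbb G$-martingale, where $\mathbb G$ is the progressive enlargement of $\mathbb F$ by $\tau$. Let $H=1_{[\tau,+\infty)}$. Then the $\mathbb G$-dual predictable projection of $\mu^Z$, where $Z=(X,H)$, is given by $$\nu^{\mathbb G,Z}(\omega,dt,dx_1,dx_2)=\nu^{\mathbb F,X}(\omega,dt,dx_1)\,\delta_0(dx_2)+\delta_1(dx_2)\,\delta_0(dx_1)\,d\Lambda^{\mathbb G}_t(\omega).$$ In particular, if $X$ is $\mathbb F$-quasi-left continuous, then $Z$ is $\mathbb G$-quasi-left continuous as well.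
   Context: On a probability space $(\Omega,\mathcal F,\mathbb P)$, $\mathbb F=(\mathcal F_t)_{t\ge0}$ is the (right-continuous) filtration $\mathcal F_t=\mathcal R^X\vee\mathcal F^X_t$, with $\mathcal R^X$ a given initial $\sigma$-field and $\mathbb F^X$ the smallest right-continuous filtration to which $X$ is adapted. The progressive enlargement $\mathbb G$ of $\mathbb F$ by $\tau$ is the smallest right-continuous filtration containing $\mathbb F$ and making $\tau$ a stopping time. A step process is a semimartingale $X=\sum_{n\ge1}\xi_n1_{[\tau_n,+\infty)}$ with $\mathbb F$-stopping times $\tau_n\uparrow+\infty$, $\tau_n<\tau_{n+1}$ on $\{\tau_n<\infty\}$, and $\mathcal F_{\tau_n}$-measurable $\xi_n$, $\xi_n\neq0$ iff $\tau_n<\infty$. The jump measure of a càdlàg process $Y$ is $\mu^Y(\omega,dt,dy)=\sum_{s>0}1_{\{\Delta Y_s(\omega)\neq0\}}\delta_{(s,\Delta Y_s(\omega))}(dt,dy)$. $\nu^{\mathbb F,X}$ is the $\mathbb F$-dual predictable projection (compensator) of $\mu^X$, $\nu^{\mathbb G,Z}$ the $\mathbb G$-dual predictable projection of $\mu^Z$, and $\Lambda^{\mathbb G}$ the $\mathbb G$-dual predictable projection of the process $H$ (the $\mathbb G$-predictable process of locally integrable variation such that $H-\Lambda^{\mathbb G}$ is a $\mathbb G$-local martingale). An adapted càdlàg process $Y$ is quasi-left continuous with respect to a filtration if $\Delta Y_\sigma=0$ a.s. for every finite-valued predictable stopping time $\sigma$ of that filtration. *)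

(* Defs.v *)
From HB Require Import structures.
From mathcomp Require Import all_boot all_order all_algebra.
From mathcomp Require Import all_classical all_reals all_analysis.
From mathcomp Require Import measurable_realfun.

Set Implicit Arguments.
Unset Strict Implicit.
Unset Printing Implicit Defensive.
Import Order.TTheory GRing.Theory Num.Theory.
Import numFieldNormedType.Exports.
Local Open Scope classical_set_scope.
Local Open Scope ring_scope.

(* Borel sigma-algebra of R^d. *)
HB.instance Definition _ (R : realType) (d : nat) :=
  Measurable.copy 'rV[R]_d (g_sigma_algebraType (@open 'rV[R]_d)).

(* The time axis is [0, +oo[, encoded inside R: filtrations and processes are
   indexed by R, and their values at negative times are never used. *)

Section measurability.
Context {T : Type} {dU : measure_display} {U : measurableType dU}.

(* f, restricted to D, is measurable for the sigma-algebra S on D. *)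
Definition measurable_wrt (D : set T) (S : set (set T)) (f : T -> U) :=
  forall B, measurable B -> S (D `&` f @^-1` B).

End measurability.

Section filtrations.
Context {R : realType} {dO : measure_display} {Omega : measurableType dO}.
Implicit Types (F G : R -> set (set Omega)) (sigma : Omega -> \bar R).

Definition rc_filtration F :=
  [/\ forall t, 0 <= t -> sigma_algebra setT (F t) /\ F t `<=` measurable,
      forall s t, 0 <= s -> s <= t -> F s `<=` F t &
      forall t, 0 <= t -> \bigcap_(s in [set s | t < s]) F s `<=` F t].

Definition adapted {dU : measure_display} {U : measurableType dU} F
    (Y : R -> Omega -> U) :=
  forall t, 0 <= t -> measurable_wrt setT (F t) (Y t).

Definition stopping_time F sigma :=
  (forall w, (0 <= sigma w)%E) /\
  (forall t, 0 <= t -> F t [set w | (sigma w <= t%:E)%E]).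

Definition stopped_sigma_algebra F sigma : set (set Omega) :=
  [set A | measurable A /\
    forall t, 0 <= t -> F t (A `&` [set w | (sigma w <= t%:E)%E])].

Definition natural_filtration {dU : measure_display} {U : measurableType dU}
    (Y : R -> Omega -> U) (t : R) : set (set Omega) :=
  [set A | forall K, rc_filtration K -> adapted K Y -> K t A].

Definition initially_enlarged (RX : set (set Omega)) F (t : R) :
    set (set Omega) :=
  <<s RX `|` F t >>.

Definition progressive_enlargement F (tau : Omega -> \bar R) (t : R) :
    set (set Omega) :=
  [set A | forall K, rc_filtration K ->
    (forall s, 0 <= s -> F s `<=` K s) -> stopping_time K tau -> K t A].

(* The predictable sigma-algebra on Omega x [0, +oo[. *)
Definition predictable F : set (set (Omega * R)) :=
  <<s [set p : Omega * R | 0 <= p.2],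
    [set C | exists2 A, F 0 A & C = A `*` [set 0]] `|`
    [set C | exists s t A,
      [/\ 0 <= s, s < t, F s A & C = A `*` `]s, t]%classic]] >>.

Definition predictable_process {dU : measure_display} {U : measurableType dU}
    F (Y : R -> Omega -> U) :=
  measurable_wrt [set p : Omega * R | 0 <= p.2] (predictable F)
    (fun p => Y p.2 p.1).

(* sigma is predictable when the stochastic interval [[0, sigma[[ is. *)
Definition predictable_time F sigma :=
  stopping_time F sigma /\
  predictable F [set p | 0 <= p.2 /\ (p.2%:E < sigma p.1)%E].

(* The sigma-algebra "predictable (x) Borel" on Omega x [0, +oo[ x E. *)
Definition predictable_prod {dE : measure_display} {E : measurableType dE} F :
    set (set (Omega * (R * E))) :=
  <<s [set z : Omega * (R * E) | 0 <= z.2.1],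
    [set C | exists D (B : set E), [/\ predictable F D, measurable B &
      C = [set z | D (z.1, z.2.1) /\ B z.2.2]]] >>.

Definition predictable_function {dE : measure_display}
    {E : measurableType dE} F (W : Omega * (R * E) -> \bar R) :=
  measurable_wrt [set z : Omega * (R * E) | 0 <= z.2.1]
    (predictable_prod F) W.

End filtrations.

Section paths.
Context {R : realType} {E : normedModType R}.
Implicit Type y : R -> E.

Definition cadlag_path y :=
  (forall t, 0 <= t -> y x @[x --> t^'+] --> y t) /\
  (forall t, 0 < t -> cvg (y x @[x --> t^'-])).

(* Convention: no jump at time 0. *)
Definition jump y (t : R) : E :=
  if 0 < t then y t - lim (y x @[x --> t^'-]) else 0.

End paths.

Section martingales.
Context {R : realType} {dO : measure_display} {Omega : measurableType dO}.
Variable P : probability Omega R.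
Implicit Types (F G : R -> set (set Omega)) (M Y : R -> Omega -> R)
  (sigma : Omega -> \bar R).

Definition martingale F M :=
  [/\ adapted F M,
      forall t, 0 <= t -> P.-integrable setT (EFin \o M t),
      {ae P, forall w, cadlag_path (M ^~ w)} &
      forall s t A, 0 <= s -> s <= t -> F s A ->
        (\int[P]_(w in A) (M t w)%:E = \int[P]_(w in A) (M s w)%:E)%E].

Definition stopped_process sigma M : R -> Omega -> R :=
  fun t w => M (fine (Order.min t%:E (sigma w))) w.

Definition localizing_sequence F (T : nat -> Omega -> \bar R) :=
  (forall n, stopping_time F (T n)) /\
  {ae P, forall w, (forall n, (T n w <= T n.+1 w)%E) /\
    T n w @[n --> \oo] --> +oo%E}.

Definition local_martingale F M :=
  exists2 T, localizing_sequence F T &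
    forall n, martingale F (stopped_process (T n) M).

Definition avoids_stopping_times F (tau : Omega -> \bar R) :=
  forall sigma, stopping_time F sigma ->
    P [set w | tau w = sigma w /\ (tau w < +oo)%E] = 0%E.

Definition immersed F G := forall M, martingale F M -> martingale G M.

Definition quasi_left_continuous {E : normedModType R} F
    (Y : R -> Omega -> E) :=
  forall sigma, predictable_time F sigma -> (forall w, (sigma w < +oo)%E) ->
    {ae P, forall w, jump (Y ^~ w) (fine (sigma w)) = 0}.

(* The dual predictable projection of an increasing process A, which is again
   an increasing process.  A cumulative function is nondecreasing and
   right-continuous, so the variation of L w over [0, t] is L w t. *)
Definition dual_predictable_projection F (A : R -> Omega -> R)
    (L : Omega -> cumulative R R) :=
  [/\ forall w t, t <= 0 -> L w t = 0,
      predictable_process F (fun t w => L w t),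
      (exists2 T, localizing_sequence F T & forall n,
        (\int[P]_w ereal_sup [set
          (stopped_process (T n) (fun t w' => L w' t) t w)%:E | t in `[0%R, +oo[]
         < +oo)%E) &
      local_martingale F (fun t w => A t w - L w t)].

(* nu is the dual predictable projection (compensator) of the random measure
   mu; nu is predictable when each process nu(]0, t] x B) is. *)
Definition dual_predictable_projection_measure {dE : measure_display}
    {E : measurableType dE} F
    (mu nu : Omega -> {measure set (R * E) -> \bar R}) :=
  [/\ forall w, nu w [set z | z.1 <= 0] = 0%E,
      forall B : set E, measurable B ->
        predictable_process F (fun t w => nu w (`]0, t]%classic `*` B)) &
      forall W : Omega * (R * E) -> \bar R,
        (forall z, 0 <= W z)%E -> predictable_function F W ->
        (\int[P]_w \int[nu w]_(z in [set z | (0 <= z.1)%R]) W (w, z) =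
         \int[P]_w \int[mu w]_(z in [set z | (0 <= z.1)%R]) W (w, z))%E].

End martingales.

Section step_processes.
Context {R : realType} {dO : measure_display} {Omega : measurableType dO}.

(* The index n : nat stands for n + 1 in the mathematical notation. *)
Definition step_process {d : nat} (F : R -> set (set Omega))
    (X : R -> Omega -> 'rV[R]_d) :=
  exists (T : nat -> Omega -> \bar R) (xi : nat -> Omega -> 'rV[R]_d),
  [/\ forall n, stopping_time F (T n),
      forall w, (forall n, (T n w <= T n.+1 w)%E /\
                  ((T n w < +oo)%E -> (T n w < T n.+1 w)%E)) /\
                T n w @[n --> \oo] --> +oo%E,
      forall n, measurable_wrt setT (stopped_sigma_algebra F (T n)) (xi n),
      forall n w, xi n w <> 0 <-> (T n w < +oo)%E &
      forall t w, 0 <= t ->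
        (\sum_(0 <= n < N) (if (T n w <= t%:E)%E then xi n w else 0))
          @[N --> \oo] --> X t w].

Definition default_process (tau : Omega -> \bar R) : R -> Omega -> R :=
  fun t w => if (tau w <= t%:E)%E then 1 else 0.

End step_processes.

Section jump_measure.
Context {R : realType} {dE : measure_display} {E : measurableType dE}.
Variables (dy : R -> E) (zero : E).
Local Open Scope ereal_scope.

(* The sum of the Dirac masses at (s, dy s) over the times s > 0 such that
   dy s <> zero.  For a process Y with values in a normed space, it is used
   with dy := jump (Y ^~ w) and zero := 0; dy and zero are parameters because
   no library structure joins measurableType and normedModType. *)
Definition jump_measure (C : set (R * E)) : \bar R :=
  \esum_(s in [set s | (0 < s)%R /\ dy s <> zero]) \d_(s, dy s) C.

Let jump_measure0 : jump_measure set0 = 0.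
Proof. by rewrite /jump_measure esum1// => s _; rewrite measure0. Qed.

Let jump_measure_ge0 C : 0 <= jump_measure C.
Proof. by apply: esum_ge0 => s _; exact: measure_ge0. Qed.

Let jump_measure_sigma_additive : semi_sigma_additive jump_measure.
Proof.
move=> F mF tF mUF.
have -> : jump_measure (\bigcup_n F n) = \sum_(n <oo) jump_measure (F n).
  rewrite nneseries_esumT// /jump_measure.
  transitivity (\esum_(s in [set s | (0 < s)%R /\ dy s <> zero])
      \esum_(n in [set: nat]) (\d_(s, dy s) (F n) : \bar R)).
    apply: eq_esum => s _; rewrite -nneseries_esumT//.
    exact: measure_semi_bigcup.
  rewrite esum_esum//= esum_esum//=.
  apply: (reindex_esum _ _ (fun p : nat * R => (p.2, p.1))).
  split.
  - by move=> [n s] /= [].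
  - by move=> [n s] [m u] _ _ /= [-> ->].
  - by move=> [s n] /= [h _]; exists (n, s).
by apply: is_cvg_nneseries => n _ _; exact: jump_measure_ge0.
Qed.

HB.instance Definition _ := isMeasure.Build _ _ _ jump_measure
  jump_measure0 jump_measure_ge0 jump_measure_sigma_additive.

End jump_measure.

Section stieltjes.
Context {R : realType}.
Variable f : cumulative R R.
Local Open Scope ereal_scope.

(* lebesgue_stieltjes_measure, which the library puts on measurableTypeR R,
   seen as a measure on R itself. *)
Definition stieltjes (C : set R) : \bar R := lebesgue_stieltjes_measure f C.

Let stieltjes0 : stieltjes set0 = 0.
Proof. exact: (measure0 (lebesgue_stieltjes_measure f)). Qed.

Let stieltjes_ge0 C : 0 <= stieltjes C.
Proof. exact: (measure_ge0 (lebesgue_stieltjes_measure f)). Qed.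

Let stieltjes_sigma_additive : semi_sigma_additive stieltjes.
Proof.
move=> F mF tF mUF.
exact: (@measure_semi_sigma_additive _ _ _ (lebesgue_stieltjes_measure f)
  F mF tF mUF).
Qed.

HB.instance Definition _ := isMeasure.Build _ _ _ stieltjes
  stieltjes0 stieltjes_ge0 stieltjes_sigma_additive.

End stieltjes.

Section joint_compensator.
Context {R : realType} {d : nat}.
Local Open Scope ereal_scope.

Section times_dirac.
Variables (nu : {measure set (R * 'rV[R]_d) -> \bar R}) (a : R).

Let reassoc (z : (R * 'rV[R]_d) * R) : R * ('rV[R]_d * R) :=
  (z.1.1, (z.1.2, z.2)).

Let measurable_reassoc : measurable_fun setT reassoc.
Proof.
apply/measurable_fun_pairP; split.
  exact: (measurableT_comp measurable_fst measurable_fst).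
apply/measurable_fun_pairP; split; last exact: measurable_snd.
exact: (measurableT_comp measurable_snd measurable_fst).
Qed.

(* nu(dt, dx1) delta_a(dx2) as a measure in (t, (x1, x2)) *)
Definition times_dirac (C : set (R * ('rV[R]_d * R))) : \bar R :=
  (nu \x \d_a) (reassoc @^-1` C).

Let times_dirac0 : times_dirac set0 = 0.
Proof. by rewrite /times_dirac preimage_set0 measure0. Qed.

Let times_dirac_ge0 C : 0 <= times_dirac C.
Proof. exact: measure_ge0. Qed.

Let times_dirac_sigma_additive : semi_sigma_additive times_dirac.
Proof.
have mpre A : measurable A -> measurable (reassoc @^-1` A).
  by move=> mA; rewrite -[X in measurable X]setTI; exact: measurable_reassoc.
move=> F mF tF mUF; rewrite /times_dirac preimage_bigcup.
apply: measure_semi_sigma_additive.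
- by move=> n; exact: mpre.
- apply/trivIsetP => /= i j _ _ ij; rewrite -preimage_setI.
  by move/trivIsetP : tF => /(_ _ _ _ _ ij) ->//; rewrite preimage_set0.
- by rewrite -preimage_bigcup; exact: mpre.
Qed.

HB.instance Definition _ := isMeasure.Build _ _ _ times_dirac
  times_dirac0 times_dirac_ge0 times_dirac_sigma_additive.

End times_dirac.

(* nu(dt, dx1) delta_0(dx2) + delta_1(dx2) delta_0(dx1) dL_t *)
Definition joint_compensator (nu : {measure set (R * 'rV[R]_d) -> \bar R})
    (L : cumulative R R) : {measure set (R * ('rV[R]_d * R)) -> \bar R} :=
  measure_add (times_dirac nu 0%R)
    (times_dirac (stieltjes L \x \d_(0%R : 'rV[R]_d)) 1%R).

End joint_compensator.

(* Main.v *)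
Require Import Defs.
From HB Require Import structures.
From mathcomp Require Import all_boot all_order all_algebra.
From mathcomp Require Import all_classical all_reals all_analysis.
From mathcomp Require Import measurable_realfun.
From mathcomp Require Import lra.

Set Implicit Arguments.
Unset Strict Implicit.
Unset Printing Implicit Defensive.
Import Order.TTheory GRing.Theory Num.Theory.
Import numFieldNormedType.Exports.
Local Open Scope classical_set_scope.
Local Open Scope ring_scope.

(** Call mu^X and nu^X the jump measure of X and its F-compensator, and T_m the
    jump times of X.

    Compensators are compared through martingales.  If the masses of two random
    measures on ]0, t] x B, stopped at T_m, differ by a G-martingale, then the
    two measures integrate every nonnegative G-predictable function to the same
    expectation ([predictable_integral_eq]): the martingale property is the
    equality on predictable rectangles, Dynkin's lemma extends it to predictable
    sets, and monotone convergence to functions.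

    For X, the mass of mu^X stopped at T_m is at most m + 1, so that its
    difference with the mass of nu^X is a true F-martingale.  Immersion makes it
    a G-martingale, and nu^X is therefore the G-compensator of mu^X as well
    ([jump_same_martingale_part]).  For H, the martingale is H - Lambda
    ([default_same_martingale_part]).  By avoidance tau differs from all T_m, so
    almost surely X and H have no common jump, and the jump measure of (X, H) is
    the sum of the jump measures of (X, 0) and of (0, H) ([jump_measure_pair]).
    Adding the two identities gives the formula.

    For quasi-left continuity there are two points.  First, nu^X has almost
    surely no atom in time.  The process A_t = nu^X(]0, t] x R^d) is increasing
    and predictable, so its crossing times of rational levels are predictable
    times as soon as the level is reached by a jump, and they exhaust the jumps
    of A; X does not jump at these times, so nu^X does not charge them
    ([compensator_no_atom]).  Since nu^X is the G-compensator, mu^X charges no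
    graph of a G-predictable time.

    Second, tau meets no G-predictable time sigma ([predictable_time_avoids]).
    Up to tau the filtration G brings nothing new ([predictable_trace]), so the
    graph of sigma on [0, tau] is the trace of an F-predictable set D with at
    most one point there.  Up to small measure, D contains a countable
    intersection of finite unions of blocks A x [a, b] with A in F_a, whose
    debut is an F-stopping time ([foretellable_debut]).  When tau hits this
    intersection it coincides with the debut, and avoidance applies.

    The filtrations are not completed.  The exceptional null sets are therefore
    kept explicit, and integrals of functions that are measurable only off a
    null set are compared by [integral_null_ext]. *)

(** * Sigma-algebras and integrals *)

Section sigma_algebra_facts.
Context {T : pointedType}.

Lemma g_sigma_algebra_restrict (D : set T) (S : set (set T)) A :
  sigma_algebra D S -> (forall B, S B -> B `<=` D) -> <<s S >> A -> S (D `&` A).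
Proof.
move=> [S0 SD SU] SsubD.
suff: <<s S >> `<=` [set B | S (D `&` B)] by exact.
apply: smallest_sub => [|B SB] /=; last first.
  by rewrite setIidr//; exact: SsubD.
split=> /=; first by rewrite setI0.
- by move=> B /SD; rewrite setTD setDIr setDv set0U setDE.
- by move=> B SB; rewrite setI_bigcupr; exact: SU.
Qed.

Lemma g_sigma_algebra_sub (D : set T) (S : set (set T)) :
  (forall B, S B -> B `<=` D) -> forall B, <<s D, S >> B -> B `<=` D.
Proof.
move=> SD; suff: <<s D, S >> `<=` [set B | B `<=` D] by exact.
apply: smallest_sub => //; split=> [|A _|A AD] /=; first exact: sub0set.
- exact: subDsetl.
- by apply: bigcup_sub => i _; exact: AD.
Qed.

(** Measurability on D with respect to a sigma-algebra of subsets of D is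
    measurability for the sigma-algebra on the whole space that it generates;
    this gives access to the usual calculus of measurable functions. *)
Lemma measurable_wrtP {dU} {U : measurableType dU} (D : set T)
    (S : set (set T)) (f : T -> U) :
  sigma_algebra D S -> (forall B, S B -> B `<=` D) ->
  measurable_wrt D S f <->
  @measurable_fun _ _ (g_sigma_algebraType S : measurableType _) U D f.
Proof.
move=> sS SD; split=> [mf _ B mB|mf B mB].
  exact: sub_sigma_algebra (mf B mB).
have [S0 SC SU] := sS.
have SDD : S D by rewrite -(setD0 D); exact: SC.
have := mf (sub_sigma_algebra SDD) B mB.
move=> /(g_sigma_algebra_restrict sS SD); by rewrite setIA setIid.
Qed.

End sigma_algebra_facts.

Section integral_facts.
Context {d} {T : measurableType d} {R : realType} (mu : {measure set T -> \bar R}).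
Local Open Scope ereal_scope.
Import HBNNSimple.

(** The integral is a supremum over the simple functions below, and cutting
    these off a null set does not change their integrals.  The inner integrals
    against a compensator are known to be measurable only off a null set. *)
Lemma integral_null_ext (N : set T) (f g : T -> \bar R) :
  measurable N -> mu N = 0 -> (forall x, 0 <= f x) -> (forall x, 0 <= g x) ->
  (forall x, ~ N x -> f x = g x) -> \int[mu]_x f x = \int[mu]_x g x.
Proof.
move=> mN N0.
wlog suff le : f g / (forall x, 0 <= f x) -> (forall x, 0 <= g x) ->
    (forall x, ~ N x -> f x = g x) -> \int[mu]_x f x <= \int[mu]_x g x.
  move=> f0 g0 fg; apply/eqP; rewrite eq_le; apply/andP; split; apply: le => //.
  by move=> x /fg.
move=> f0 g0 fg; rewrite !ge0_integralTE//.
apply: ge_ereal_sup => _ [h hf <-]; apply: ereal_sup_ubound => /=.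
have mNC := measurableC mN.
have hE x : proj_nnsfun h mNC x = (h \_ (~` N)) x by rewrite mrestrict.
exists (proj_nnsfun h mNC) => [x|].
  have le : ((h \_ (~` N)) x)%:E <= g x.
    by rewrite patchE; case: ifPn => [/set_mem/fg <-//|_]; exact: g0.
  by move: le; rewrite -hE.
rewrite -!integralT_nnsfun.
rewrite [RHS](ge0_negligible_integral mN)//=; last 2 first.
- exact/measurable_EFinP.
- by move=> x _; rewrite lee_fin.
rewrite setTD [RHS]integral_mkcond; apply: eq_integral => x _.
transitivity ((h \_ (~` N)) x)%:E; first by congr EFin; exact: hE.
by rewrite !patchE; case: ifPn.
Qed.

End integral_facts.

Section integral_kernel.
Context {d d'} {X : measurableType d} {Y : measurableType d'} {R : realType}.
Variable mu : {measure set X -> \bar R}.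
Local Open Scope ereal_scope.
Import HBNNSimple.

Lemma integral_kernel_lim (l : X -> {measure set Y -> \bar R})
    (ml : forall U, measurable U -> measurable_fun [set: X] (l ^~ U))
    (f : Y -> \bar R) (f0 : forall y, 0 <= f y) (mf : measurable_fun setT f) :
  \int[mu]_x \int[l x]_y f y =
  limn (fun n => \sum_(r \in range (nnsfun_approx measurableT mf n))
    r%:E * \int[mu]_x l x (nnsfun_approx measurableT mf n @^-1` [set r])).
Proof.
set f_ := nnsfun_approx measurableT mf.
have ndf m n : (m <= n)%N -> forall y, (f_ m y)%:E <= (f_ n y)%:E.
  by move=> mn y; rewrite lee_fin; apply/lefP; exact: nd_nnsfun_approx.
have mif n : measurable_fun setT (fun x => \int[l x]_y (f_ n y)%:E).
  apply: measurable_fun_integral_kernel => // [y|]; first by rewrite lee_fin.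
  exact/measurable_EFinP.
transitivity (\int[mu]_x limn (fun n => \int[l x]_y (f_ n y)%:E)).
  apply: eq_integral => x _; rewrite -monotone_convergence//; last 3 first.
  - by move=> n; exact/measurable_EFinP.
  - by move=> n y _; rewrite lee_fin.
  - by move=> y _ m n mn; exact: ndf.
  apply: eq_integral => y _; apply/esym/cvg_lim => //.
  exact: cvg_nnsfun_approx.
rewrite monotone_convergence//; last 2 first.
- by move=> n x _; apply: integral_ge0 => y _; rewrite lee_fin.
- move=> x _ m n mn; apply: ge0_le_integral => //.
  + by move=> y _; rewrite lee_fin.
  + exact/measurable_EFinP.
  + exact/measurable_EFinP.
  + by move=> y _; exact: ndf.
congr (limn _); apply/funext => n.
transitivity (\int[mu]_x \sum_(r \in range (f_ n)) r%:E * l x (f_ n @^-1` [set r])).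
  by apply: eq_integral => x _; rewrite integralT_nnsfun sintegralE.
rewrite ge0_integral_fsum//; last 2 first.
- by move=> r; apply: measurable_funeM; exact: ml.
- by move=> r x _; exact: nnsfun_mulemu_ge0.
apply: eq_fsbigr => r; rewrite inE => -[y _ <-].
rewrite ge0_integralZl//; last by rewrite lee_fin.
exact: ml.
Qed.

(** By approximation with simple functions: the double integral is a limit of
    linear combinations of the averages of [l x U]. *)
Lemma eq_integral_kernel (l1 l2 : X -> {measure set Y -> \bar R}) :
  (forall U, measurable U -> measurable_fun [set: X] (l1 ^~ U)) ->
  (forall U, measurable U -> measurable_fun [set: X] (l2 ^~ U)) ->
  (forall U, measurable U -> \int[mu]_x l1 x U = \int[mu]_x l2 x U) ->
  forall f : Y -> \bar R, (forall y, 0 <= f y) -> measurable_fun setT f ->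
  \int[mu]_x \int[l1 x]_y f y = \int[mu]_x \int[l2 x]_y f y.
Proof.
move=> ml1 ml2 l12 f f0 mf; rewrite !(integral_kernel_lim _ f0 mf)//.
congr (limn _); apply/funext => n; apply: eq_fsbigr => r _.
by rewrite l12.
Qed.

End integral_kernel.

(** * Filtrations, stopping times and predictable sets *)

Lemma set_system_ext {T} (S : set (set T)) A B :
  S A -> (forall x, A x <-> B x) -> S B.
Proof. by move=> SA AB; rewrite -(_ : A = B)//; apply/seteqP; split=> x /AB. Qed.

Section sigma_algebra_on.
Context {T : pointedType} {D : set T} {S : set (set T)}.
Hypotheses (sS : sigma_algebra D S) (SD : forall B, S B -> B `<=` D).

Lemma salg0 : S set0. Proof. by case: sS. Qed.

Lemma salgC A : S A -> S (D `\` A). Proof. by case: sS => _ + _; exact. Qed.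

Lemma salgT : S D. Proof. by rewrite -(setD0 D); exact/salgC/salg0. Qed.

Lemma salg_bigcup (A : nat -> set T) : (forall n, S (A n)) -> S (\bigcup_n A n).
Proof. by case: sS => _ _; exact. Qed.

Lemma salg_bigcup_count (I : countType) (A : I -> set T) :
  (forall i, S (A i)) -> S (\bigcup_i A i).
Proof.
move=> SA; pose B n := if unpickle n is Some i then A i else set0.
have -> : \bigcup_i A i = \bigcup_n B n.
  apply/seteqP; split=> [x [i _ Aix]|x [n _]].
    by exists (pickle i) => //; rewrite /B pickleK.
  by rewrite /B; case: unpickle => // i Aix; exists i.
by apply: salg_bigcup => n; rewrite /B; case: unpickle => // ; exact: salg0.
Qed.

Lemma salgU A B : S A -> S B -> S (A `|` B).
Proof.
by move=> SA SB; rewrite -bigcup2E; apply: salg_bigcup => -[|[|n]] //=; exact: salg0.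
Qed.

Lemma salg_bigcap (A : nat -> set T) : (forall n, S (A n)) -> S (\bigcap_n A n).
Proof.
move=> SA; have -> : \bigcap_n A n = D `\` \bigcup_n (D `\` A n).
  apply/seteqP; split=> [x Ax|x [Dx nA] n _].
    by split=> [|[n _ []] _]; [exact: (SD (SA 0%N)) (Ax 0%N _)|apply; exact: Ax].
  by apply: contrapT => nAx; apply: nA; exists n.
by apply/salgC/salg_bigcup => n; exact/salgC.
Qed.

Lemma salgI A B : S A -> S B -> S (A `&` B).
Proof.
move=> SA SB; have -> : A `&` B = D `\` ((D `\` A) `|` (D `\` B)).
  rewrite setDUr !setDD -setIIr; apply/esym/setIidr.
  by move=> x [/(SD SA)].
by apply/salgC/salgU; exact/salgC.
Qed.

Lemma salgD A B : S A -> S B -> S (A `\` B).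
Proof.
move=> SA SB; have -> : A `\` B = A `&` (D `\` B).
  by rewrite setIDA; congr (_ `\` _); apply/esym/setIidl/SD.
by apply: salgI => //; exact: salgC.
Qed.

End sigma_algebra_on.

Section filtration_facts.
Context {R : realType} {dO : measure_display} {Omega : measurableType dO}.
Implicit Types (F G : R -> set (set Omega)) (sigma : Omega -> \bar R).

Section one_filtration.
Variable F : R -> set (set Omega).
Hypothesis rcF : rc_filtration F.

Lemma filt_salg t : 0 <= t -> sigma_algebra setT (F t).
Proof. by case: rcF => + _ _ => /[apply] -[]. Qed.

Lemma filt_meas t A : 0 <= t -> F t A -> measurable A.
Proof. by case: rcF => + _ _ => /[apply] -[_]; exact. Qed.

Lemma filt_le s t A : 0 <= s -> s <= t -> F s A -> F t A.
Proof. by case: rcF => _ + _ => h s0 st; exact: h. Qed.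

Lemma filt_rc t A : 0 <= t -> (forall s, t < s -> F s A) -> F t A.
Proof. by case: rcF => _ _ h t0 FA; exact: h. Qed.

Lemma filt0 t : 0 <= t -> F t set0.
Proof. by move=> t0; exact: salg0 (filt_salg t0). Qed.

Lemma filtT t : 0 <= t -> F t setT.
Proof. by move=> t0; exact: salgT (filt_salg t0). Qed.

Lemma filtC t A : 0 <= t -> F t A -> F t (~` A).
Proof. by move=> t0 FA; rewrite -setTD; exact: salgC (filt_salg t0) _ FA. Qed.

Lemma filtU t A B : 0 <= t -> F t A -> F t B -> F t (A `|` B).
Proof. by move=> t0; exact: salgU (filt_salg t0) _ _. Qed.

Lemma filtI t A B : 0 <= t -> F t A -> F t B -> F t (A `&` B).
Proof. by move=> t0; apply: (salgI (filt_salg t0)) => C _; exact: subsetT. Qed.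

Lemma filt_bigcup t (A : nat -> set Omega) : 0 <= t ->
  (forall n, F t (A n)) -> F t (\bigcup_n A n).
Proof. by move=> t0; exact: salg_bigcup (filt_salg t0) _. Qed.

Lemma filt_bigcap t (A : nat -> set Omega) : 0 <= t ->
  (forall n, F t (A n)) -> F t (\bigcap_n A n).
Proof.
by move=> t0; apply: (salg_bigcap (filt_salg t0)) => C _; exact: subsetT.
Qed.

Lemma stopping_time_measurable sigma : stopping_time F sigma ->
  measurable_fun setT sigma.
Proof.
move=> [s0 Fs]; apply: (measurability _ (ErealGenInftyO.measurableE R)).
move=> _ [_ [x ->] <-]; rewrite setTI.
have -> : sigma @^-1` `]-oo, x%:E[ =
    \bigcup_(q : rat) (if (0 <= ratr q :> R) && (ratr q < x) then
      [set w | (sigma w <= (ratr q)%:E)%E] else set0).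
  apply/seteqP; split=> w /=; last first.
    move=> [q _]; case: ifPn => // /andP[q0 qx] /= sq.
    by rewrite in_itv/= (le_lt_trans sq)// lte_fin.
  rewrite in_itv/= => sx.
  have sfin : sigma w \is a fin_num.
    by rewrite ge0_fin_numE// (lt_le_trans sx)// leey.
  move: sx; rewrite -(fineK sfin) lte_fin => sx.
  have [q] := rat_in_itvoo sx; rewrite in_itv/= => /andP[sq qx].
  exists q => //; rewrite qx (le_trans _ (ltW sq)) ?fine_ge0//=.
  by rewrite -(fineK sfin) lee_fin ltW.
apply: (salg_bigcup_count (sigma_algebra_measurable Omega)) => q.
case: ifPn => [/andP[q0 _]|_]; last exact: measurable0.
exact/(filt_meas q0)/Fs.
Qed.

Lemma stopping_time_cst (c : \bar R) : (0 <= c)%E -> stopping_time F (cst c).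
Proof.
move=> c0; split=> // t t0; have [ct|ct] := pselect (c <= t%:E)%E.
  rewrite (_ : [set _ | _] = setT); first exact: filtT.
  by apply/seteqP; split.
rewrite (_ : [set _ | _] = set0); first exact: filt0.
by apply/seteqP; split.
Qed.

Lemma stopping_time_min sigma rho : stopping_time F sigma ->
  stopping_time F rho -> stopping_time F (fun w => Order.min (sigma w) (rho w)).
Proof.
move=> [s0 Fs] [r0 Fr]; split=> [w|t t0]; first by rewrite le_min s0 r0.
have -> : [set w | (Order.min (sigma w) (rho w) <= t%:E)%E] =
    [set w | (sigma w <= t%:E)%E] `|` [set w | (rho w <= t%:E)%E].
  by apply/seteqP; split=> w /=; rewrite ge_min => /orP.
by apply: filtU => //; [exact: Fs|exact: Fr].
Qed.

Lemma predictable_sub D : predictable F D -> D `<=` [set p | 0 <= p.2].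
Proof.
apply: g_sigma_algebra_sub => B [[A _ ->]|[s [t [A [s0 st _ ->]]]]] [w u] /=.
  by move=> [_ ->].
by rewrite in_itv/= => -[_ /andP[su _]]; rewrite (le_trans s0)// ltW.
Qed.

Lemma predictable_salg : sigma_algebra [set p : Omega * R | 0 <= p.2] (predictable F).
Proof. exact: smallest_sigma_algebra. Qed.

Let pS := predictable_salg.

Lemma predictable_rect0 A : F 0 A -> predictable F (A `*` [set 0]).
Proof. by move=> FA; apply: sub_sigma_algebra; left; exists A. Qed.

Lemma predictable_rect s t A : 0 <= s -> s < t -> F s A ->
  predictable F (A `*` `]s, t]%classic).
Proof.
by move=> s0 st FA; apply: sub_sigma_algebra; right; exists s, t, A; split.
Qed.

Lemma predictable_ray s A : 0 <= s -> F s A ->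
  predictable F (A `*` `]s, +oo[%classic).
Proof.
move=> s0 FA.
have -> : A `*` `]s, +oo[%classic = \bigcup_n (A `*` `]s, s + n.+1%:R]%classic).
  apply/seteqP; split=> [[w u] /= [Aw]|[w u] [n _] /= [Aw]].
    rewrite in_itv/= andbT => su.
    exists (Num.truncn (u - s)) => //=; split=> //; rewrite in_itv/= su/=.
    by rewrite -lerBlDl ltW// truncnS_gt.
  by rewrite !in_itv/= => /andP[-> _].
apply: (salg_bigcup pS) => n; apply: predictable_rect => //.
by rewrite ltrDl.
Qed.

(** A rational separates sigma from any later time, and the event that sigma
    has come by the time q belongs to [F q]. *)
Lemma predictable_after sigma : stopping_time F sigma ->
  predictable F [set p | 0 <= p.2 /\ (sigma p.1 < p.2%:E)%E].
Proof.
move=> [s0 Fs].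
have -> : [set p : Omega * R | 0 <= p.2 /\ (sigma p.1 < p.2%:E)%E] =
    \bigcup_(q : rat) (if 0 <= ratr q :> R then
      [set w | (sigma w <= (ratr q)%:E)%E] `*` `]ratr q, +oo[%classic else set0).
  apply/seteqP; split=> [[w u] /= [u0 su]|[w u] [q _]]; last first.
    case: ifPn => // q0 /= [sq]; rewrite in_itv/= andbT => qu; split.
      by rewrite (le_trans q0)// ltW.
    by rewrite (le_lt_trans sq)// lte_fin.
  have sfin : sigma w \is a fin_num.
    by rewrite ge0_fin_numE// (lt_le_trans su)// leey.
  move: su; rewrite -(fineK sfin) lte_fin => su.
  have [q] := rat_in_itvoo su; rewrite in_itv/= => /andP[sq qu].
  exists q => //; rewrite (le_trans _ (ltW sq)) ?fine_ge0//=.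
  by rewrite in_itv/= andbT qu -(fineK sfin) lee_fin ltW.
apply: (salg_bigcup_count pS) => q; case: ifPn => q0; last exact: salg0 pS.
by apply: predictable_ray => //; exact: Fs.
Qed.

Lemma predictable_upto sigma : stopping_time F sigma ->
  predictable F [set p | 0 <= p.2 /\ (p.2%:E <= sigma p.1)%E].
Proof.
move=> /predictable_after/(salgC pS); congr predictable.
apply/seteqP; split=> [p [/= p0 /not_andP[//|/negP]]|p /= [p0 ps]].
  by rewrite -leNgt.
by split=> // -[_]; apply/negP; rewrite -leNgt.
Qed.

Lemma predictable_graph sigma : predictable_time F sigma ->
  predictable F [set p | 0 <= p.2 /\ p.2%:E = sigma p.1].
Proof.
move=> [/predictable_upto ps pbefore].
have := salgD pS predictable_sub ps pbefore; congr predictable.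
apply/seteqP; split=> [p [/= [p0 ps'] /not_andP[//|/negP]]|p /= [p0 ps']].
  by rewrite -leNgt => sp; split=> //; apply/eqP; rewrite eq_le ps' sp.
by rewrite ps' lexx; split=> // -[_]; rewrite ltxx.
Qed.

Lemma predictable_measurable D : predictable F D -> measurable D.
Proof.
have mT : measurable [set p : Omega * R | 0 <= p.2].
  rewrite [X in measurable X](_ : _ = setT `*` `[0, +oo[%classic).
    by apply: measurableX => //; exact: measurable_itv.
  by apply/seteqP; split=> p /=; rewrite in_itv/= andbT// => -[].
suff : predictable F `<=` measurable by exact.
apply: smallest_sub.
  split=> [|A mA|A mA]; [exact: measurable0|exact: measurableD|].
  exact: bigcup_measurable.
move=> _ [[A FA ->]|[s [t [A [s0 st FA ->]]]]]; apply: measurableX => //.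
- exact: filt_meas FA.
- exact: filt_meas FA.
Qed.

(** A predictable process frozen at a stopping time is adapted: this is clear
    for the generating rectangles, and the property passes to the generated
    sigma-algebra. *)
Lemma predictable_stopped sigma D t : stopping_time F sigma -> 0 <= t ->
  predictable F D -> F t [set w | D (w, fine (Order.min t%:E (sigma w)))].
Proof.
move=> [s0 Fs] t0.
pose tau w := fine (Order.min t%:E (sigma w)).
have tauE w : (tau w)%:E = Order.min t%:E (sigma w).
  rewrite fineK// ge0_fin_numE ?le_min ?lee_fin ?t0 ?s0//.
  by rewrite gt_min ltry.
have tau0 w : 0 <= tau w by rewrite -lee_fin tauE le_min lee_fin t0 s0.
have Ftau u : 0 <= u -> F t [set w | tau w <= u].
  move=> u0; have [tu|ut] := leP t u.
    rewrite (_ : [set _ | _] = setT); first exact: filtT.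
    by apply/seteqP; split=> // w _ /=; rewrite -lee_fin tauE ge_min lee_fin tu.
  apply: (filt_le u0 (ltW ut)); rewrite (_ : [set _ | _] =
    [set w | (sigma w <= u%:E)%E]); first exact: Fs.
  apply/seteqP; split=> w /=; rewrite -lee_fin tauE ge_min lee_fin.
    by case/orP => //; rewrite leNgt ut.
  by move=> ->; rewrite orbT.
suff : predictable F `<=` [set D | F t [set w | D (w, tau w)]] by exact.
apply: smallest_sub => [|_ [[A FA ->]|[s [u [A [s00 su FA ->]]]]]] /=.
- split=> [|A /= FA|A FA] /=; first exact: filt0.
  + apply: (set_system_ext (filtC t0 FA)) => w /=; split=> [nA|[]//].
    by split=> //; exact: tau0.
  + apply: (set_system_ext (filt_bigcup t0 FA)) => w /=.
    by split=> -[n _ h]; exists n.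
- apply: (set_system_ext (filtI t0 (filt_le (lexx 0) t0 FA) (Ftau _ (lexx 0)))) => w /=.
  split=> -[Aw tw]; split=> //; last by rewrite tw.
  by apply/eqP; rewrite eq_le tw tau0.
- have [st|ts] := leP s t.
    apply: (set_system_ext (filtI t0 (filt_le s00 st FA)
      (filtI t0 (filtC t0 (Ftau _ s00)) (Ftau _ (le_trans s00 (ltW su)))))) => w /=.
    rewrite in_itv/=; split.
      by move=> [Aw [/negP]]; rewrite -ltNge => -> ->.
    by move=> [Aw /andP[sw ->]]; split=> //; split=> //; apply/negP; rewrite -ltNge.
  rewrite (_ : [set _ | _] = set0); first exact: filt0.
  apply/seteqP; split=> // w /= [_]; rewrite in_itv/= => /andP[sw _].
  have : ((tau w)%:E <= t%:E)%E by rewrite tauE ge_min lexx.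
  by rewrite lee_fin leNgt (lt_trans ts sw).
Qed.

Lemma predictable_process_stopped {dU} {U : measurableType dU}
    (Y : R -> Omega -> U) sigma t :
  predictable_process F Y -> stopping_time F sigma -> 0 <= t ->
  measurable_wrt setT (F t) (fun w => Y (fine (Order.min t%:E (sigma w))) w).
Proof.
move=> pY ss t0 B mB; rewrite setTI.
have := predictable_stopped ss t0 (pY _ mB); congr (F t).
apply/seteqP; split=> w /= => [[]//|Bw]; split=> //.
by rewrite fine_ge0// le_min lee_fin t0; case: ss => ->.
Qed.

End one_filtration.

Lemma predictable_le F G : (forall t, 0 <= t -> F t `<=` G t) ->
  predictable F `<=` predictable G.
Proof.
move=> FG; apply: sub_sigma_algebra2.
move=> _ [[A FA ->]|[s [t [A [s0 st FA ->]]]]].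
  by left; exists A => //; exact: FG FA.
by right; exists s, t, A; split=> //; exact: FG FA.
Qed.

Lemma predictable_process_le F G {dU} {U : measurableType dU}
    (Y : R -> Omega -> U) : (forall t, 0 <= t -> F t `<=` G t) ->
  predictable_process F Y -> predictable_process G Y.
Proof. by move=> FG pY B mB; apply: (predictable_le FG); exact: pY. Qed.

Lemma stopping_time_le F G sigma : (forall t, 0 <= t -> F t `<=` G t) ->
  stopping_time F sigma -> stopping_time G sigma.
Proof. by move=> FG [s0 Fs]; split=> // t t0; apply: FG => //; exact: Fs. Qed.

End filtration_facts.

(** * Random measures that differ by a martingale *)

Section predictable_rectangles.
Context {R : realType} {dO : measure_display} {Omega : measurableType dO}.
Context {dE : measure_display} {E : measurableType dE}.
Variable G : R -> set (set Omega).
Hypothesis rcG : rc_filtration G.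

(** The rectangles are closed under intersection, so that an induction by
    Dynkin's lemma can start from them. *)
Definition predictable_rectangles : set (set (Omega * (R * E))) :=
  [set C | exists s t A B, [/\ 0 <= s, G s A, measurable B &
    C = [set z | [/\ A z.1, s < z.2.1 <= t & B z.2.2]]]] `|`
  [set C | exists A B, [/\ G 0 A, measurable B &
    C = [set z | [/\ A z.1, z.2.1 = 0 & B z.2.2]]]].

Lemma predictable_rectanglesI : setI_closed predictable_rectangles.
Proof.
move=> C1 C2 [[s [t [A [B [s0 GA mB ->]]]]]|[A [B [GA mB ->]]]]
  [[s' [t' [A' [B' [s0' GA' mB' ->]]]]]|[A' [B' [GA' mB' ->]]]].
- left; exists (Num.max s s'), (Num.min t t'), (A `&` A'), (B `&` B'); split.
  + by rewrite le_max s0.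
  + have m0 : 0 <= Num.max s s' by rewrite le_max s0.
    apply: (filtI rcG m0).
      by apply: (filt_le rcG s0) GA; rewrite le_max lexx.
    by apply: (filt_le rcG s0') GA'; rewrite le_max lexx orbT.
  + exact: measurableI.
  + apply/seteqP; split=> -[w [u x]] /=.
      move=> [[Aw /andP[su ut] Bx] [Aw' /andP[su' ut'] Bx']]; split=> //.
      by rewrite gt_max le_min su su' ut ut'.
    by rewrite gt_max le_min => -[[? ?] /andP[/andP[-> ->] /andP[-> ->]] [? ?]].
- left; exists 0, 0, set0, set0; split=> //; first exact: filt0.
  apply/seteqP; split=> -[w [u x]] /=; last by case.
  move=> [[_ /andP[su _] _] [_ u0 _]].
  by move: su; rewrite u0 ltNge s0.
- left; exists 0, 0, set0, set0; split=> //; first exact: filt0.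
  apply/seteqP; split=> -[w [u x]] /=; last by case.
  move=> [[_ u0 _] [_ /andP[su _] _]].
  by move: su; rewrite u0 ltNge s0'.
- right; exists (A `&` A'), (B `&` B'); split.
  + exact: filtI.
  + exact: measurableI.
  + apply/seteqP; split=> -[w [u x]] /=; first by move=> [[? ? ?] [? ? ?]].
    by move=> [[? ?] ? [? ?]].
Qed.

Notation gen := <<s predictable_rectangles>>.
Let sgen : sigma_algebra setT gen := smallest_sigma_algebra _ _.
Let subgen C : gen C -> C `<=` setT. Proof. by []. Qed.

Lemma predictable_rectangles_cover :
  gen [set z | 0 <= z.2.1].
Proof.
have := salgU sgen
  (_ : gen [set z | [/\ setT z.1, z.2.1 = 0 & setT z.2.2]])
  (salg_bigcup sgen (fun n => (_ :
    gen [set z | [/\ setT z.1, 0 < z.2.1 <= n%:R & setT z.2.2]]))).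
move=> H; apply: (set_system_ext (H _ _)).
- by apply: sub_sigma_algebra; right; exists setT, setT; split=> //; exact: filtT.
- move=> n; apply: sub_sigma_algebra; left; exists 0, n%:R, setT, setT; split=> //.
  exact: filtT.
- move=> -[w [u x]] /=; split=> [[[_ -> _]//|[n _ [_ /andP[/ltW]]]]//|].
  rewrite le_eqVlt => /orP[/eqP <-|u0]; [by left|right].
  exists (Num.truncn u).+1 => //; split=> //.
  by rewrite u0/= ltW// truncnS_gt.
Qed.

Lemma predictable_prod_rectangles (C : set (Omega * (R * E))) :
  predictable_prod G C -> gen C.
Proof.
suff DB D (B : set E) : predictable G D -> measurable B ->
    gen [set z | D (z.1, z.2.1) /\ B z.2.2].
  suff : predictable_prod G `<=` gen by exact.
  apply: smallest_sub; last by move=> _ [D [B [pD mB ->]]]; exact: DB.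
  split; first exact: salg0 sgen.
    by move=> A; exact: (salgD sgen subgen) predictable_rectangles_cover.
  by move=> A; exact: salg_bigcup sgen _.
move=> pD mB.
suff : predictable G `<=` [set D | gen [set z | D (z.1, z.2.1) /\ B z.2.2]].
  exact.
apply: smallest_sub => [|_ [[A FA ->]|[s [t [A [s0 st FA ->]]]]]] /=.
- have gB : gen [set z | B z.2.2 /\ 0 <= z.2.1].
    have := salgU sgen
      (_ : gen [set z | [/\ setT z.1, z.2.1 = 0 & B z.2.2]])
      (salg_bigcup sgen (fun n => (_ :
        gen [set z | [/\ setT z.1, 0 < z.2.1 <= n%:R & B z.2.2]]))).
    move=> H; apply: (set_system_ext (H _ _)).
    + by apply: sub_sigma_algebra; right; exists setT, B; split=> //; exact: filtT.
    + move=> n; apply: sub_sigma_algebra; left; exists 0, n%:R, setT, B; split=> //.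
      exact: filtT.
    + move=> -[w [u x]] /=; split=> [[[_ -> ?]//|[n _ [_ /andP[/ltW]]]]//|[Bx]].
      rewrite le_eqVlt => /orP[/eqP <-|u0]; [by left|right].
      exists (Num.truncn u).+1 => //; split=> //.
      by rewrite u0/= ltW// truncnS_gt.
  split=> [|A /= gA|A gA] /=.
  + by apply: (set_system_ext (salg0 sgen)) => z; split=> // -[].
  + apply: (set_system_ext (salgD sgen subgen gB gA)) => z /=; split.
      by move=> [[Bz z0] nA]; split=> //; split=> // Az; exact: nA.
    by move=> [[z0 nA] Bz]; split=> // -[].
  + apply: (set_system_ext (salg_bigcup sgen gA)) => z /=; split.
      by move=> [n _ [An Bz]]; split=> //; exists n.
    by move=> [[n _ An] Bz]; exists n.
- apply: sub_sigma_algebra; right; exists A, B; split=> //.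
  by apply/seteqP; split=> z /=; [move=> [[? ?] ?]|move=> [? ? ?]].
- apply: sub_sigma_algebra; left; exists s, t, A, B; split=> //.
  by apply/seteqP; split=> z /=; rewrite in_itv/=; [move=> [[? ?] ?]|move=> [? ? ?]].
Qed.

Definition predictable_space := g_sigma_algebraType predictable_rectangles.

Lemma measurable_predictable_pair w :
  measurable_fun setT ((fun z => (w, z)) : R * E -> predictable_space).
Proof.
apply: (@measurability _ _ _ predictable_space _ _ predictable_rectangles) => //.
move=> _ [C [|] CE <-]; rewrite setTI.
  case: CE => s [t [A [B [s0 GA mB ->]]]].
  have [Aw|nAw] := pselect (A w).
    rewrite (_ : _ @^-1` _ = `]s, t]%classic `*` B).
      by apply: measurableX => //; exact: measurable_itv.
    by apply/seteqP; split=> z /=; rewrite in_itv/= => -[].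
  by rewrite (_ : _ @^-1` _ = set0)//; apply/seteqP; split=> z // [].
case: CE => A [B [GA mB ->]].
have [Aw|nAw] := pselect (A w).
  rewrite (_ : _ @^-1` _ = [set 0] `*` B); first exact: measurableX.
  by apply/seteqP; split=> z /= [].
by rewrite (_ : _ @^-1` _ = set0)//; apply/seteqP; split=> z // [].
Qed.

Lemma predictable_function_section (W : Omega * (R * E) -> \bar R) (w : Omega) :
  predictable_function G W ->
  measurable_fun [set z : R * E | 0 <= z.1] (fun z => W (w, z)).
Proof.
move=> pW _ B mB.
have := measurable_predictable_pair w measurableT
  (predictable_prod_rectangles (pW _ mB)).
by rewrite setTI.
Qed.

Section graph_measure.
Variables (m : {measure set (R * E) -> \bar R}) (c : \bar R) (w : Omega).

(** The image of m, cut at the time c, under [z |-> (w, z)].  With it the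
    integral of [W (w, .)] becomes the integral of W itself against a kernel
    from Omega to the predictable space. *)
Definition graph_measure (U : set predictable_space) : \bar R :=
  m [set z | [/\ 0 < z.1, (z.1%:E <= c)%E & U (w, z)]].

Lemma measurable_strip (D : set (R * E)) : measurable D ->
  measurable [set z : R * E | [/\ 0 < z.1, (z.1%:E <= c)%E & D z]].
Proof.
move=> mD.
rewrite (_ : [set z | _] =
    ([set t : R | 0 < t /\ (t%:E <= c)%E] `*` setT) `&` D); last first.
  by apply/seteqP; split=> z /=; [move=> [? ? ?]|move=> [[[? ?] ?] ?]].
apply: measurableI => //; apply: measurableX => //.
rewrite (_ : [set t | _] = `]0, +oo[%classic `&` (EFin @^-1` `]-oo, c]%classic)).
  apply: measurableI; first exact: measurable_itv.
  rewrite -[X in measurable X]setTI; apply: EFin_measurable => //.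
  exact: emeasurable_itv.
by apply/seteqP; split=> t /=; rewrite !in_itv/= andbT => -[].
Qed.

Let msec (U : set predictable_space) : measurable U ->
  measurable [set z | [/\ 0 < z.1, (z.1%:E <= c)%E & U (w, z)]].
Proof.
move=> mU; apply: measurable_strip.
by have := measurable_predictable_pair w measurableT mU; rewrite setTI.
Qed.

Let graph_measure0 : graph_measure set0 = 0%E.
Proof.
by rewrite /graph_measure (_ : [set z | _] = set0)//; apply/seteqP; split=> z //[].
Qed.

Let graph_measure_ge0 U : (0 <= graph_measure U)%E.
Proof. exact: measure_ge0. Qed.

Let graph_measure_sigma_additive : semi_sigma_additive graph_measure.
Proof.
move=> F mF tF mUF; rewrite /graph_measure.
rewrite (_ : [set z | _] = \bigcup_n
  [set z | [/\ 0 < z.1, (z.1%:E <= c)%E & F n (w, z)]]); last first.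
  apply/seteqP; split=> z /=; first by move=> [z0 zc [n _ Fz]]; exists n.
    move=> [n _ [z0 zc Fz]].
  by split=> //; exists n.
apply: measure_semi_sigma_additive => [n||].
- exact: msec.
- apply/trivIsetP => /= i j _ _ ij; apply/seteqP; split=> // z /=.
  move=> [[_ _ Fi] [_ _ Fj]].
  by move/trivIsetP : tF => /(_ i j Logic.I Logic.I ij)/seteqP[+ _] => /(_ (w, z)); apply.
- by apply: bigcup_measurable => n _; exact: msec.
Qed.

HB.instance Definition _ := isMeasure.Build _ _ _ graph_measure
  graph_measure0 graph_measure_ge0 graph_measure_sigma_additive.

End graph_measure.

End predictable_rectangles.

Lemma fine_le_id {R : realDomainType} (x : \bar R) :
  (0 <= x)%E -> ((fine x)%:E <= x)%E.
Proof. by case: x => [r| |]//= _; rewrite leey. Qed.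

Section random_measures.
Context {R : realType} {dO : measure_display} {Omega : measurableType dO}.
Context {dE : measure_display} {E : measurableType dE}.
Variables (P : probability Omega R) (G : R -> set (set Omega)).
Hypothesis rcG : rc_filtration G.
Variables (T : nat -> Omega -> \bar R) (N : set Omega).
Hypotheses (sT : forall n, stopping_time G (T n))
  (mN : measurable N) (N0 : P N = 0%E)
  (Tle : forall w, ~ N w -> forall n, (T n w <= T n.+1 w)%E)
  (Tlim : forall w, ~ N w -> T n w @[n --> \oo] --> +oo%E).

Definition stopped_mass (a : Omega -> {measure set (R * E) -> \bar R}) n t w
    (B : set E) : \bar R :=
  a w (`]0, fine (Order.min t%:E (T n w))]%classic `*` B).

Definition locally_integrable_measure
    (a : Omega -> {measure set (R * E) -> \bar R}) :=
  [/\ forall w, ~ N w -> a w [set z | z.1 <= 0] = 0%E,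
      forall n t B, 0 <= t -> measurable B ->
        measurable_fun setT (fun w => stopped_mass a n t w B),
      forall n t, 0 <= t -> (\int[P]_w stopped_mass a n t w setT < +oo)%E &
      forall n t w, ~ N w -> 0 <= t -> (stopped_mass a n t w setT < +oo)%E].

Local Notation Y := (@predictable_space _ _ Omega _ E G).

Local Notation rect s t A B :=
  [set z : Omega * (R * E) | [/\ A z.1, s < z.2.1 <= t & B z.2.2]].

(** Zero on N, so that finiteness and measurability hold for every w. *)
Definition trimmed_kernel (a : Omega -> {measure set (R * E) -> \bar R})
    (c : Omega -> \bar R) (w : Omega) : {measure set Y -> \bar R} :=
  let z : {measure set Y -> \bar R} := mzero in
  let m : {measure set Y -> \bar R} := graph_measure (a w) (c w) w in
  if w \in N then z else m.

(** The horizon n is added to the localizing time because masses are known to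
    be finite only up to finite times. *)
Definition window n w := Order.min n%:R%:E (T n w).

Lemma T_ge0 n w : (0 <= T n w)%E. Proof. by case: (sT n). Qed.

Lemma stopped_timeE n t w : 0 <= t ->
  (fine (Order.min t%:E (T n w)))%:E = Order.min t%:E (T n w).
Proof.
move=> t0; rewrite fineK// ge0_fin_numE ?le_min ?lee_fin ?t0 ?T_ge0//.
by rewrite gt_min ltry.
Qed.

Lemma in_stopped n t w (u : R) : 0 <= t ->
  u \in `]0, fine (Order.min t%:E (T n w))] =
  [&& 0 < u, u <= t & (u%:E <= T n w)%E].
Proof.
by move=> t0; rewrite in_itv/= -lee_fin stopped_timeE// le_min lee_fin.
Qed.

Lemma measurable_stopped n t w (B : set E) : measurable B ->
  measurable (`]0, fine (Order.min t%:E (T n w))]%classic `*` B).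
Proof. by move=> mB; apply: measurableX => //; exact: measurable_itv. Qed.

Section one_measure.
Variable a : Omega -> {measure set (R * E) -> \bar R}.
Hypothesis ha : locally_integrable_measure a.

Lemma stopped_mass_fin n t w B : ~ N w -> 0 <= t -> measurable B ->
  stopped_mass a n t w B \is a fin_num.
Proof.
case: ha => _ _ _ h Nw t0 mB; rewrite ge0_fin_numE//.
apply: le_lt_trans (h n t w Nw t0); apply: le_measure; rewrite ?inE.
- exact: measurable_stopped.
- exact: measurable_stopped.
- by move=> [u x] [].
Qed.

Lemma stopped_mass_integrable n t B : 0 <= t -> measurable B ->
  P.-integrable setT (fun w => (fine (stopped_mass a n t w B))%:E).
Proof.
move=> t0 mB; have [_ h1 h2 h3] := ha.
have mf : measurable_fun setT (fun w => (fine (stopped_mass a n t w B))%:E).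
  by apply/measurable_EFinP; apply: measurableT_comp => //; exact: h1.
apply/integrableP; split => //.
apply: le_lt_trans (h2 n t t0); apply: ge0_le_integral => //.
- exact: measurableT_comp.
- exact: h1.
- move=> w _; rewrite /= ger0_norm ?fine_ge0//.
  apply: (@le_trans _ _ (stopped_mass a n t w B)).
    by apply: fine_le_id; exact: measure_ge0.
  apply: le_measure; rewrite ?inE; try exact: measurable_stopped.
  by move=> [u x] [].
Qed.

(** A rectangle on ]s, t] seen through the window carries the increment of
    the stopped mass between s and t cut at the horizon; for t < s both ends
    are s and the increment vanishes, as it should. *)
Lemma graph_measure_rect n (s t : R) A (B : set E) w : ~ N w -> 0 <= s -> measurable B ->
  let s' := Num.min s n%:R in let t' := Num.min n%:R (Num.max s t) in
  @graph_measure _ _ _ _ _ G (a w) (window n w) w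
    (rect s t A B) =
  (\1_A w * (fine (stopped_mass a n t' w B) - fine (stopped_mass a n s' w B)))%:E.
Proof.
move=> Nw s0 mB s' t'.
have s'0 : 0 <= s' by rewrite le_min s0 ler0n.
have t'0 : 0 <= t' by rewrite le_min ler0n le_max s0.
have s't' : s' <= t' by rewrite le_min !ge_min !le_max !lexx !orbT.
rewrite /graph_measure/=.
have [Aw|nAw] := pselect (A w); last first.
  rewrite indicE memNset// mul0r (_ : [set z | _] = set0) ?measure0//.
  by apply/seteqP; split=> z //= [_ _ []].
rewrite indicE mem_set// mul1r EFinB !fineK; [|exact: stopped_mass_fin..].
set D := [set z | _].
have DE : D = (`]0, fine (Order.min t'%:E (T n w))]%classic `*` B) `\`
              (`]0, fine (Order.min s'%:E (T n w))]%classic `*` B).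
  apply/seteqP; split=> -[u x] /=.
    rewrite /D/= !in_stopped// le_min lee_fin => -[u0 /andP[un uT] [_ /andP[su ut] Bx]].
    rewrite u0 uT le_min un le_max ut orbT; split=> //.
    by move=> [/and3P[_ us _] _]; move: us; rewrite le_min leNgt su.
  rewrite /D/= !in_stopped// => -[[/and3P[u0 ut' uT] Bx]].
  rewrite u0 uT/= andbT => /not_andP[|//] /negP.
  move: ut'; rewrite !le_min le_max => /andP[un ust]; rewrite un andbT -ltNge => su.
  split=> //; first by rewrite lee_fin un.
  by rewrite su; move: ust; rewrite leNgt su.
rewrite DE measureD.
- congr (_ - _)%E; rewrite setIidr// => -[u x] /=; rewrite !in_stopped//.
  by move=> [/and3P[-> us ->] ?]; rewrite (le_trans us s't').
- exact: measurable_stopped.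
- exact: measurable_stopped.
- by have := stopped_mass_fin n Nw t'0 mB; rewrite ge0_fin_numE.
Qed.

Lemma graph_measureT n w :
  @graph_measure _ _ _ _ _ G (a w) (window n w) w setT =
  @graph_measure _ _ _ _ _ G (a w) (window n w) w
    [set z | [/\ setT z.1, 0 < z.2.1 <= n%:R & setT z.2.2]].
Proof.
rewrite /graph_measure; congr (a w _); apply/seteqP; split=> z /= [z0 zc _] //.
by split=> //; split=> //; move: zc; rewrite z0 le_min lee_fin => /andP[].
Qed.

Lemma trimmed_kernel_fin n w (U : set Y) : measurable U ->
  trimmed_kernel a (window n) w U \is a fin_num.
Proof.
move=> mU; rewrite /trimmed_kernel; case: ifPn => [_|/negP]; first by rewrite /= /mzero.
rewrite in_setE => Nw; rewrite ge0_fin_numE//.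
apply: (@le_lt_trans _ _ (@graph_measure _ _ _ _ _ G (a w) (window n w) w setT)).
  by apply: le_measure => //; rewrite ?inE//; exact: measurableT.
by rewrite graph_measureT graph_measure_rect// ltry.
Qed.

Lemma trimmed_kernel_rectE n (s t : R) A (B : set E) w : 0 <= s -> measurable B ->
  let s' := Num.min s n%:R in let t' := Num.min n%:R (Num.max s t) in
  trimmed_kernel a (window n) w (rect s t A B) =
  (\1_(A `\` N) w * (fine (stopped_mass a n t' w B) - fine (stopped_mass a n s' w B)))%:E.
Proof.
move=> s0 mB s' t'; rewrite /trimmed_kernel.
case: ifPn => [/set_mem Nw|/negP]; last rewrite in_setE => Nw.
  by rewrite indicE memNset ?mul0r// => -[].
apply: etrans (graph_measure_rect n t A Nw s0 mB) _.
by rewrite !indicE in_setD (memNset Nw)/= andbT.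
Qed.


Lemma trimmed_kernel_rect_measurable n (s t : R) A (B : set E) : 0 <= s -> measurable A ->
  measurable B -> measurable_fun setT (fun w => trimmed_kernel a (window n) w
    (rect s t A B)).
Proof.
move=> s0 mA mB; under eq_fun do rewrite trimmed_kernel_rectE//.
have [_ h1 _ _] := ha.
apply/measurable_EFinP/measurable_funM.
  by apply: measurable_indic; exact: measurableD.
have m0 (x : R) : 0 <= x -> measurable_fun setT (fun w => fine (stopped_mass a n x w B)).
  by move=> x0; apply: measurableT_comp => //; exact: h1.
by apply: measurable_funB; apply: m0; rewrite le_min ?ler0n ?s0// le_max s0.
Qed.

Lemma trimmed_kernel_rect_integral n (s t : R) A (B : set E) : 0 <= s -> measurable A ->
  measurable B ->
  let s' := Num.min s n%:R in let t' := Num.min n%:R (Num.max s t) in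
  (\int[P]_w trimmed_kernel a (window n) w
    (rect s t A B) =
  \int[P]_(w in A) (fine (stopped_mass a n t' w B))%:E -
  \int[P]_(w in A) (fine (stopped_mass a n s' w B))%:E)%E.
Proof.
move=> s0 mA mB s' t'.
have s'0 : 0 <= s' by rewrite le_min s0 ler0n.
have t'0 : 0 <= t' by rewrite le_min ler0n le_max s0.
have iA x : 0 <= x -> P.-integrable A (fun w => (fine (stopped_mass a n x w B))%:E).
  by move=> x0; apply: integrableS (stopped_mass_integrable n x0 mB).
have := integralB_EFin mA (iA _ t'0) (iA _ s'0) => /= <-.
rewrite [RHS]integral_mkcond; apply: ae_eq_integral => //.
- exact: trimmed_kernel_rect_measurable.
- apply/measurable_restrict => //; rewrite setTI.
  have mf x : 0 <= x -> measurable_fun A (fun w => fine (stopped_mass a n x w B)).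
    by move=> /iA/integrableP[/measurable_EFinP].
  by apply: emeasurable_funD; apply/measurable_EFinP; [|apply: measurableT_comp => //];
    exact: mf.
- exists N; split=> // w; apply: contra_notP => Nw _.
  rewrite trimmed_kernel_rectE// patchE indicE in_setD (memNset Nw) andbT.
  by case: ifPn => _; rewrite ?mul1r ?mul0r.
Qed.

Lemma trimmed_kernel_cvg w (U : set Y) : measurable U ->
  trimmed_kernel a (window n) w U @[n --> \oo] --> trimmed_kernel a (cst +oo%E) w U.
Proof.
move=> mU; rewrite /trimmed_kernel; case: ifPn => [_|/negP]; first exact: cvg_cst.
rewrite in_setE => Nw /=.
pose S c := [set z : R * E | [/\ 0 < z.1, (z.1%:E <= c)%E & U (w, z)]].
have mS c : measurable (S c).
  apply: measurable_strip.
  by have := measurable_predictable_pair w measurableT mU; rewrite setTI.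
have ST : S +oo%E = \bigcup_n S (window n w).
  apply/seteqP; split=> [z [z0 _ Uz]|z [n _ [z0 _ Uz]]]; last by split; rewrite ?leey.
  have /cvgeyPge/(_ z.1) [k _ kT] := Tlim Nw.
  exists (maxn k (Num.truncn z.1).+1) => //; split=> //.
  rewrite le_min lee_fin kT /= ?leq_maxl// andbT.
  by rewrite (le_trans (ltW (truncnS_gt z.1)))// ler_nat leq_maxr.
rewrite /graph_measure -/(S +oo%E) ST.
apply: (@nondecreasing_cvg_mu _ _ _ (a w) (fun n => S (window n w))) => //.
  by rewrite -ST; exact: mS.
have nT m n : (m <= n)%N -> (T m w <= T n w)%E.
  move=> mn; have /nondecreasing_seqP : forall n, (T n w <= T n.+1 w)%E by exact: Tle.
  exact.
move=> m n mn; apply/subsetPset => z [z0 zm Uz]; split=> //.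
move: zm; rewrite !le_min => /andP[zm zT]; apply/andP; split.
  by rewrite (le_trans zm)// lee_fin ler_nat.
by rewrite (le_trans zT)// nT.
Qed.

Lemma trimmed_kernel_le w (U : set Y) : measurable U ->
  {homo (fun n => trimmed_kernel a (window n) w U) : m n / (m <= n)%N >-> (m <= n)%E}.
Proof.
move=> mU m n mn; rewrite /trimmed_kernel; case: ifPn => [_//|/negP].
rewrite in_setE => Nw /=.
have nT : (T m w <= T n w)%E.
  have /nondecreasing_seqP : forall n, (T n w <= T n.+1 w)%E by exact: Tle.
  exact.
have mS c : measurable [set z : R * E | [/\ 0 < z.1, (z.1%:E <= c)%E & U (w, z)]].
  apply: measurable_strip.
  by have := measurable_predictable_pair w measurableT mU; rewrite setTI.
apply: le_measure; rewrite ?inE// => z [z0 zm Uz]; split=> //.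
move: zm; rewrite !le_min => /andP[zm zT]; apply/andP; split.
  by rewrite (le_trans zm)// lee_fin ler_nat.
by rewrite (le_trans zT)// nT.
Qed.

End one_measure.

(** For filtrations and stopped masses, this is the martingale property of the
    difference of the two stopped masses, freed from path regularity. *)
Definition same_martingale_part a b := forall n B s t A, measurable B ->
  0 <= s -> s <= t -> G s A ->
  (\int[P]_(w in A) (fine (stopped_mass a n t w B) - fine (stopped_mass b n t w B))%:E =
   \int[P]_(w in A) (fine (stopped_mass a n s w B) - fine (stopped_mass b n s w B))%:E)%E.

Section two_measures.
Variables a b : Omega -> {measure set (R * E) -> \bar R}.
Hypotheses (ha : locally_integrable_measure a) (hb : locally_integrable_measure b).
Hypothesis hab : same_martingale_part a b.

Lemma trimmed_kernel_rect_eq n s t A B : 0 <= s -> G s A -> measurable B ->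
  (\int[P]_w trimmed_kernel a (window n) w (rect s t A B) =
   \int[P]_w trimmed_kernel b (window n) w (rect s t A B))%E.
Proof.
move=> s0 GA mB; have mA := filt_meas rcG s0 GA.
rewrite !trimmed_kernel_rect_integral//.
set t' := Num.min n%:R (Num.max s t); set s' := Num.min s n%:R.
have s'0 : 0 <= s' by rewrite le_min s0 ler0n.
have t'0 : 0 <= t' by rewrite le_min ler0n le_max s0.
have iA c x : locally_integrable_measure c -> 0 <= x ->
    P.-integrable A (fun w => (fine (stopped_mass c n x w B))%:E).
  by move=> hc x0; apply: integrableS (stopped_mass_integrable hc n x0 mB).
have fA c x : locally_integrable_measure c -> 0 <= x ->
    (\int[P]_(w in A) (fine (stopped_mass c n x w B))%:E)%E \is a fin_num.
  by move=> hc x0; apply: integrable_fin_num => //; exact: iA.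
have [sn|ns] := leP s n%:R; last first.
  rewrite (_ : t' = s'); first by rewrite !subee// fA.
  rewrite /t' /s' [in RHS]min_r; last exact: ltW.
  by rewrite min_l// le_max (ltW ns).
have s's : s' = s by rewrite /s' min_l.
have s't' : s <= t' by rewrite le_min le_max sn lexx.
have := hab n mB s0 s't' GA.
under eq_integral do rewrite EFinB.
under [in RHS]eq_integral do rewrite EFinB.
rewrite (integralB_EFin mA (iA _ _ ha t'0) (iA _ _ hb t'0)).
rewrite (integralB_EFin mA (iA _ _ ha s0) (iA _ _ hb s0)).
rewrite s's => eqI.
move: (fA a _ ha t'0) (fA b _ hb t'0) (fA a _ ha s0) (fA b _ hb s0) eqI.
move: (integral _ _ _) (integral _ _ _) (integral _ _ _) (integral _ _ _).
move=> [x1| |] [x2| |] [x3| |] [x4| |]// _ _ _ _ /eqP; rewrite -!EFinB eqe.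
by move=> /eqP e; congr (_%:E); lra.
Qed.

Lemma trimmed_kernel_zero c n A B w :
  trimmed_kernel c (window n) w
    [set z : Omega * (R * E) | [/\ A z.1, z.2.1 = 0 & B z.2.2]] = 0%E.
Proof.
rewrite /trimmed_kernel; case: ifPn => // _ /=.
rewrite /graph_measure (_ : [set z | _] = set0) ?measure0//.
by apply/seteqP; split=> // z /= [z0 _ [_ zz _]]; move: z0; rewrite zz ltxx.
Qed.

Lemma trimmed_kernelTE c n w : trimmed_kernel c (window n) w setT =
  trimmed_kernel c (window n) w (rect 0 n%:R setT setT).
Proof.
rewrite /trimmed_kernel; case: ifPn => // _ /=; exact: graph_measureT.
Qed.

Definition agree n (U : set Y) :=
  [/\ measurable_fun setT (fun w => trimmed_kernel a (window n) w U),
      measurable_fun setT (fun w => trimmed_kernel b (window n) w U) &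
      (\int[P]_w trimmed_kernel a (window n) w U =
       \int[P]_w trimmed_kernel b (window n) w U)%E].

Lemma agree_rect n s t A B : 0 <= s -> G s A -> measurable B ->
  agree n (rect s t A B).
Proof.
move=> s0 GA mB; have mA := filt_meas rcG s0 GA; split.
- exact: trimmed_kernel_rect_measurable.
- exact: trimmed_kernel_rect_measurable.
- exact: trimmed_kernel_rect_eq.
Qed.

Lemma agreeT n : agree n setT.
Proof.
have [ma mb e] := agree_rect n n%:R (lexx 0) (filtT rcG (lexx 0)) measurableT.
split; [move: ma|move: mb|move: e].
- by under [X in _ -> measurable_fun _ X]eq_fun do rewrite trimmed_kernelTE.
- by under [X in _ -> measurable_fun _ X]eq_fun do rewrite trimmed_kernelTE.
- move=> e; under eq_integral do rewrite trimmed_kernelTE.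
  by under [RHS]eq_integral do rewrite trimmed_kernelTE.
Qed.

Lemma trimmed_kernel_mass c n : locally_integrable_measure c ->
  (\int[P]_w trimmed_kernel c (window n) w setT < +oo)%E.
Proof.
move=> hc; under eq_integral do rewrite trimmed_kernelTE.
rewrite trimmed_kernel_rect_integral// ltey_eq.
have iA x : 0 <= x -> P.-integrable setT (fun w => (fine (stopped_mass c n x w setT))%:E).
  by move=> x0; exact: (stopped_mass_integrable hc n x0 measurableT).
by rewrite fin_numB !integrable_fin_num//; apply: iA; rewrite le_min ler0n ?lexx// le_max lexx.
Qed.

(** Dynkin's lemma on rectangles; inside a window all masses are finite and
    complements can be subtracted. *)
Lemma agree_all n U : measurable U -> agree n U.
Proof.
have trimC c (V : set Y) w : locally_integrable_measure c -> measurable V ->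
    trimmed_kernel c (window n) w (~` V) =
    (trimmed_kernel c (window n) w setT - trimmed_kernel c (window n) w V)%E.
  move=> hc mV; rewrite -setTD measureD//; last first.
    by have := trimmed_kernel_fin hc n w measurableT; rewrite ge0_fin_numE.
  by rewrite setTI.
have [maT mbT abT] := agreeT n.
apply: (@dynkin_induction _ Y (@predictable_rectangles R _ Omega _ E G)) => //.
- exact: predictable_rectanglesI.
- move=> _ [[s [t [A [B [s0 GA mB ->]]]]]|[A [B [GA mB ->]]]].
    exact: agree_rect.
  split.
  + under eq_fun do rewrite trimmed_kernel_zero.
    exact: measurable_cst.
  + under eq_fun do rewrite trimmed_kernel_zero.
    exact: measurable_cst.
  + under eq_integral do rewrite trimmed_kernel_zero.
    by under [RHS]eq_integral do rewrite trimmed_kernel_zero.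
- move=> V mV [ma mb ab].
  have intC c : locally_integrable_measure c ->
      measurable_fun setT (fun w => trimmed_kernel c (window n) w setT) ->
      measurable_fun setT (fun w => trimmed_kernel c (window n) w V) ->
      (\int[P]_w trimmed_kernel c (window n) w (~` V) =
       \int[P]_w trimmed_kernel c (window n) w setT -
       \int[P]_w trimmed_kernel c (window n) w V)%E.
    move=> hc mT mVc; under eq_integral do rewrite trimC//.
    have i1 : P.-integrable setT (fun w => trimmed_kernel c (window n) w setT).
      apply/integrableP; split=> //.
      under eq_integral do rewrite gee0_abs//.
      exact: trimmed_kernel_mass.
    have i2 : P.-integrable setT (fun w => trimmed_kernel c (window n) w V).
      apply: le_integrable i1 => // w _; rewrite !gee0_abs//.
      by apply: le_measure; rewrite ?inE//; exact: measurableT.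
    exact: integralB.
  split.
  + under eq_fun do rewrite trimC//.
    exact: emeasurable_funB.
  + under eq_fun do rewrite trimC//.
    exact: emeasurable_funB.
  + by rewrite !intC// abT ab.
- move=> F mF tF hF.
  have trimU c w : trimmed_kernel c (window n) w (\bigcup_k F k) =
      (\sum_(k <oo) trimmed_kernel c (window n) w (F k))%E.
    by apply: measure_semi_bigcup => //; exact: bigcup_measurable.
  split.
  + under eq_fun do rewrite trimU.
    by apply: ge0_emeasurable_sum => // k _; case: (hF k).
  + under eq_fun do rewrite trimU.
    by apply: ge0_emeasurable_sum => // k _; case: (hF k).
  + under eq_integral do rewrite trimU.
    under [RHS]eq_integral do rewrite trimU.
    rewrite !integral_nneseries//; last 2 first.
    * by move=> k; case: (hF k).
    * by move=> k; case: (hF k).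
    by apply: eq_eseriesr => k _; case: (hF k).
Qed.

Let full c := trimmed_kernel c (cst +oo%E).

Lemma full_agree U : measurable U ->
  [/\ measurable_fun setT (fun w => full a w U),
      measurable_fun setT (fun w => full b w U) &
      (\int[P]_w full a w U = \int[P]_w full b w U)%E].
Proof.
move=> mU.
have hlim c w : full c w U = limn (fun n => trimmed_kernel c (window n) w U).
  by apply/esym/cvg_lim => //; exact: trimmed_kernel_cvg.
have ma n : measurable_fun setT (fun w => trimmed_kernel a (window n) w U).
  by case: (agree_all n mU).
have mb n : measurable_fun setT (fun w => trimmed_kernel b (window n) w U).
  by case: (agree_all n mU).
split.
- by apply: (emeasurable_fun_cvg _ _ ma) => w _; exact: trimmed_kernel_cvg.
- by apply: (emeasurable_fun_cvg _ _ mb) => w _; exact: trimmed_kernel_cvg.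
- under eq_integral do rewrite hlim.
  under [RHS]eq_integral do rewrite hlim.
  rewrite !monotone_convergence//; last 2 first.
  + by move=> w _ m n; exact: trimmed_kernel_le.
  + by move=> w _ m n; exact: trimmed_kernel_le.
  by congr (limn _); apply/funext => n; case: (agree_all n mU).
Qed.

(** The two kernels have the same averages on predictable sets, by letting the
    windows grow, and therefore on nonnegative predictable functions.  The
    functions f and g are measurable versions of the inner integrals, which are
    needed later to add two such identities. *)
Lemma predictable_integral_eq (W : Omega * (R * E) -> \bar R) :
  (forall z, 0 <= W z)%E -> predictable_function G W ->
  exists f g : Omega -> \bar R,
  [/\ measurable_fun setT f, measurable_fun setT g,
      (forall w, ~ N w ->
         f w = \int[a w]_(z in [set z | (0 <= z.1)%R]) W (w, z))%E,
      (forall w, ~ N w ->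
         g w = \int[b w]_(z in [set z | (0 <= z.1)%R]) W (w, z))%E &
      [/\ forall w, (0 <= f w)%E, forall w, (0 <= g w)%E &
        (\int[P]_w f w = \int[P]_w g w)%E]].
Proof.
move=> W0 pW.
pose D : set Y := [set z : Omega * (R * E) | 0 <= z.2.1].
have mD : measurable D by exact: predictable_rectangles_cover.
pose V : Y -> \bar R := W \_ D.
have V0 z : (0 <= V z)%E by rewrite /V patchE; case: ifPn.
have mV : measurable_fun setT V.
  apply/(measurable_restrict _ mD measurableT); rewrite setTI.
  by move=> _ B mB; exact: (predictable_prod_rectangles rcG (pW _ mB)).
have fullE c w : locally_integrable_measure c -> ~ N w ->
    (\int[full c w]_z V z = \int[c w]_(z in [set z | (0 <= z.1)%R]) W (w, z))%E.
  move=> [c0 _ _ _] Nw.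
  have mw := @measurable_predictable_pair R _ Omega _ E G w.
  have mneg : measurable [set z : R * E | z.1 <= 0].
    rewrite (_ : [set z | _] = `]-oo, 0]%classic `*` setT).
      exact: (measurableX (measurable_itv _) (@measurableT _ E)).
    by apply/seteqP; split=> z /=; rewrite in_itv/= => // -[].
  transitivity (\int[pushforward (c w) (fun z => (w, z) : Y)]_z V z)%E.
    apply: eq_measure_integral => U mU _.
    rewrite /full /trimmed_kernel memNset//= /graph_measure /pushforward.
    have mUw : measurable ((fun z => (w, z) : Y) @^-1` U).
      by rewrite -[X in measurable X]setTI; exact: mw.
    rewrite -[RHS](measureU0 mUw mneg (c0 w Nw)).
    have mS := measurable_strip +oo%E mUw.
    rewrite -[LHS](measureU0 mS mneg (c0 w Nw)).
    congr (c w _); apply/seteqP; split=> z /=.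
      by move=> [[z0 _ Uz]|]; [left|right].
    move=> [Uz|]; last by right.
    by have [z0|z0] := leP z.1 0; [right|left; split=> //; rewrite leey].
  rewrite (ge0_integral_pushforward mw)//.
  rewrite preimage_setT [RHS]integral_mkcond.
  by apply: eq_integral => z _; rewrite /V/= !patchE.
exists (fun w => \int[full a w]_z V z)%E, (fun w => \int[full b w]_z V z)%E.
split.
- by apply: measurable_fun_integral_kernel => // U /full_agree[].
- by apply: measurable_fun_integral_kernel => // U /full_agree[].
- by move=> w Nw; rewrite fullE.
- by move=> w Nw; rewrite fullE.
- split; [by move=> w; exact: integral_ge0|by move=> w; exact: integral_ge0|].
  by apply: eq_integral_kernel => // U /full_agree[].
Qed.

End two_measures.

End random_measures.

(** * The progressive enlargement before tau *)

Section progressive_enlargement_facts.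
Context {R : realType} {dO : measure_display} {Omega : measurableType dO}.
Variables (F : R -> set (set Omega)) (tau : Omega -> \bar R).
Hypotheses (rcF : rc_filtration F) (mtau : measurable_fun setT tau)
  (tau_gt0 : forall w, (0 < tau w)%E).

Local Notation G := (progressive_enlargement F tau).

Lemma progressive_enlargement_le t : 0 <= t -> F t `<=` G t.
Proof. by move=> t0 A FA K rcK FK sK; exact: FK FA. Qed.

Lemma measurable_rc_filtration : rc_filtration (fun _ : R => @measurable _ Omega).
Proof.
split=> [t _|s t _ _ A //|t t0 A h]; first by split=> //; exact: sigma_algebra_measurable.
by apply: (h (t + 1)); rewrite /= ltrDl.
Qed.

Lemma progressive_enlargement_rc : rc_filtration G.
Proof.
split=> [t t0|s t s0 st A GA|t t0 A GA].
- split.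
  + split=> [|A GA|A GA] K rcK FK sK.
    * exact: filt0.
    * by rewrite setTD; apply: filtC => //; exact: GA.
    * by apply: filt_bigcup => // n; exact: GA.
  + move=> A GA; apply: (GA (fun=> measurable)); first exact: measurable_rc_filtration.
      by move=> s s0 B; exact: filt_meas.
    split=> [w|s s0]; first exact: ltW.
    rewrite -[X in measurable X]setTI.
    exact: (emeasurable_fun_infty_c measurableT mtau).
- by move=> K rcK FK sK; apply: (filt_le rcK s0 st); exact: GA.
- move=> K rcK FK sK; apply: (filt_rc rcK t0) => s ts.
  exact: (GA s ts K).
Qed.

(** Before tau the enlargement brings nothing new.  The sets that agree on
    [s < tau] with a set of F s form a right-continuous filtration that makes
    tau a stopping time, so that it contains the smallest one. *)
Lemma progressive_enlargement_trace s A : 0 <= s -> G s A ->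
  exists2 A', F s A' & forall w, (s%:E < tau w)%E -> (A w <-> A' w).
Proof.
pose tr t A := exists2 A', F t A' & forall w, (t%:E < tau w)%E -> (A w <-> A' w).
pose K t := [set A | measurable A /\ tr t A].
have trF t B : 0 <= t -> F t B -> tr t B by move=> t0 FB; exists B.
suff rcK : rc_filtration K.
  move=> s0 /(_ K rcK)[]//.
  - by move=> t t0 B FB; split; [exact: filt_meas FB|exact: trF].
  - split=> [w|t t0]; first exact: ltW.
    split.
      rewrite -[X in measurable X]setTI.
      exact: (emeasurable_fun_infty_c measurableT mtau).
    exists set0; first exact: filt0.
    by move=> w tw; split=> //=; rewrite leNgt tw.
split=> [t t0|t u t0 tu B [mB [B' FB BB']]|t t0 B KB].
- split; last by move=> B [].
  split.
  + by split => //; apply: trF => //; exact: filt0.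
  + move=> B [mB [B' FB BB']]; rewrite setTD; split; first exact: measurableC.
    exists (~` B'); first exact: filtC.
    by move=> w /BB' h /=; rewrite h.
  + move=> B KB; split; first by apply: bigcup_measurable => n _; case: (KB n).
    have /choice[B' hB'] : forall n, exists C,
        F t C /\ forall w, (t%:E < tau w)%E -> (B n w <-> C w).
      by move=> n; have [_ [C FC CB]] := KB n; exists C.
    exists (\bigcup_n B' n); first by apply: filt_bigcup => // n; case: (hB' n).
    by move=> w tw; split=> -[n _ h]; exists n => //; apply/(hB' n).2.
- split=> //; exists B'; first exact: filt_le FB.
  by move=> w uw; apply: BB'; rewrite (le_lt_trans _ uw)// lee_fin.
- pose e (n : nat) : R := t + n.+1%:R^-1.
  have te n : t < e n by rewrite ltrDl invr_gt0.
  have ele n m : (n <= m)%N -> e m <= e n.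
    by move=> nm; rewrite lerD2l lef_pV2 ?posrE// ler_nat.
  split; first by have [] := KB _ (te 0%N).
  have /choice[B' hB'] : forall n, exists C,
      F (e n) C /\ forall w, ((e n)%:E < tau w)%E -> (B w <-> C w).
    by move=> n; have [_ [C FC CB]] := KB _ (te n); exists C.
  exists (\bigcup_m \bigcap_n B' (m + n)%N).
    apply: (filt_rc rcF t0) => u tu.
    have u0 : 0 <= u by rewrite (le_trans t0)// ltW.
    pose m0 := Num.truncn (u - t)^-1.
    have m0u : e m0 <= u.
      rewrite -lerBrDl invf_ple ?posrE ?subr_gt0//.
      by rewrite ltW// truncnS_gt.
    have FB' n : F u (B' (m0 + n)%N).
      apply: (@filt_le _ _ _ _ rcF (e (m0 + n)%N)).
      - by rewrite (le_trans t0)// ltW.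
      - by rewrite (le_trans _ m0u)// ele// leq_addr.
      - by case: (hB' (m0 + n)%N).
    apply: (@set_system_ext _ _ (\bigcup_m \bigcap_n B' (m0 + (m + n))%N)).
      by apply: filt_bigcup => // m; apply: filt_bigcap.
    move=> w; split=> -[m _ h].
      by exists (m0 + m)%N => // n _; rewrite -addnA; exact: h.
    exists m => // n _; have := h (m0 + n)%N Logic.I.
    by rewrite addnCA.
  move=> w tw.
  have [m0 hm0] : exists m0, forall n, (m0 <= n)%N -> ((e n)%:E < tau w)%E.
    case: (tau w) tw => [r| |]//; last by move=> _; exists 0%N => n _; exact: ltry.
    rewrite lte_fin => tr'.
    exists (Num.truncn (r - t)^-1) => n nn; rewrite lte_fin.
    apply: (le_lt_trans (ele _ _ nn)).
    rewrite -ltrBrDl invf_plt ?posrE ?subr_gt0//; exact: truncnS_gt.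
  split=> [Bw|[m _ h]].
    exists m0 => // n _; apply/(hB' (m0 + n)%N).2 => //; apply: hm0.
    exact: leq_addr.
  by have [_ /(_ w (hm0 _ (leq_addl _ _))) ->] := hB' (m + m0)%N; exact: h.
Qed.

(** A generator A x ]s, t] meets [0, tau] only where s < tau, and there A can be
    exchanged for an element of [F s]. *)
Lemma predictable_trace D : predictable G D ->
  exists2 D', predictable F D' &
    forall w t, (t%:E <= tau w)%E -> (D (w, t) <-> D' (w, t)).
Proof.
pose tr (D : set (Omega * R)) := exists2 D', predictable F D' &
    forall w t, (t%:E <= tau w)%E -> (D (w, t) <-> D' (w, t)).
have sF := predictable_salg F.
suff : predictable G `<=` tr by exact.
apply: smallest_sub => [|_ [[A GA ->]|[s [t [A [s0 st GA ->]]]]]].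
- split.
  + by exists set0 => //; exact: salg0 sF.
  + move=> B [B' pB' BB']; exists ([set p | 0 <= p.2] `\` B').
      exact: salgC sF _ pB'.
    by move=> w t tw; split=> -[t0 nB]; split=> // /(BB' _ _ tw).
  + move=> B trB.
    have /choice[B' hB'] : forall n, exists C, predictable F C /\
        forall w t, (t%:E <= tau w)%E -> (B n (w, t) <-> C (w, t)).
      by move=> n; have [C FC CB] := trB n; exists C.
    exists (\bigcup_n B' n).
      by apply: (salg_bigcup sF) => n; case: (hB' n).
    by move=> w t tw; split=> -[n _ h]; exists n => //; apply/(hB' n).2.
- have [A' FA' AA'] := progressive_enlargement_trace (lexx 0) GA.
  exists (A' `*` [set 0]); first exact: predictable_rect0.
  by move=> w t tw /=; split=> -[Aw t0]; split=> //; apply/(AA' w).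
- have [A' FA' AA'] := progressive_enlargement_trace s0 GA.
  exists (A' `*` `]s, t]%classic); first exact: predictable_rect.
  move=> w u uw /=; rewrite in_itv/=.
  split=> -[Aw /andP[su ut]]; (split; last by rewrite su ut);
    by apply/(AA' w) => //; rewrite (lt_le_trans _ uw)// lte_fin.
Qed.

End progressive_enlargement_facts.

(** * Inner approximation of predictable sets *)

Section inner_approximation.
Context {d} {T : measurableType d} {R : realType}.
Variables (mu : {measure set T -> \bar R}) (D : set T) (K : set (set T)).
Hypotheses (mu_fin : (mu setT < +oo)%E)
  (K0 : K set0) (KU : setU_closed K)
  (Kcap : forall C : nat -> set T, (forall n, K (C n)) -> K (\bigcap_n C n))
  (mK : K `<=` measurable).

Definition inner_approximable (A : set T) := measurable A /\
  forall e : R, 0 < e -> exists C, [/\ K C, C `<=` A & (mu (A `\` C) <= e%:E)%E].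

Lemma inner_approximable_K A : K A -> inner_approximable A.
Proof.
move=> KA; split=> [|e e0]; first exact: mK.
by exists A; split=> //; rewrite setDv measure0 lee_fin ltW.
Qed.

Let mu_fin' A : measurable A -> (mu A < +oo)%E.
Proof.
by move=> mA; apply: le_lt_trans mu_fin; apply: le_measure; rewrite ?inE.
Qed.

Let sum_eps (F : nat -> set T) (e : R) : 0 < e -> (forall n, measurable (F n)) ->
  (forall n, (mu (F n) <= (e / (2 ^ n.+1)%:R)%:E)%E) ->
  (mu (\bigcup_n F n) <= e%:E)%E.
Proof.
move=> e0 mF Fe.
apply: (@le_trans _ _ (\sum_(n <oo) mu (F n))%E).
  apply: measure_sigma_subadditive => //; exact: bigcup_measurable.
apply: le_trans (epsilon_trick0 xpredT (ltW e0)).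
by apply: lee_nneseries => // n _; exact: Fe.
Qed.

Lemma inner_approximable_bigcup (A : nat -> set T) :
  (forall n, inner_approximable (A n)) -> inner_approximable (\bigcup_n A n).
Proof.
move=> hA; have mA n : measurable (A n) by case: (hA n).
split=> [|e e0]; first exact: bigcup_measurable.
have e20 : 0 < e / 2 by rewrite divr_gt0.
have /choice[C hC] : forall n, exists C,
    [/\ K C, C `<=` A n & (mu (A n `\` C) <= (e / 2 / (2 ^ n.+1)%:R)%:E)%E].
  move=> n; have [_ h] := hA n; apply: h; apply: divr_gt0 => //.
have mC n : measurable (C n) by apply: mK; case: (hC n).
pose U n := \big[setU/set0]_(i < n) C i.
have KUn n : K (U n).
  by rewrite /U; elim/big_ind : _ => // i _; case: (hC i).
have UC n : U n `<=` \bigcup_n A n.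
  by rewrite /U -bigcup_mkord => x [i _ Cx]; exists i => //; have [_ + _] := hC i; exact.
have Ubig : \bigcap_n (\bigcup_n A n `\` U n) = \bigcup_n A n `\` \bigcup_n C n.
  apply/seteqP; split=> [x h|x [Ax nC] n _].
    split; first by case: (h 0%N).
    move=> [n _ Cx]; have [_] := h n.+1 Logic.I; apply.
    by rewrite /U -bigcup_mkord; exists n => //=.
  by split=> //; rewrite /U -bigcup_mkord => -[i _ Cx]; apply: nC; exists i.
have mdiff n : measurable (\bigcup_n A n `\` U n).
  by apply: measurableD; [exact: bigcup_measurable|exact: mK].
have cv : mu (\bigcup_n A n `\` U n) @[n --> \oo] -->
    mu (\bigcup_n A n `\` \bigcup_n C n).
  rewrite -Ubig; apply: nonincreasing_cvg_mu => //.
  - exact: mu_fin'.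
  - exact: bigcapT_measurable.
  - move=> m n mn; apply/subsetPset; apply: setDS.
    by rewrite /U -!bigcup_mkord => x [i /= im Cx]; exists i => //=; exact: leq_trans mn.
have le2 : (mu (\bigcup_n A n `\` \bigcup_n C n) < e%:E)%E.
  apply: (@le_lt_trans _ _ (e / 2)%:E); last by rewrite lte_fin ltr_pdivrMr// ltr_pMr// ltr1n.
  apply: (@le_trans _ _ (mu (\bigcup_n (A n `\` C n)))).
    apply: le_measure; rewrite ?inE.
    - by apply: measurableD; exact: bigcup_measurable.
    - by apply: bigcup_measurable => n _; exact: measurableD.
    - by move=> x [[n _ Ax] nC]; exists n => //; split=> // Cx; apply: nC; exists n.
  apply: sum_eps => // [n|n]; first exact: measurableD.
  by case: (hC n).
have [n hn] : exists n, (mu (\bigcup_n A n `\` U n) <= e%:E)%E.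
  apply: contrapT => /forallNP h; move: le2; apply/negP; rewrite -leNgt.
  rewrite -(cvg_lim _ cv)//; apply: lime_ge; first by apply/cvg_ex; eexists; exact: cv.
  by apply: nearW => n; apply: ltW; rewrite ltNge; apply/negP; exact: h.
by exists (U n).
Qed.

Lemma inner_approximableU A B : inner_approximable A -> inner_approximable B ->
  inner_approximable (A `|` B).
Proof.
move=> hA hB; rewrite -bigcup2E; apply: inner_approximable_bigcup => -[|[|n]] //=.
exact: inner_approximable_K.
Qed.

Lemma inner_approximable_bigcap (A : nat -> set T) :
  (forall n, inner_approximable (A n)) -> inner_approximable (\bigcap_n A n).
Proof.
move=> hA; have mA n : measurable (A n) by case: (hA n).
split=> [|e e0]; first exact: bigcapT_measurable.
have /choice[C hC] : forall n, exists C,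
    [/\ K C, C `<=` A n & (mu (A n `\` C) <= (e / (2 ^ n.+1)%:R)%:E)%E].
  move=> n; have [_ h] := hA n; apply: h; apply: divr_gt0 => //.
have KC n : K (C n) by case: (hC n).
have mC n : measurable (C n) by apply: mK.
exists (\bigcap_n C n); split; first exact: Kcap.
  by move=> x Cx n _; have [_ + _] := hC n; apply; exact: Cx.
apply: (@le_trans _ _ (mu (\bigcup_n (A n `\` C n)))).
  apply: le_measure; rewrite ?inE.
  - by apply: measurableD; exact: bigcapT_measurable.
  - by apply: bigcup_measurable => n _; exact: measurableD.
  - move=> x [Ax nC]; apply: contrapT => h; apply: nC => n _.
    by apply: contrapT => nCx; apply: h; exists n => //; split=> //; exact: Ax.
apply: sum_eps => // [n|n]; first exact: measurableD.
by case: (hC n).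
Qed.

(** The complements are carried along: countable unions are approximated by
    finite ones, and their complements by countable intersections. *)
Lemma inner_approximable_sigma (gen : set (set T)) :
  (forall A, gen A -> [/\ A `<=` D, inner_approximable A &
    inner_approximable (D `\` A)]) ->
  inner_approximable D ->
  forall A, <<s D, gen >> A -> inner_approximable A.
Proof.
move=> hgen hD.
suff : <<s D, gen >> `<=` [set A | [/\ A `<=` D, inner_approximable A &
    inner_approximable (D `\` A)]] by move=> h A /h[].
apply: smallest_sub; last exact: hgen.
split=> [|A [AD hA hDA]|A hA] /=.
- by rewrite setD0; split=> //; exact: inner_approximable_K.
- by rewrite setDD setIidr//; split=> // x [].
- split.
  + by apply: bigcup_sub => n _; case: (hA n).
  + by apply: inner_approximable_bigcup => n; case: (hA n).
  + rewrite (_ : _ `\` _ = \bigcap_n (D `\` A n)).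
      by apply: inner_approximable_bigcap => n; case: (hA n).
    apply/seteqP; split=> [x [Dx nA] n _|x h].
      by split=> // Ax; apply: nA; exists n.
    split; first by case: (h 0%N Logic.I).
    by move=> [n _ Ax]; have [_] := h n Logic.I; apply.
Qed.

End inner_approximation.

Section foretellable_sets.
Context {R : realType} {dO : measure_display} {Omega : measurableType dO}.
Variable F : R -> set (set Omega).
Hypothesis rcF : rc_filtration F.

Definition block (A : set Omega) (a : R) (b : \bar R) : set (Omega * R) :=
  [set p | [/\ A p.1, a <= p.2 & (p.2%:E <= b)%E]].

Inductive block_union : set (Omega * R) -> Prop :=
| block_union0 : block_union set0
| block_unionS A a b K : 0 <= a -> F a A -> block_union K ->
    block_union (block A a b `|` K).

Lemma block_union1 A a b : 0 <= a -> F a A -> block_union (block A a b).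
Proof. by move=> a0 FA; rewrite -(setU0 (block A a b)); apply: block_unionS => //; exact: block_union0. Qed.

Lemma block_unionU : setU_closed block_union.
Proof.
move=> K L; elim=> [|A a b {}K a0 FA _ IH] uL; first by rewrite set0U.
by rewrite -setUA; apply: block_unionS => //; exact: IH.
Qed.

Lemma block_unionI : setI_closed block_union.
Proof.
have blockI A a b A' a' b' : block A a b `&` block A' a' b' =
    block (A `&` A') (Num.max a a') (Order.min b b').
  apply/seteqP; split=> -[w t]; rewrite /block/= ge_max le_min.
    by move=> [[? -> ->] [? -> ->]].
  by move=> [[? ?] /andP[? ?] /andP[? ?]].
move=> K L; elim=> [|A a b {}K a0 FA _ IH] uL; first by rewrite set0I; exact: block_union0.
rewrite setIUl; apply: block_unionU; last exact: IH.
elim: uL => [|A' a' b' {IH}L a0' FA' _ IH]; first by rewrite setI0; exact: block_union0.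
rewrite setIUr; apply: block_unionU; last exact: IH.
rewrite blockI; apply: block_union1; first by rewrite le_max a0.
have m0 : 0 <= Num.max a a' by rewrite le_max a0.
apply: (filtI rcF m0).
  by apply: (filt_le rcF a0) FA; rewrite le_max lexx.
by apply: (filt_le rcF a0') FA'; rewrite le_max lexx orbT.
Qed.

Lemma block_union_closed K w : block_union K -> closed [set t | K (w, t)].
Proof.
elim=> [|A a b {}K a0 FA _ IH]; first exact: closed0.
suff cb : closed [set t | block A a b (w, t)] by exact: closedU cb IH.
have [Aw|nAw] := pselect (A w); last first.
  rewrite (_ : [set t | _] = set0); first exact: closed0.
  by apply/seteqP; split=> t // [].
rewrite (_ : [set t | _] = [set t | a <= t] `&` [set t | (t%:E <= b)%E]); last first.
  by apply/seteqP; split=> t /= [].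
apply: closedI; first exact: closed_ge.
case: b => [b| |].
- exact: closed_le.
- rewrite (_ : [set t | _] = setT); first exact: closedT.
  by apply/seteqP; split=> t //=; rewrite leey.
- rewrite (_ : [set t | _] = set0); first exact: closed0.
  by apply/seteqP; split=> t.
Qed.

Lemma block_union_measurable K : block_union K -> measurable K.
Proof.
elim=> [|A a b {}K a0 FA _ IH]; first exact: measurable0.
apply: measurableU => //.
rewrite (_ : block A a b = A `*` (`[a, +oo[%classic `&` (EFin @^-1` `]-oo, b]%classic))).
  apply: measurableX; first exact: (filt_meas rcF a0).
  apply: measurableI; first exact: measurable_itv.
  rewrite -[X in measurable X]setTI; apply: EFin_measurable => //.
  exact: emeasurable_itv.
by apply/seteqP; split=> -[w t]; rewrite /block/= !in_itv/= andbT => -[? []] //.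
Qed.

Lemma block_union_debut K : block_union K -> exists2 d, stopping_time F d &
  forall w, (forall t, K (w, t) -> (d w <= t%:E)%E) /\
    ((d w < +oo)%E -> K (w, fine (d w))).
Proof.
elim=> [|A a b {}K a0 FA _ [d sd hd]].
  by exists (cst +oo%E) => //; exact: (stopping_time_cst rcF (leey _)).
have [ab|ba] := leP a%:E b; last first.
  exists d => // w; have [h1 h2] := hd w; split=> [t [[/= _ at_ tb]|]|dw].
  - by move: ba; rewrite ltNge (le_trans _ tb)// lee_fin.
  - exact: h1.
  - by right; exact: h2.
pose e w := if w \in A then Order.min a%:E (d w) else d w.
exists e.
  split=> [w|t t0].
    by rewrite /e; case: ifPn => _; rewrite ?le_min ?lee_fin ?a0; case: sd => ->.
  have [at_|ta] := leP a t.
    have FA' := filtU rcF t0 (filt_le rcF a0 at_ FA) (sd.2 t t0).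
    apply: (set_system_ext FA') => w; rewrite /e /=.
    case: ifPn => [/set_mem Aw|/negP].
      by rewrite ge_min lee_fin at_; split=> // _; left.
    by rewrite in_setE => nA; split=> [[]//|]; right.
  apply: (set_system_ext (sd.2 t t0)) => w; rewrite /e /=; case: ifPn => // _.
  by rewrite ge_min lee_fin (leNgt a) ta.
move=> w; have [h1 h2] := hd w; rewrite /e; case: ifPn => [/set_mem Aw|/negP].
  split=> [t [[/= _ at_ tb]|Kt]|].
  - by rewrite ge_min lee_fin at_.
  - by rewrite ge_min h1// orbT.
  - have [_|da dy] := leP a%:E (d w); last by right; exact: h2.
    by left; split=> //=.
rewrite in_setE => nA; split=> [t [[]//|]|dy]; first exact: h1.
by right; exact: h2.
Qed.

(** This class is large enough to approximate predictable sets from inside and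
    small enough for debuts to be stopping times; together these replace the
    section theorem.  Blocks are closed on the left because the debut must be
    attained. *)
Definition foretellable (K : set (Omega * R)) := exists2 C : nat -> set (Omega * R),
  forall n, block_union (C n) & K = \bigcap_n C n.

Lemma block_union_foretellable K : block_union K -> foretellable K.
Proof. by move=> uK; exists (fun=> K) => //; rewrite bigcap_const. Qed.

Let pair_of (k : nat) : nat * nat := odflt (0, 0)%N (unpickle k).

Let pair_ofK p : pair_of (pickle p) = p.
Proof. by rewrite /pair_of pickleK. Qed.

Lemma foretellableU : setU_closed foretellable.
Proof.
move=> _ _ [C uC ->] [D uD ->].
exists (fun k => C (pair_of k).1 `|` D (pair_of k).2).
  by move=> k; exact: block_unionU.
apply/seteqP; split=> [p [h|h] k _|p h]; [left; exact: h|right; exact: h|].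
apply: contrapT => /not_orP[/existsNP[n /not_implyP[_ nC]] /existsNP[m /not_implyP[_ nD]]].
by have := h (pickle (n, m)) Logic.I; rewrite pair_ofK => -[].
Qed.

Lemma foretellable_bigcap (C : nat -> set (Omega * R)) :
  (forall n, foretellable (C n)) -> foretellable (\bigcap_n C n).
Proof.
move=> hC.
have /choice[D hD] : forall n, exists D : nat -> set (Omega * R),
    (forall m, block_union (D m)) /\ C n = \bigcap_m D m.
  by move=> n; have [D uD CE] := hC n; exists D.
exists (fun k => D (pair_of k).1 (pair_of k).2).
  by move=> k; case: (hD (pair_of k).1).
apply/seteqP; split=> [p h k _|p h n _].
  by have := h (pair_of k).1 Logic.I; rewrite (hD _).2; exact.
rewrite (hD n).2 => m _; have := h (pickle (n, m)) Logic.I.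
by rewrite pair_ofK.
Qed.

Lemma foretellable_measurable : foretellable `<=` measurable.
Proof.
move=> _ [C uC ->]; apply: bigcapT_measurable => n.
exact: block_union_measurable.
Qed.

(** The debut of a foretellable set is attained, and it is a stopping time as
    the supremum of the debuts of the decreasing finite unions. *)
Lemma foretellable_debut K : foretellable K -> exists2 d, stopping_time F d &
  forall w t, K (w, t) -> (d w <= t%:E)%E /\ K (w, fine (d w)).
Proof.
move=> [C uC ->].
pose D n := \big[setI/setT]_(i < n.+1) C i.
have DE n p : D n p <-> forall i, (i <= n)%N -> C i p.
  by rewrite /D -bigcap_mkord; split=> h i; [move=> iN; apply: h|exact: h].
have uD n : block_union (D n).
  rewrite /D; elim: n => [|n IH]; first by rewrite big_ord1.
  by rewrite big_ord_recr/=; exact: block_unionI.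
have /choice[d hd] : forall n, exists d, stopping_time F d /\
    forall w, (forall t, D n (w, t) -> (d w <= t%:E)%E) /\
      ((d w < +oo)%E -> D n (w, fine (d w))).
  by move=> n; have [d sd h] := block_union_debut (uD n); exists d.
pose s w := ereal_sup (range (fun n => d n w)).
have s_ge n w : (d n w <= s w)%E by apply: ereal_sup_ubound; exists n.
exists s.
  split=> [w|t t0]; first by rewrite (le_trans _ (s_ge 0%N w))//; case: (hd 0%N) => -[->].
  have FD n : F t [set w | (d n w <= t%:E)%E] by case: (hd n) => -[_ h] _; exact: h.
  apply: (set_system_ext (filt_bigcap rcF t0 FD)) => w /=; split=> [h|h n _].
    by apply: ge_ereal_sup => _ [n _ <-]; exact: h.
  exact: le_trans (s_ge n w) h.
move=> w t Kt.
have dt n : (d n w <= t%:E)%E.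
  by have [_ /(_ w)[+ _]] := hd n; apply; apply/DE => i _; exact: Kt.
have st : (s w <= t%:E)%E by apply: ge_ereal_sup => _ [n _ <-]; exact: dt.
split=> // n _.
have d0 m : (0 <= d m w)%E by case: (hd m) => -[->].
have dfin m : d m w \is a fin_num.
  by rewrite ge0_fin_numE// (le_lt_trans (dt m))// ltry.
have sfin : s w \is a fin_num.
  by rewrite ge0_fin_numE ?(le_trans (d0 0%N))// (le_lt_trans st)// ltry.
have Dd m : D m (w, fine (d m w)).
  by have [_ /(_ w)[_]] := hd m; apply; rewrite (le_lt_trans (dt m))// ltry.
have nd : {homo (fun m => d m w) : m k / (m <= k)%N >-> (m <= k)%E}.
  move=> m k mk; have [_ /(_ w)[+ _]] := hd m.
  move=> /(_ (fine (d k w))); rewrite fineK//; apply; apply/DE => i im.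
  by have /DE := Dd k; apply; exact: leq_trans mk.
(* The sections are closed, so the limit of the increasing debuts stays in. *)
have cv : fine (d m w) @[m --> \oo] --> fine (s w).
  apply: fine_cvg; rewrite fineK//.
  exact: ereal_nondecreasing_cvgn.
apply: (@closed_cvg _ _ _ _ _ (fun t => C n (w, t)) _ _ _ cv).
  exact: block_union_closed.
by exists n => // m /= nm; have /DE := Dd m; apply.
Qed.

End foretellable_sets.

(** * Total inaccessibility of tau *)

Section avoidance.
Context {R : realType} {dO : measure_display} {Omega : measurableType dO}.
Variables (P : probability Omega R) (F : R -> set (set Omega))
  (tau : Omega -> \bar R).
Hypotheses (rcF : rc_filtration F) (mtau : measurable_fun setT tau)
  (tau_gt0 : forall w, (0 < tau w)%E)
  (avoid : avoids_stopping_times P F tau).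

(** A half-open interval ]s, t] is the union of the intervals [s + 1/n, t], which
    makes the generators and their complements approximable. *)
Lemma predictable_inner_approximable (mu : {measure set (Omega * R) -> \bar R}) D :
  (mu setT < +oo)%E -> predictable F D ->
  inner_approximable mu (foretellable F) D.
Proof.
move=> mufin; pose IA := inner_approximable mu (foretellable F).
have F0 : foretellable F set0.
  by apply: block_union_foretellable; exact: block_union0.
have FU := @foretellableU _ _ _ F.
have Fcap := @foretellable_bigcap _ _ _ F.
have Fm := foretellable_measurable rcF.
have blockIA A a b : 0 <= a -> F a A -> IA (block A a b).
  move=> a0 FA; apply: inner_approximable_K => //.
  by apply: block_union_foretellable; exact: block_union1.
have ocIA A a b : 0 <= a -> F a A ->
    IA [set p | [/\ A p.1, a < p.2 & (p.2%:E <= b)%E]].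
  move=> a0 FA; rewrite (_ : [set p | _] = \bigcup_n block A (a + n.+1%:R^-1) b).
    apply: inner_approximable_bigcup => // n.
    have an : a <= a + n.+1%:R^-1 by rewrite lerDl.
    by apply: blockIA; [exact: le_trans an|exact: (filt_le rcF a0 an)].
  apply/seteqP; split=> -[w t] /=.
    move=> [Aw at_ tb]; exists (Num.truncn (t - a)^-1) => //; split=> //=.
    rewrite -lerBrDl invf_ple ?posrE ?subr_gt0//.
    by rewrite ltW// truncnS_gt.
  move=> [n _ [/= Aw ant tb]]; split=> //.
  by apply: lt_le_trans ant; rewrite ltrDl.
have DIA : IA [set p | 0 <= p.2].
  have := blockIA setT 0 +oo%E (lexx 0) (filtT rcF (lexx 0)).
  rewrite (_ : block _ _ _ = [set p | 0 <= p.2])//.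
  apply/seteqP; split=> -[w t]; rewrite /block/=; first by case.
  by move=> t0; rewrite leey.
have IAU := @inner_approximableU _ _ _ mu (foretellable F) mufin F0 FU Fm.
apply: (inner_approximable_sigma mufin F0 FU Fcap Fm _ DIA).
move=> _ [[A FA ->]|[s [t [A [s0 st FA ->]]]]].
- have -> : A `*` [set 0 : R] = block A 0 0%:E.
    apply/seteqP; split=> -[w u]; rewrite /block/= ?lee_fin.
      by move=> [Aw ->].
    by move=> [Aw u0 u0']; split=> //; apply/eqP; rewrite eq_le u0 u0'.
  split; first by move=> [w u] []/=.
    exact: blockIA.
  rewrite (_ : _ `\` _ = block (~` A) 0 +oo%E `|`
      [set p | [/\ setT p.1, 0 < p.2 & (p.2%:E <= +oo)%E]]).
    apply: (IAU); first by apply: blockIA => //; exact: filtC.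
    by apply: ocIA => //; exact: filtT.
  apply/seteqP; split=> -[w u]; rewrite /block/= leey.
    move=> [u0 h]; have [u00|u00] := ltP 0 u; first by right.
    by left; split=> // Aw; apply: h.
  move=> [[nA u0 _]|[_ u0 _]]; first by split=> // -[].
  by split; [exact: ltW|move=> [_ _]; rewrite lee_fin leNgt u0].
- have -> : A `*` `]s, t]%classic = [set p | [/\ A p.1, s < p.2 & (p.2%:E <= t%:E)%E]].
    apply/seteqP; split=> -[w u] /=; rewrite in_itv/= lee_fin.
      by move=> [Aw /andP[]].
    by move=> [Aw -> ->].
  have t0 : 0 <= t by rewrite (le_trans s0)// ltW.
  split.
  + by move=> [w u] [/= _ su _]; rewrite (le_trans s0)// ltW.
  + exact: ocIA.
  rewrite (_ : _ `\` _ = block setT 0 s%:E `|`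
      ([set p | [/\ (~` A) p.1, s < p.2 & (p.2%:E <= +oo)%E]] `|`
      [set p | [/\ setT p.1, t < p.2 & (p.2%:E <= +oo)%E]])).
    apply: (IAU); first by apply: blockIA => //; exact: filtT.
    apply: (IAU); first by apply: ocIA => //; exact: filtC.
    by apply: ocIA => //; exact: filtT.
  apply/seteqP; split=> -[w u]; rewrite /block/= leey !lee_fin.
    move=> [u0 h]; have [us|su] := leP u s; first by left.
    right; have [ut|tu] := leP u t; last by right.
    by left; split=> // Aw; apply: h.
  move=> [[_ u0 us]|[[nA su _]|[_ tu _]]].
  + by split=> // -[_]; rewrite ltNge us.
  + by split=> [|[]//]; rewrite (le_trans s0)// ltW.
  + split; first by rewrite (le_trans t0)// ltW.
    by move=> [_ _]; rewrite leNgt tu.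
Qed.

Let hit_time w : Omega * R := (w, fine (tau w)).

Let mhit : measurable_fun setT hit_time.
Proof.
apply/measurable_fun_pairP; split; first exact: measurable_id.
have -> : snd \o hit_time = fine \o tau by [].
by apply: measurableT_comp => //; exact: fine_measurable.
Qed.

Let mfin : measurable [set w | (tau w < +oo)%E].
Proof.
rewrite -[X in measurable X]setTI.
exact: (emeasurable_fun_infty_o measurableT mtau).
Qed.

(** Up to small measure D may be replaced by a foretellable subset.  The debut
    of that subset is an F-stopping time, and it equals tau whenever tau hits
    the subset, since D has only one time up to tau; avoidance concludes. *)
Lemma predictable_thin_avoids D : predictable F D ->
  (forall w t u, D (w, t) -> D (w, u) -> (t%:E <= tau w)%E ->
    (u%:E <= tau w)%E -> t = u) ->
  P [set w | (tau w < +oo)%E /\ D (w, fine (tau w))] = 0%E.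
Proof.
move=> pD thin.
pose mu : {measure set (Omega * R) -> \bar R} :=
  measure_function_pushforward__canonical__measure_function_Measure
    (mrestr P mfin) mhit.
have mhitD A : measurable A -> measurable (hit_time @^-1` A `&` [set w | (tau w < +oo)%E]).
  by move=> mA; apply: measurableI => //; rewrite -[X in measurable X]setTI; exact: mhit.
have muE A : mu A = P (hit_time @^-1` A `&` [set w | (tau w < +oo)%E]) by [].
have mufin : (mu setT < +oo)%E.
  by rewrite muE (le_lt_trans (probability_le1 _ _)) ?ltry//; exact: mhitD.
have mD := predictable_measurable rcF pD.
suff : mu D = 0%E.
  rewrite muE; congr (P _ = _); apply/seteqP; split=> w /= [] //.
apply/eqP; rewrite eq_le measure_ge0 andbT; apply/lee_addgt0Pr => e e0.
rewrite add0e.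
have [_ /(_ e e0)[C [KC CD muC]]] := predictable_inner_approximable mufin pD.
have mC := foretellable_measurable rcF KC.
have C0 : mu C = 0%E.
  have [s ss hs] := foretellable_debut rcF KC.
  have ms := stopping_time_measurable rcF ss.
  rewrite muE; apply: (subset_measure0 _ _ _ (avoid ss)).
  - exact: mhitD.
  - rewrite (_ : [set w | _] =
        (setT `&` [set w | tau w = s w]) `&` [set w | (tau w < +oo)%E]).
      by apply: measurableI => //; exact: measurable_eqe.
    by rewrite setTI.
  - move=> w [/= Cw tfin]; split=> //.
    have [st Cs] := hs _ _ Cw.
    have tE : (fine (tau w))%:E = tau w by rewrite fineK// gt0_fin_numE.
    have s0 : (0 <= s w)%E by case: ss => ->.
    have sE : (fine (s w))%:E = s w.
      by rewrite fineK// ge0_fin_numE// (le_lt_trans st)// ltry.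
    rewrite -tE -sE; congr (_%:E); apply: (thin w); [exact: CD|exact: CD| |].
      by rewrite tE.
    by rewrite sE -tE.
have -> : D = C `|` (D `\` C) by rewrite setDUK.
have mDC := measurableD mD mC.
apply: (@le_trans _ _ (mu C + mu (D `\` C))%E); first exact: measureU2.
by rewrite C0 add0e.
Qed.

(** On [0, tau] the graph of sigma is the trace of an F-predictable set, which
    has at most one time up to tau.  So tau is totally inaccessible for the
    enlarged filtration. *)
Lemma predictable_time_avoids sigma :
  predictable_time (progressive_enlargement F tau) sigma ->
  P [set w | (tau w < +oo)%E /\ tau w = sigma w] = 0%E.
Proof.
move=> psigma.
have [D' pD' hD'] := predictable_trace rcF mtau tau_gt0
  (predictable_graph psigma).
rewrite (_ : [set w | _] = [set w | (tau w < +oo)%E /\ D' (w, fine (tau w))]).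
  apply: predictable_thin_avoids => // w t u Dt Du tt ut.
  have /hD'[_ /(_ Dt)[/= _ ts]] := tt; have /hD'[_ /(_ Du)[/= _ us]] := ut.
  by apply: EFin_inj; rewrite ts us.
apply/seteqP; split=> w /= [tfin h]; split=> //.
- apply/hD'; first by rewrite fineK// gt0_fin_numE.
  by split; [rewrite fine_ge0// ltW|rewrite /= fineK// gt0_fin_numE].
- have tE : (fine (tau w))%:E = tau w by rewrite fineK// gt0_fin_numE.
  by move/hD': h; rewrite tE lexx => /(_ isT)[_ /=]; rewrite tE.
Qed.

End avoidance.

(** * Step paths and their jump measures *)

Section step_path.
Context {R : realType} {V : normedModType R}.
Variables (T : nat -> \bar R) (xi : nat -> V) (x : R -> V).
Hypotheses (T_ge0 : forall n, (0 <= T n)%E)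
  (Tle : forall n, (T n <= T n.+1)%E)
  (Tlt : forall n, (T n < +oo)%E -> (T n < T n.+1)%E)
  (Tlim : T n @[n --> \oo] --> +oo%E)
  (xT : forall t, 0 <= t ->
    (\sum_(0 <= n < N) (if (T n <= t%:E)%E then xi n else 0)) @[N --> \oo] --> x t).

Lemma step_le m n : (m <= n)%N -> (T m <= T n)%E.
Proof. by move=> mn; have /nondecreasing_seqP := Tle; exact. Qed.

Lemma step_lt m n : (m < n)%N -> (T m < +oo)%E -> (T m < T n)%E.
Proof. by move=> mn /Tlt Tm; exact: lt_le_trans Tm (step_le mn). Qed.

Lemma step_inj m n : (T m < +oo)%E -> T m = T n -> m = n.
Proof.
move=> Tm mn; have [/step_lt|/step_lt|//] := ltngtP m n.
  by move=> /(_ Tm); rewrite mn ltxx.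
by rewrite -mn => /(_ Tm); rewrite ltxx.
Qed.

Lemma step_value t n0 : 0 <= t -> (forall n, (n0 <= n)%N -> (t%:E < T n)%E) ->
  x t = \sum_(0 <= n < n0) (if (T n <= t%:E)%E then xi n else 0).
Proof.
move=> t0 h; rewrite -(cvg_lim _ (xT t0))//; apply: lim_near_cst => //.
exists n0 => // N /= n0N.
rewrite (@big_cat_nat _ _ _ n0)//= -[RHS]addr0; congr (_ + _).
rewrite big_nat_cond big1//.
by move=> n /andP[/andP[n0n _] _]; rewrite leNgt h.
Qed.

Lemma step_index (t : R) : exists k, (forall n, (n < k)%N -> (T n < t%:E)%E) /\
  (t%:E <= T k)%E.
Proof.
have ex : exists k, (t%:E <= T k)%E.
  have /cvgeyPge/(_ t) [k _ h] := Tlim; exists k; exact: h (leqnn k).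
exists (ex_minn ex); case: ex_minnP => k tk kmin; split=> // n nk.
by rewrite ltNge; apply/negP => /kmin; rewrite leqNgt nk.
Qed.

(** Just before t a step path is constant, equal to the sum of the jumps at
    the times before t. *)
Lemma step_left_limit t k : 0 < t -> (forall n, (n < k)%N -> (T n < t%:E)%E) ->
  (t%:E <= T k)%E -> x u @[u --> t^'-] --> \sum_(0 <= n < k) xi n.
Proof.
move=> t0 Tk tk.
have [s [s0 st hs]] : exists s, [/\ 0 <= s, s < t &
    forall n, (n < k)%N -> (T n <= s%:E)%E].
  case: k Tk tk => [|k] Tk tk; first by exists 0; split.
  have Tkt := Tk k (ltnSn k).
  have Tfin : T k \is a fin_num by rewrite ge0_fin_numE// (lt_le_trans Tkt)// leey.
  exists (fine (T k)); split; first exact: fine_ge0.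
    by rewrite -lte_fin fineK.
  by move=> n nk; rewrite fineK// step_le.
apply: cvg_near_cst; near=> u.
have su : s <= u by near: u; exact: nbhs_left_ge.
have ut : u < t by near: u; exact: nbhs_left_lt.
rewrite (@step_value u k); last 2 first.
- exact: le_trans s0 su.
- by move=> n kn; rewrite (lt_le_trans _ (step_le kn))// (lt_le_trans _ tk)// lte_fin.
apply: eq_big_nat => n /andP[_ nk].
by rewrite (le_trans (hs n nk))// lee_fin.
Unshelve. all: by end_near. Qed.

Lemma step_cvg_left t : 0 < t -> cvg (x u @[u --> t^'-]).
Proof.
move=> t0; have [k [Tk tk]] := step_index t.
by apply/cvg_ex; eexists; exact: step_left_limit tk.
Qed.

Lemma step_jump t k : 0 < t -> (forall n, (n < k)%N -> (T n < t%:E)%E) ->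
  (t%:E <= T k)%E -> jump x t = if T k == t%:E then xi k else 0.
Proof.
move=> t0 Tk tk; rewrite /jump t0 (cvg_lim _ (step_left_limit t0 Tk tk))//.
have sumE : \sum_(0 <= n < k) (if (T n <= t%:E)%E then xi n else 0) =
    \sum_(0 <= n < k) xi n.
  by apply: eq_big_nat => n /andP[_ /Tk/ltW ->].
case: eqP => [Tkt|/eqP Tkt].
  rewrite (@step_value t k.+1) ?ltW//; last first.
    by move=> n kn; rewrite -Tkt; apply: step_lt => //; rewrite Tkt ltry.
  by rewrite big_nat_recr//= Tkt lexx sumE addrAC subrr add0r.
rewrite (@step_value t k) ?ltW// ?sumE ?subrr// => n kn.
by rewrite (lt_le_trans _ (step_le kn))// lt_neqAle eq_sym Tkt.
Qed.

Lemma step_jump_at n t : 0 < t -> T n = t%:E -> jump x t = xi n.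
Proof.
move=> t0 Tn; have [k [Tk tk]] := step_index t.
suff Tkt : T k = t%:E.
  rewrite (step_jump t0 Tk tk) Tkt eqxx; congr xi.
  by apply: step_inj; rewrite Tkt ?ltry// Tn.
apply/eqP; rewrite eq_le tk andbT -Tn; apply: step_le.
by rewrite leqNgt; apply/negP => /Tk; rewrite Tn ltxx.
Qed.

Lemma step_jump_off t : 0 < t -> (forall n, T n <> t%:E) -> jump x t = 0.
Proof.
move=> t0 Tn; have [k [Tk tk]] := step_index t.
by rewrite (step_jump t0 Tk tk); case: eqP => // /Tn.
Qed.

Hypothesis xi_neq0 : forall n, xi n <> 0 <-> (T n < +oo)%E.

Lemma step_jump_times : [set s | 0 < s /\ jump x s <> 0] =
  (fun n => fine (T n)) @` [set n | (0 < T n)%E /\ (T n < +oo)%E].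
Proof.
apply/seteqP; split=> [s [s0 js]|_ [n [Tn0 Tny] <-]] /=.
  have [n Tn] : exists n, T n = s%:E.
    by apply: contrapT => /forallNP h; apply: js; exact: step_jump_off.
  by exists n; rewrite ?Tn//= lte_fin ltry.
have TE : (fine (T n))%:E = T n by rewrite fineK// gt0_fin_numE.
have T0 : 0 < fine (T n) by rewrite -lte_fin TE.
by split=> //; rewrite (@step_jump_at n)//; exact/xi_neq0.
Qed.

End step_path.

Section step_jump_measure.
Context {R : realType} {d : nat}.
Local Notation E := 'rV[R]_d.
Variables (T : nat -> \bar R) (xi : nat -> E) (x : R -> E).
Hypotheses (T_ge0 : forall n, (0 <= T n)%E)
  (Tle : forall n, (T n <= T n.+1)%E)
  (Tlt : forall n, (T n < +oo)%E -> (T n < T n.+1)%E)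
  (Tlim : T n @[n --> \oo] --> +oo%E)
  (xi_neq0 : forall n, xi n <> 0 <-> (T n < +oo)%E)
  (xT : forall t, 0 <= t ->
    (\sum_(0 <= n < N) (if (T n <= t%:E)%E then xi n else 0)) @[N --> \oo] --> x t).

Lemma step_jump_measureE (C : set (R * E)) :
  jump_measure (jump x) 0 C =
  (\sum_(n <oo) (if ((0 < T n) && (T n < +oo))%E
                 then \d_(fine (T n), xi n) C else 0))%E.
Proof.
rewrite /jump_measure (step_jump_times T_ge0 Tle Tlt Tlim xT xi_neq0).
rewrite esum_image; last first.
  move=> m n; rewrite !inE/= => -[m0 my] [n0 ny] mn.
  apply: (step_inj Tle Tlt my).
  by rewrite -[LHS]fineK ?gt0_fin_numE// mn fineK ?gt0_fin_numE.
rewrite esum_mkcond nneseries_esumT; last by move=> n; case: ifP.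
apply: eq_esum => n _; case: ifPn.
  rewrite inE/= => -[n0 ny]; rewrite n0 ny/=.
  have TE : (fine (T n))%:E = T n by rewrite fineK// gt0_fin_numE.
  rewrite (step_jump_at T_ge0 Tle Tlt Tlim xT (n := n))//.
  by rewrite -lte_fin TE.
by rewrite notin_setE/= => h; case: ifP => // /andP[n0 ny]; case: h; split.
Qed.

(** The times increase strictly while they are finite, so only the first m + 1
    of them can lie in ]0, T m]. *)
Lemma step_jump_measure_stopped m t (B : set E) : 0 <= t ->
  jump_measure (jump x) 0 (`]0, fine (Order.min t%:E (T m))]%classic `*` B) =
  (\sum_(0 <= n < m.+1) (if ((0 < T n) && (T n <= t%:E))%E
                 then (\1_B (xi n))%:E else 0))%E.
Proof.
move=> t0; rewrite step_jump_measureE (nneseries_split 0 m.+1); last first.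
  by move=> n _; case: ifP.
rewrite add0n [X in (_ + X)%E]eseries0 ?adde0; last first.
  move=> n mn _; case: ifPn => // /andP[n0 ny].
  rewrite diracE memNset// => -[/=]; rewrite in_itv/= => /andP[_].
  have my : (T m < +oo)%E by rewrite (le_lt_trans _ ny)//; apply: step_le => //; exact: ltnW.
  rewrite -lee_fin fineK ?gt0_fin_numE// fineK; last first.
    by rewrite ge0_fin_numE ?le_min ?lee_fin ?t0 ?T_ge0// gt_min ltry.
  by rewrite le_min => /andP[_]; rewrite leNgt (step_lt Tle Tlt mn).
apply: eq_big_nat => n /andP[_ nm].
have [n0|n0]/= := ltP 0%E (T n); last by [].
have [ny|] := ltP (T n) +oo%E; last first.
  by rewrite leye_eq => /eqP ->; rewrite leNgt ltry.
rewrite diracE indicE.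
have inE' : (fine (T n) \in `]0, fine (Order.min t%:E (T m))]) = (T n <= t%:E)%E.
  have Tfin : T n \is a fin_num by rewrite gt0_fin_numE.
  rewrite in_itv/= -!lte_fin -lee_fin !fineK//; last first.
    by rewrite ge0_fin_numE ?le_min ?lee_fin ?t0 ?T_ge0// gt_min ltry.
  by rewrite n0 le_min (step_le Tle) ?andbT.
case: ifPn => Tt; last first.
  by rewrite memNset// => -[/=]; rewrite inE' (negbTE Tt).
congr (_%:R%:E); congr nat_of_bool.
apply/idP/idP; rewrite !inE/=; first by case.
by move=> Bx; rewrite inE' Tt.
Qed.

End step_jump_measure.

(** * Immersion preserves the compensator of a step process *)

Section cadlag_mass.
Context {R : realType} {dE : measure_display} {E : measurableType dE}.
Variables (m : {measure set (R * E) -> \bar R}) (c : \bar R) (B : set E).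
Hypotheses (c0 : (0 <= c)%E) (mB : measurable B).

Definition mass_upto (t : R) : \bar R :=
  m (`]0, fine (Order.min t%:E c)]%classic `*` B).

Hypothesis mfin : forall t, 0 <= t -> (mass_upto t < +oo)%E.

Let minE t : 0 <= t -> (fine (Order.min t%:E c))%:E = Order.min t%:E c.
Proof.
move=> t0; rewrite fineK// ge0_fin_numE ?le_min ?lee_fin ?t0//.
by rewrite gt_min ltry.
Qed.

Lemma in_upto t u : 0 <= t ->
  u \in `]0, fine (Order.min t%:E c)] = [&& 0 < u, u <= t & (u%:E <= c)%E].
Proof. by move=> t0; rewrite in_itv/= -lee_fin minE// le_min lee_fin. Qed.

Lemma measurable_upto t :
  measurable (`]0, fine (Order.min t%:E c)]%classic `*` B).
Proof. by apply: measurableX => //; exact: measurable_itv. Qed.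

Lemma mass_upto_le s t : 0 <= s -> s <= t -> (mass_upto s <= mass_upto t)%E.
Proof.
move=> s0 st; have t0 := le_trans s0 st.
apply: le_measure; rewrite ?inE; try exact: measurable_upto.
move=> [u x] [/=]; rewrite !in_upto// => /and3P[-> us ->] Bx.
by rewrite (le_trans us st).
Qed.

Let g t := fine (mass_upto t).

Let g_fin t : 0 <= t -> mass_upto t \is a fin_num.
Proof. by move=> t0; rewrite ge0_fin_numE ?mfin. Qed.

Let g_le s t : 0 <= s -> s <= t -> g s <= g t.
Proof.
move=> s0 st; rewrite -lee_fin !fineK ?g_fin//; first exact: mass_upto_le.
exact: le_trans st.
Qed.

(** Continuity from above of the measure along t + 1/n, then monotonicity. *)
Lemma mass_upto_right t : 0 <= t -> g x @[x --> t^'+] --> g t.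
Proof.
move=> t0; pose e (n : nat) : R := t + n.+1%:R^-1.
have te n : t < e n by rewrite ltrDl invr_gt0.
have e0 n : 0 <= e n by rewrite (le_trans t0)// ltW.
have cv : g (e n) @[n --> \oo] --> g t.
  apply: fine_cvg; rewrite fineK ?g_fin// {2}/mass_upto.
  have <- : \bigcap_n (`]0, fine (Order.min (e n)%:E c)]%classic `*` B) =
      `]0, fine (Order.min t%:E c)]%classic `*` B.
    apply/seteqP; split=> [[u x] h|[u x] [/=]]; last first.
      rewrite in_upto// => /and3P[u0 ut uc] Bx n _; split=> //=.
      by rewrite in_upto// u0 uc (le_trans ut)// ltW.
    split=> /=; last by case: (h 0%N Logic.I).
    have h' n : [&& 0 < u, u <= e n & (u%:E <= c)%E].
      by rewrite -in_upto//; case: (h n Logic.I).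
    have /and3P[u0 _ uc] := h' 0%N.
    rewrite in_upto// u0 uc andbT/=; apply/ler_addgt0Pr => r r0.
    have /and3P[_ + _] := h' (Num.truncn r^-1); move/le_trans; apply.
    rewrite /e lerD2l invf_ple ?posrE//.
    by rewrite ltW// truncnS_gt.
  apply: nonincreasing_cvg_mu => //.
  - exact: mfin.
  - by move=> n; exact: measurable_upto.
  - by apply: bigcapT_measurable => n; exact: measurable_upto.
  - move=> n k nk; apply/subsetPset => -[u x] [/=]; rewrite !in_upto//.
    move=> /and3P[-> ue ->] Bx; split=> //; rewrite andbT/= (le_trans ue)//.
    by rewrite lerD2l lef_pV2 ?posrE// ler_nat.
apply/cvgrPdist_le => r r0.
move/cvgrPdist_le : cv => /(_ r r0)[n _ /(_ n (leqnn n))/= hn].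
near=> u.
have tu : t <= u by near: u; exact: nbhs_right_ge.
have ue : u <= e n by near: u; exact: nbhs_right_le.
rewrite distrC ger0_norm ?subr_ge0 ?g_le//.
rewrite distrC ger0_norm ?subr_ge0 ?g_le// in hn; last exact: ltW.
rewrite (le_trans _ hn)// lerB// g_le//; exact: le_trans tu.
Unshelve. all: by end_near. Qed.

Lemma mass_upto_left t : 0 < t -> cvg (g x @[x --> t^'-]).
Proof.
move=> t0; apply: nondecreasing_at_left_is_cvgr.
- near=> s => x y; rewrite !in_itv/= => /andP[sx xt] /andP[sy yt] xy.
  apply: g_le => //; rewrite (le_trans _ (ltW sx))//.
  by near: s; exact: nbhs_left_ge.
- near=> s; exists (g t) => _ [y + <-]; rewrite /= in_itv/= => /andP[sy yt].
  apply: g_le; last exact: ltW.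
  by rewrite (le_trans _ (ltW sy))//; near: s; exact: nbhs_left_ge.
Unshelve. all: by end_near. Qed.

End cadlag_mass.

Section indicator_functions.
Context {R : realType} {dO : measure_display} {Omega : measurableType dO}.
Context {dE : measure_display} {E : measurableType dE}.
Variable F : R -> set (set Omega).
Implicit Type C : set (Omega * (R * E)).

Lemma predictable_prod_sub C : predictable_prod F C -> C `<=` [set z | 0 <= z.2.1].
Proof.
apply: g_sigma_algebra_sub => _ [D [B [pD mB ->]]] z /= [Dz _].
exact: predictable_sub pD _ Dz.
Qed.

Lemma predictable_prod_rect D (B : set E) : predictable F D -> measurable B ->
  predictable_prod F [set z | D (z.1, z.2.1) /\ B z.2.2].
Proof. by move=> pD mB; apply: sub_sigma_algebra; exists D, B. Qed.

Lemma predictable_function_indic C : predictable_prod F C ->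
  predictable_function F (fun z => (\1_C z)%:E : \bar R).
Proof.
move=> pC; have sF : sigma_algebra [set z : Omega * (R * E) | 0 <= z.2.1]
    (predictable_prod F) by exact: smallest_sigma_algebra.
apply/(measurable_wrtP _ sF predictable_prod_sub) => mD.
have mC : measurable (C : set (g_sigma_algebraType (predictable_prod F))).
  exact: sub_sigma_algebra.
have : measurable_fun setT (\1_C : g_sigma_algebraType (predictable_prod F) -> R).
  exact: measurable_indic.
move=> /measurable_EFinP /(measurable_funS measurableT (@subsetT _ _)); exact.
Qed.

Lemma predictable_prod_section C w : rc_filtration F -> predictable_prod F C ->
  measurable [set z | C (w, z)].
Proof.
move=> rcF /(predictable_prod_rectangles rcF) gC.
have := @measurable_predictable_pair R _ Omega _ E F w measurableT C gC.
by rewrite setTI.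
Qed.

Lemma integral_predictable_indic C w (m : {measure set (R * E) -> \bar R}) :
  rc_filtration F -> predictable_prod F C ->
  (\int[m]_(z in [set z | (0 <= z.1)%R]) (\1_C (w, z))%:E = m [set z | C (w, z)])%E.
Proof.
move=> rcF pC; have mC := predictable_prod_section w rcF pC.
have m0 : measurable [set z : R * E | 0 <= z.1].
  rewrite (_ : [set z | _] = `[0, +oo[%classic `*` setT).
    by apply: measurableX => //; exact: measurable_itv.
  by apply/seteqP; split=> z /=; rewrite in_itv/= andbT// => -[].
have -> : (\int[m]_(z in [set z | (0 <= z.1)%R]) (\1_C (w, z))%:E =
    \int[m]_(z in [set z | (0 <= z.1)%R]) (\1_[set z | C (w, z)] z)%:E)%E.
  apply: eq_integral => z _; rewrite !indicE.
  by rewrite (_ : ((w, z) \in C) = (z \in [set z | C (w, z)]))//; apply/idP/idP; rewrite !inE.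
rewrite integral_indic//; congr (m _); apply: setIidl => z.
exact: predictable_prod_sub pC _.
Qed.

End indicator_functions.

Section immersion.
Context {R : realType} {dO : measure_display} {Omega : measurableType dO}.
Variables (P : probability Omega R) (d : nat).
Local Notation E := 'rV[R]_d.
Variables (F : R -> set (set Omega)) (X : R -> Omega -> E)
  (T : nat -> Omega -> \bar R) (xi : nat -> Omega -> E)
  (nu : Omega -> {measure set (R * E) -> \bar R}).
Hypotheses (rcF : rc_filtration F)
  (sT : forall n, stopping_time F (T n))
  (Tinc : forall w, (forall n, (T n w <= T n.+1 w)%E /\
     ((T n w < +oo)%E -> (T n w < T n.+1 w)%E)) /\
     T n w @[n --> \oo] --> +oo%E)
  (mxi : forall n, measurable_wrt setT (stopped_sigma_algebra F (T n)) (xi n))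
  (xi_neq0 : forall n w, xi n w <> 0 <-> (T n w < +oo)%E)
  (XT : forall t w, 0 <= t ->
    (\sum_(0 <= n < N) (if (T n w <= t%:E)%E then xi n w else 0))
      @[N --> \oo] --> X t w).

Let mu : Omega -> {measure set (R * E) -> \bar R} :=
  fun w => jump_measure (jump (X ^~ w)) (0 : E).

Hypothesis hnu : dual_predictable_projection_measure P F mu nu.

Let T_ge0 n w : (0 <= T n w)%E. Proof. by case: (sT n). Qed.
Let Tle w n : (T n w <= T n.+1 w)%E. Proof. by have [/(_ n)[]] := Tinc w. Qed.
Let Tlt w n : (T n w < +oo)%E -> (T n w < T n.+1 w)%E.
Proof. by have [/(_ n)[]] := Tinc w. Qed.
Let Tlim w : T n w @[n --> \oo] --> +oo%E. Proof. by have [] := Tinc w. Qed.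

Local Notation mass := (stopped_mass T).

Let mu_mass m t w B : 0 <= t -> mass mu m t w B =
  (\sum_(0 <= n < m.+1) (if ((0 < T n w) && (T n w <= t%:E))%E
                 then (\1_B (xi n w))%:E else 0))%E.
Proof.
move=> t0; apply: (@step_jump_measure_stopped _ _ (T ^~ w) (xi ^~ w) (X ^~ w)) => //.
- exact: Tlt.
- by move=> s s0; exact: XT.
Qed.

Let mu_mass_le m t w B : 0 <= t -> (mass mu m t w B <= m.+1%:R%:E)%E.
Proof.
move=> t0; rewrite mu_mass//.
apply: (@le_trans _ _ (\sum_(0 <= n < m.+1) (1%:E : \bar R))%E).
  apply: lee_sum => n _; case: ifP => _; last by rewrite lee_fin.
  by rewrite lee_fin indicE; case: (_ \in _).
by rewrite sumEFin lee_fin big_const_nat subn0 iter_addr_0.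
Qed.

Let mu_mass_adapted m t B : 0 <= t -> measurable B ->
  measurable_wrt setT (F t) (fun w => mass mu m t w B).
Proof.
move=> t0 mB; have sF := filt_salg rcF t0.
apply/(measurable_wrtP _ sF (fun _ _ => @subsetT _ _)).
pose A n := [set w | (0 < T n w)%E /\ (T n w <= t%:E)%E /\ B (xi n w)].
have FA n : F t (A n).
  have [_ /(_ t t0)] := @mxi n B mB; rewrite setTI => FB.
  have FT := filtC rcF t0 (filt_le rcF (lexx 0) t0 ((sT n).2 0 (lexx 0))).
  apply: (set_system_ext (filtI rcF t0 FT FB)) => w /=; rewrite /A/=.
  split=> [[/negP]|[Tn [Tt Bx]]]; first by rewrite -ltNge => ? [? ?].
  by split=> //; apply/negP; rewrite -ltNge.
rewrite (_ : (fun w => _) =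
    (fun w => \sum_(0 <= n < m.+1) (\1_(A n) w)%:E)%E); last first.
  apply/funext => w; rewrite mu_mass//; apply: eq_bigr => n _.
  case: ifPn => [/andP[Tn Tt]|h].
    rewrite !indicE (_ : (xi n w \in B) = (w \in A n))//.
    by apply/idP/idP; rewrite !inE /A/=; [|case=> _ []].
  by rewrite indicE memNset// => -[Tn [Tt _]]; move: h; rewrite Tn Tt.
apply: emeasurable_sum => n; apply/measurable_EFinP.
exact: (@measurable_indic _ (g_sigma_algebraType (F t)) R setT _
  (sub_sigma_algebra (FA n))).
Qed.

Let nu_mass_adapted m t B : 0 <= t -> measurable B ->
  measurable_wrt setT (F t) (fun w => mass nu m t w B).
Proof.
move=> t0 mB; have [_ pnu _] := hnu.
exact: (predictable_process_stopped rcF (pnu B mB) (sT m) t0).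
Qed.

Let mass_measurable (a : Omega -> {measure set (R * E) -> \bar R}) m t B :
  measurable_wrt setT (F t) (fun w => mass a m t w B) -> 0 <= t ->
  measurable_fun setT (fun w => mass a m t w B).
Proof. by move=> h t0 _ C mC; exact: (filt_meas rcF t0 (h C mC)). Qed.

Let nu_set C : predictable_prod F C ->
  (\int[P]_w nu w [set z | C (w, z)] = \int[P]_w mu w [set z | C (w, z)])%E.
Proof.
move=> pC; have [_ _ h] := hnu.
have := h (fun z => (\1_C z)%:E) _ (predictable_function_indic pC).
under eq_integral do rewrite (integral_predictable_indic _ _ rcF pC).
under [in RHS]eq_integral do rewrite (integral_predictable_indic _ _ rcF pC).
by apply=> z; rewrite lee_fin.
Qed.

Let rect m s t (A : set Omega) (B : set E) : set (Omega * (R * E)) :=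
  [set z | (([set p | 0 <= p.2 /\ (p.2%:E <= T m p.1)%E] `&` (A `*` `]s, t]%classic))
    (z.1, z.2.1)) /\ B z.2.2].

Let rect_predictable m s t A B : 0 <= s -> s < t -> F s A -> measurable B ->
  predictable_prod F (rect m s t A B).
Proof.
move=> s0 st FA mB; apply: predictable_prod_rect => //.
apply: (salgI (predictable_salg F) (@predictable_sub _ _ _ F)).
  exact: predictable_upto.
exact: predictable_rect.
Qed.

Let rect_section m s t A B w : 0 <= s -> s <= t -> A w ->
  [set z | rect m s t A B (w, z)] =
  (`]0, fine (Order.min t%:E (T m w))]%classic `*` B) `\`
  (`]0, fine (Order.min s%:E (T m w))]%classic `*` B).
Proof.
move=> s0 st Aw; have t0 := le_trans s0 st.
apply/seteqP; split=> -[u x] /=; rewrite !(in_upto (T_ge0 m w))// /rect/=.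
  rewrite in_itv/= => -[[[u0 uT] [_ /andP[su ut]]] Bx].
  have u0' : 0 < u by exact: le_lt_trans su.
  by rewrite u0' ut uT; split=> // -[/and3P[_ us _] _]; move: us; rewrite leNgt su.
move=> [[/and3P[u0 ut uT] Bx] h]; rewrite in_itv/= ut andbT; split=> //.
split; first by split=> //; exact: ltW.
split=> //; rewrite ltNge; apply/negP => us; apply: h.
by rewrite u0 us uT.
Qed.

Let rect_sectionN m s t A B w : ~ A w -> [set z | rect m s t A B (w, z)] = set0.
Proof. by move=> nA; apply/seteqP; split=> // z [[_ []]]. Qed.

(** At most m + 1 jumps up to T m, and nu has the same mean mass there. *)
Let nu_mass_integral m t : 0 <= t ->
  (\int[P]_w mass nu m t w setT <= m.+1%:R%:E)%E.
Proof.
move=> t0; move: t0; rewrite le_eqVlt => /orP[/eqP <-|t0].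
  rewrite integral0_eq ?lee_fin// => w _.
  rewrite /stopped_mass (_ : _ `*` _ = set0) ?measure0//.
  apply/seteqP; split=> // -[u x] /= []; rewrite (in_upto (T_ge0 m w))//.
  by move=> /and3P[u0 u1]; move: u0; rewrite ltNge u1.
have secE (a : Omega -> {measure set (R * E) -> \bar R}) w : a w [set z | rect m 0 t setT setT (w, z)] = mass a m t w setT.
  rewrite (rect_section m setT (lexx 0) (ltW t0) Logic.I) /stopped_mass; apply: congr1.
  apply/seteqP; split=> [z []//|[u x] /= [h _]]; split=> // -[].
  rewrite (in_upto (T_ge0 m w))// => /and3P[u0 u1].
  by move: u0; rewrite ltNge u1.
have := nu_set (rect_predictable m (lexx 0) t0 (filtT rcF (lexx 0)) measurableT).
under eq_integral do rewrite secE.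
under [in RHS]eq_integral do rewrite secE.
move=> ->; apply: (@le_trans _ _ (\int[P]_w (cst m.+1%:R%:E w))%E).
  apply: ge0_le_integral => //.
  - by apply: mass_measurable; [exact: mu_mass_adapted (ltW t0) _|exact: ltW].
  - by move=> w _; exact: mu_mass_le (ltW t0).
rewrite integral_cst//= [X in (_ * X)%E](_ : _ = 1%E) ?mule1//.
exact: probability_setT.
Qed.

(** Off this null set nu is finite up to each T m; inside it nothing is known
    about the paths of nu. *)
Definition explosion_set : set Omega :=
  \bigcup_m \bigcup_k [set w | mass nu m k%:R w setT = +oo%E].

Let mexp m k : measurable [set w | mass nu m k%:R w setT = +oo%E].
Proof.
have mf := mass_measurable (nu_mass_adapted m (ler0n R k) (measurableT : measurable (setT : set E))) (ler0n R k).
by have := mf measurableT [set +oo%E] (emeasurable_set1 _); rewrite setTI.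
Qed.

Lemma explosion_set_measurable : measurable explosion_set.
Proof.
by apply: bigcup_measurable => m _; apply: bigcup_measurable => k _; exact: mexp.
Qed.

Lemma explosion_set_null : P explosion_set = 0%E.
Proof.
apply/negligibleP; first exact: explosion_set_measurable.
apply: negligible_bigcup => m; apply: negligible_bigcup => k.
apply/negligibleP => //.
have mf := mass_measurable (nu_mass_adapted m (ler0n R k) (measurableT : measurable (setT : set E))) (ler0n R k).
have : P.-integrable setT (fun w => mass nu m k%:R w setT).
  apply/integrableP; split=> //.
  under eq_integral do rewrite gee0_abs//.
  by apply: le_lt_trans (nu_mass_integral m (ler0n R k)) _; exact: ltry.
move=> /(integrable_ae measurableT)[A [mA A0 hA]].
apply/eqP; rewrite eq_le measure_ge0 andbT -A0; apply: le_measure; rewrite ?inE//.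
by move=> w /= wy; apply: hA => /=; rewrite wy => /(_ Logic.I).
Qed.

Let mu_negative w : mu w [set z | z.1 <= 0] = 0%E.
Proof.
rewrite /mu/= /jump_measure esum1// => s [s0 _].
by rewrite diracE memNset//= => s1; move: s0; rewrite ltNge s1.
Qed.

Let nu_fin m t w : ~ explosion_set w -> 0 <= t -> (mass nu m t w setT < +oo)%E.
Proof.
move=> Nw t0.
have tk : t <= (Num.truncn t).+1%:R by rewrite ltW// truncnS_gt.
apply: (@le_lt_trans _ _ (mass nu m (Num.truncn t).+1%:R w setT)).
  exact: (mass_upto_le (nu w) (T_ge0 m w) (@measurableT _ E) t0 tk).
by rewrite ltey; apply/eqP => h; apply: Nw; exists m => //; exists (Num.truncn t).+1.
Qed.

Lemma jump_locally_integrable : locally_integrable_measure P T explosion_set mu.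
Proof.
split=> [w _|n t B t0 mB|n t t0|n t w _ t0].
- exact: mu_negative.
- by apply: mass_measurable => //; exact: mu_mass_adapted.
- apply: (@le_lt_trans _ _ (\int[P]_w (cst n.+1%:R%:E w))%E); last first.
    rewrite integral_cst//= [X in (_ * X)%E](_ : _ = 1%E) ?mule1 ?ltry//.
    exact: probability_setT.
  apply: ge0_le_integral => //.
  + by apply: mass_measurable => //; exact: mu_mass_adapted.
  + by move=> w _; exact: mu_mass_le.
- by apply: le_lt_trans (mu_mass_le n w setT t0) _; exact: ltry.
Qed.

Lemma compensator_locally_integrable :
  locally_integrable_measure P T explosion_set nu.
Proof.
split=> [w _|n t B t0 mB|n t t0|n t w Nw t0].
- by case: hnu => ->.
- by apply: mass_measurable => //; exact: nu_mass_adapted.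
- by apply: le_lt_trans (nu_mass_integral n t0) _; exact: ltry.
- exact: nu_fin.
Qed.

Let compensated m B t w := fine (mass mu m t w B) - fine (mass nu m t w B).

(** The defining property of nu, for the indicator of A x ]s, t] x B cut at
    T m. *)
Let compensated_increment m B s t A : measurable B -> 0 <= s -> s <= t -> F s A ->
  (\int[P]_(w in A) (compensated m B t w)%:E =
   \int[P]_(w in A) (compensated m B s w)%:E)%E.
Proof.
move=> mB s0; rewrite le_eqVlt => /orP[/eqP -> //|st] FA.
have t0 : 0 <= t by rewrite (le_trans s0)// ltW.
have mA := filt_meas rcF s0 FA.
have hmu := jump_locally_integrable; have hn := compensator_locally_integrable.
have iA (a : Omega -> {measure set (R * E) -> \bar R}) x : locally_integrable_measure P T explosion_set a -> 0 <= x ->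
    P.-integrable A (fun w => (fine (mass a m x w B))%:E).
  by move=> ha x0; apply: integrableS (stopped_mass_integrable ha m x0 mB).
have fA (a : Omega -> {measure set (R * E) -> \bar R}) x : locally_integrable_measure P T explosion_set a -> 0 <= x ->
    (\int[P]_(w in A) (fine (mass a m x w B))%:E)%E \is a fin_num.
  by move=> ha x0; apply: integrable_fin_num => //; exact: iA.
have incr (a : Omega -> {measure set (R * E) -> \bar R}) : locally_integrable_measure P T explosion_set a ->
    (\int[P]_w a w [set z | rect m s t A B (w, z)] =
     \int[P]_(w in A) (fine (mass a m t w B))%:E -
     \int[P]_(w in A) (fine (mass a m s w B))%:E)%E.
  move=> ha; pose h w : R :=
    if w \in A `\` explosion_set then fine (mass a m t w B) - fine (mass a m s w B) else 0.
  have sec w : ~ explosion_set w -> a w [set z | rect m s t A B (w, z)] = (h w)%:E.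
    move=> Nw; rewrite /h; case: ifPn => [/set_mem[Aw _]|/negP].
      rewrite (rect_section m B s0 (ltW st) Aw) EFinB !fineK; last 2 first.
      - exact: (stopped_mass_fin ha).
      - exact: (stopped_mass_fin ha).
      rewrite measureD//.
      + congr (_ - _)%E; apply: congr1; apply/setIidr => -[u x] [/=].
        rewrite !(in_upto (T_ge0 m w))// => /and3P[-> us ->] Bx.
        by rewrite (le_trans us (ltW st)).
      + exact: measurable_upto.
      + exact: measurable_upto.
      + by have := stopped_mass_fin ha m Nw t0 mB; rewrite ge0_fin_numE.
    rewrite in_setE => nA; rewrite rect_sectionN ?measure0// => Aw.
    by apply: nA; split.
  have mh : measurable_fun setT (EFin \o h).
    have mDf : measurable_fun setT
        (fun w => (fine (mass a m t w B) - fine (mass a m s w B))%:E).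
      apply/measurable_EFinP/measurable_funB; apply/measurable_EFinP.
        by have /integrableP[] := stopped_mass_integrable ha m t0 mB.
      by have /integrableP[] := stopped_mass_integrable ha m s0 mB.
    apply/measurable_EFinP.
    rewrite (_ : h = (fun w => fine (mass a m t w B) - fine (mass a m s w B))
        \_ (A `\` explosion_set)).
      apply/measurable_restrict => //.
        by apply: measurableD => //; exact: explosion_set_measurable.
      by move/measurable_EFinP : mDf; exact: measurable_funS.
    by apply/funext => w; rewrite /h patchE.
  have -> : (\int[P]_w a w [set z | rect m s t A B (w, z)] = \int[P]_w (h w)%:E)%E.
    apply: (integral_null_ext explosion_set_measurable explosion_set_null) => //.
    - move=> w; rewrite lee_fin /h; case: ifPn => // /set_mem[_ Nw].
      rewrite subr_ge0 -lee_fin !fineK; [|exact: (stopped_mass_fin ha)..].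
      exact: (mass_upto_le (a w) (T_ge0 m w) mB s0 (ltW st)).
  have e := integralB_EFin mA (iA _ _ ha t0) (iA _ _ ha s0).
  rewrite -e [RHS]integral_mkcond; apply: ae_eq_integral => //.
  - apply/(measurable_restrict _ mA measurableT); rewrite setTI.
    apply: emeasurable_funB.
      by have /integrableP[] := iA _ _ ha t0.
    by have /integrableP[] := iA _ _ ha s0.
  - exists explosion_set; split=> [||w].
    + exact: explosion_set_measurable.
    + exact: explosion_set_null.
    + apply: contra_notP => Nw _; rewrite patchE /h.
      rewrite in_setD (memNset Nw)/= andbT.
      by case: ifPn => // _; rewrite EFinB.
have := nu_set (rect_predictable m s0 st FA mB).
rewrite (incr _ hmu) (incr _ hn).
rewrite /compensated.
under [in X in _ -> X]eq_integral do rewrite EFinB.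
under [in X in _ -> _ = X]eq_integral do rewrite EFinB.
rewrite (integralB_EFin mA (iA _ _ hmu t0) (iA _ _ hn t0)).
rewrite (integralB_EFin mA (iA _ _ hmu s0) (iA _ _ hn s0)).
move: (fA _ _ hmu t0) (fA _ _ hn t0) (fA _ _ hmu s0) (fA _ _ hn s0).
move: (integral _ _ _) (integral _ _ _) (integral _ _ _) (integral _ _ _).
move=> [x1| |] [x2| |] [x3| |] [x4| |]// _ _ _ _ /eqP; rewrite -!EFinB eqe.
by move=> /eqP e; congr (_%:E); lra.
Qed.

Let compensated_martingale m B : measurable B -> martingale P F (compensated m B).
Proof.
move=> mB; have hmu := jump_locally_integrable.
have hn := compensator_locally_integrable.
split.
- move=> t t0; have sF := filt_salg rcF t0.
  apply/(measurable_wrtP _ sF (fun _ _ => @subsetT _ _)).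
  have sub := fun C (_ : F t C) => @subsetT _ C.
  apply: measurable_funB; apply: measurableT_comp => //.
  + by apply/(measurable_wrtP _ sF sub); exact: mu_mass_adapted.
  + by apply/(measurable_wrtP _ sF sub); exact: nu_mass_adapted.
- move=> t t0; rewrite /compensated.
  have := integrableB measurableT (stopped_mass_integrable hmu m t0 mB)
    (stopped_mass_integrable hn m t0 mB).
  by apply: eq_integrable => // w _ /=; rewrite EFinB.
- exists explosion_set; split.
  + exact: explosion_set_measurable.
  + exact: explosion_set_null.
  + move=> w; apply: contra_notP => Nw.
    have fa (a : Omega -> {measure set (R * E) -> \bar R}) t :
        locally_integrable_measure P T explosion_set a -> 0 <= t ->
        (mass_upto (a w) (T m w) B t < +oo)%E.
      move=> ha t0.
      by have := stopped_mass_fin ha m Nw t0 mB; rewrite ge0_fin_numE.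
    split=> t t0; rewrite /compensated /=.
    * apply: cvgB.
        exact: (mass_upto_right (T_ge0 m w) mB (fun t => fa mu t hmu)).
      exact: (mass_upto_right (T_ge0 m w) mB (fun t => fa nu t hn)).
    * apply: is_cvgB.
        exact: (mass_upto_left (T_ge0 m w) mB (fun t => fa mu t hmu) t0).
      exact: (mass_upto_left (T_ge0 m w) mB (fun t => fa nu t hn) t0).
- by move=> s t A s0 st FA; exact: compensated_increment.
Qed.

(** Immersion turns the compensated jump measure into a martingale of the
    larger filtration: the F-compensator remains the compensator. *)
Lemma jump_same_martingale_part G : immersed P F G ->
  same_martingale_part P G T mu nu.
Proof.
move=> FG m B s t A mB s0 st GA.
by have [_ _ _ h] := FG _ (compensated_martingale m mB); exact: h.
Qed.

End immersion.

(** * Predictable times carried by predictable sets *)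

Section predictable_times_from_sets.
Context {R : realType} {dO : measure_display} {Omega : measurableType dO}.
Variable F : R -> set (set Omega).
Hypothesis rcF : rc_filtration F.

Lemma predictable_before (n : R) : predictable F [set p : Omega * R | 0 <= p.2 /\ p.2 < n].
Proof.
have sF := predictable_salg F.
have -> : [set p : Omega * R | 0 <= p.2 /\ p.2 < n] =
    \bigcup_(q : rat) (if (0 <= ratr q :> R) && (ratr q < n) then
      [set p : Omega * R | 0 <= p.2 /\ (p.2%:E <= (ratr q)%:E)%E] else set0).
  apply/seteqP; split=> [[w t] /= [t0 tn]|[w t] [q _]]; last first.
    case: ifPn => // /andP[q0 qn] /= [t0]; rewrite lee_fin => tq.
    by split=> //; exact: le_lt_trans qn.
  have [q] := rat_in_itvoo tn; rewrite in_itv/= => /andP[tq qn].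
  exists q => //; rewrite qn (le_trans t0 (ltW tq))/=.
  by split=> //; rewrite lee_fin ltW.
apply: (salg_bigcup_count sF) => q; case: ifPn => [/andP[q0 _]|_]; last exact: salg0 sF.
have q0' : (0 <= (ratr q : R)%:E)%E by rewrite lee_fin.
exact: predictable_upto (stopping_time_cst rcF q0').
Qed.

Variables (Gamma : set (Omega * R)) (s : Omega -> \bar R).
Hypotheses (pGamma : predictable F Gamma) (ss : stopping_time F s)
  (Gammas : forall w t, Gamma (w, t) -> s w = t%:E).

(** The debut of Gamma, whose only possible value at w is s w. *)
Definition section_time (w : Omega) : \bar R :=
  if (w, fine (s w)) \in Gamma then s w else +oo%E.

Lemma section_timeP w t : Gamma (w, t) <-> section_time w = t%:E.
Proof.
rewrite /section_time; split=> [Gt|].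
  by rewrite (Gammas Gt)/= mem_set.
by case: ifPn => [/set_mem|_ //] => Gs st; move: Gs; rewrite st.
Qed.

Lemma section_time_stopping : stopping_time F section_time.
Proof.
have s0 w : (0 <= s w)%E by case: ss.
split=> [w|t t0]; first by rewrite /section_time; case: ifP => _; rewrite ?leey.
apply: (set_system_ext (filtI rcF t0 (ss.2 t t0) (predictable_stopped rcF ss t0 pGamma))) => w /=.
rewrite /section_time; split=> [[st Gs]|].
  by move: Gs; rewrite min_r// => Gs; rewrite mem_set.
case: ifPn => [/set_mem Gs st|_]; last by rewrite leye_eq.
by rewrite min_r.
Qed.

(** The complement of [[0, section_time[[ is Gamma together with the times
    strictly after it. *)
Lemma section_time_predictable : predictable_time F section_time.
Proof.
split; first exact: section_time_stopping.
have sF := predictable_salg F.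
have := salgC sF (salgU sF pGamma (predictable_after section_time_stopping)).
move=> h; apply: (set_system_ext h) => -[w t] /=.
split=> [[t0 nG]|[t0 ts]].
  split=> //; rewrite ltNge; apply/negP => st; apply: nG.
  have [lt|] := ltP (section_time w) t%:E; first by right.
  by move=> ts; left; apply/section_timeP/eqP; rewrite eq_le st.
split=> // -[/section_timeP|[_]]; last by rewrite ltNge ltW.
by move=> st; move: ts; rewrite st ltxx.
Qed.

Lemma section_time_truncated_predictable (n : R) : 0 <= n ->
  predictable_time F (fun w => Order.min (section_time w) n%:E).
Proof.
move=> n0; have [ss' pbefore] := section_time_predictable.
split; first by apply: stopping_time_min => //; apply: stopping_time_cst; rewrite // lee_fin.
have sF := predictable_salg F.
apply: (set_system_ext (salgI sF (@predictable_sub _ _ _ F) pbefore (predictable_before n))).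
by move=> -[w t] /=; rewrite lt_min lte_fin; split=> [[[? ->] [? ->]]|[? /andP[]]].
Qed.

End predictable_times_from_sets.

Section level_crossing.
Context {R : realType} {dO : measure_display} {Omega : measurableType dO}.
Variables (F : R -> set (set Omega)) (A : R -> Omega -> \bar R) (c : \bar R).
Hypotheses (rcF : rc_filtration F) (pA : predictable_process F A)
  (ndA : forall w s t, 0 <= s -> s <= t -> (A s w <= A t w)%E).

(** The compensator may explode on a null set, which a filtration that is not
    complete cannot discard, and right after an explosion A need not be
    right-continuous.  Hence the crossing set keeps the crossing time only if
    the level is reached at that time. *)
Definition crossing_time (w : Omega) : \bar R :=
  ereal_inf [set t%:E | t in [set t | 0 <= t /\ (c <= A t w)%E]].

Let adaptedA t : 0 <= t -> F t [set w | (c <= A t w)%E].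
Proof.
move=> t0; have := predictable_process_stopped rcF pA
  (stopping_time_cst rcF (leey (0 : \bar R))) t0.
move=> /(_ [set x | (c <= x)%E]).
have -> : [set x : \bar R | (c <= x)%E] = `[c, +oo[%classic.
  by apply/seteqP; split=> x /=; rewrite in_itv/= andbT.
move=> /(_ (emeasurable_itv _)); rewrite setTI.
move=> h; apply: (set_system_ext h) => w /=; rewrite in_itv/= andbT.
by rewrite min_l ?leey.
Qed.

(** The level is reached by time t, or immediately after it; the filtration is
    right-continuous. *)
Lemma crossing_time_stopping : stopping_time F crossing_time.
Proof.
split=> [w|t t0]; first by apply: le_ereal_inf_tmp => _ [t [t0 _] <-]; rewrite lee_fin.
pose e (n : nat) : R := t + n.+1%:R^-1.
have te n : t < e n by rewrite ltrDl invr_gt0.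
have e0 n : 0 <= e n by rewrite (le_trans t0)// ltW.
apply: (filt_rc rcF t0) => u tu; have u0 : 0 <= u by rewrite (le_trans t0)// ltW.
pose m0 := Num.truncn (u - t)^-1.
have m0u : e m0 <= u.
  rewrite -lerBrDl invf_ple ?posrE ?subr_gt0//.
  by rewrite ltW// truncnS_gt.
have FA n : F u [set w | (c <= A (e (m0 + n)%N) w)%E].
  apply: (filt_le rcF (e0 (m0 + n)%N)); last exact: adaptedA.
  apply: le_trans m0u; rewrite lerD2l lef_pV2 ?posrE// ler_nat ltnS.
  exact: leq_addr.
apply: (set_system_ext (filt_bigcap rcF u0 FA)) => w /=; split=> [h|h n _].
  apply/lee_addgt0Pr => r r0.
  pose n := Num.truncn r^-1.
  apply: (@le_trans _ _ (e (m0 + n)%N)%:E).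
    by apply: ereal_inf_lbound; exists (e (m0 + n)%N) => //; split=> //; exact: h.
  rewrite -EFinD lee_fin lerD2l invf_ple ?posrE//.
  rewrite (le_trans (ltW (truncnS_gt _)))// ler_nat ltnS; exact: leq_addl.
have := le_lt_trans h (_ : t%:E < (e (m0 + n)%N)%:E)%E; rewrite lte_fin.
move=> /(_ (te _)) /ereal_inf_lt[_ [v [v0 cv] <-]]; rewrite lte_fin => /ltW ve.
exact: le_trans cv (ndA w v0 ve).
Qed.

Definition crossing_set : set (Omega * R) :=
  [set p | [/\ 0 <= p.2, (c <= A p.2 p.1)%E & (p.2%:E <= crossing_time p.1)%E]].

Lemma crossing_set_predictable : predictable F crossing_set.
Proof.
have sF := predictable_salg F.
have pc : predictable F [set p | 0 <= p.2 /\ (c <= A p.2 p.1)%E].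
  apply: (set_system_ext (pA (emeasurable_itv `[c, +oo[))) => -[w t] /=.
  by rewrite in_itv/= andbT.
apply: (set_system_ext (salgI sF (@predictable_sub _ _ _ F) pc
  (predictable_upto crossing_time_stopping))).
by move=> -[w t]; rewrite /crossing_set/=; split=> [[[? ?] [? ?]]|[? ? ?]].
Qed.

Lemma crossing_setP w t : crossing_set (w, t) -> crossing_time w = t%:E.
Proof.
move=> [/= t0 ct tc]; apply/eqP; rewrite eq_le tc andbT.
by apply: ereal_inf_lbound; exists t.
Qed.

(** A jump of A across c happens at the crossing time of c. *)
Lemma crossing_set_jump w t : 0 <= t -> (c <= A t w)%E ->
  (forall s, 0 <= s -> s < t -> (A s w < c)%E) -> crossing_set (w, t).
Proof.
move=> t0 ct hs; split=> //=; apply: le_ereal_inf_tmp => _ [s [s0 cs] <-].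
by rewrite lee_fin leNgt; apply/negP => /(hs s s0); rewrite ltNge cs.
Qed.

End level_crossing.

(** * Quasi-left continuity under immersion *)

Section null_transfer.
Context {R : realType} {dO : measure_display} {Omega : measurableType dO}.
Context {dE : measure_display} {E : measurableType dE}.
Variables (P : probability Omega R) (G : R -> set (set Omega)).
Hypothesis rcG : rc_filtration G.
Variables (T : nat -> Omega -> \bar R) (N : set Omega).
Hypotheses (sT : forall n, stopping_time G (T n))
  (mN : measurable N) (N0 : P N = 0%E)
  (Tle : forall w, ~ N w -> forall n, (T n w <= T n.+1 w)%E)
  (Tlim : forall w, ~ N w -> T n w @[n --> \oo] --> +oo%E).
Variables a b : Omega -> {measure set (R * E) -> \bar R}.
Hypotheses (ha : locally_integrable_measure P T N a)
  (hb : locally_integrable_measure P T N b)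
  (hab : same_martingale_part P G T a b).

Let eq_integral_null (f g : Omega -> \bar R) : measurable_fun setT f ->
  measurable_fun setT g -> (forall w, 0 <= f w)%E -> (forall w, 0 <= g w)%E ->
  (\int[P]_w f w = \int[P]_w g w)%E ->
  {ae P, forall w, f w = 0%E} -> {ae P, forall w, g w = 0%E}.
Proof.
move=> mf mg f0 g0 fg f00.
have gI : (\int[P]_w `|g w| = 0)%E.
  rewrite (eq_integral g); last by move=> w _; rewrite gee0_abs.
  rewrite -fg -(integral0 P setT); apply: ae_eq_integral => //.
  by apply: filterS f00 => w fw _.
have := (ae_eq_integral_abs P measurableT mg).1 gI.
by apply: filterS => w; apply.
Qed.

(** The expectations of the two masses are equal, and a nonnegative function
    with null integral vanishes almost everywhere. *)
Lemma predictable_null_iff C : predictable_prod G C ->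
  {ae P, forall w, a w [set z | C (w, z)] = 0%E} <->
  {ae P, forall w, b w [set z | C (w, z)] = 0%E}.
Proof.
move=> pC.
have W0 z : (0 <= (\1_C z)%:E :> \bar R)%E by rewrite lee_fin.
have [f [g [mf mg fa gb [f0 g0 fg]]]] := predictable_integral_eq rcG sT mN N0
  Tle Tlim ha hb hab W0 (predictable_function_indic pC).
have aeN : {ae P, forall w, ~ N w}.
  by exists N; split=> // w /= /contrapT.
have aeiff (m : Omega -> {measure set (R * E) -> \bar R}) (h : Omega -> \bar R) :
    (forall w, ~ N w -> h w = \int[m w]_(z in [set z | (0 <= z.1)%R]) (\1_C (w, z))%:E)%E ->
    {ae P, forall w, m w [set z | C (w, z)] = 0%E} <-> {ae P, forall w, h w = 0%E}.
  move=> hm; split; apply: filterS2 aeN => w Nw.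
    by rewrite hm// (integral_predictable_indic _ _ rcG pC).
  by rewrite hm// (integral_predictable_indic _ _ rcG pC).
split=> [/(aeiff a f fa)|/(aeiff b g gb)] h.
  by apply/(aeiff b g gb); exact: eq_integral_null mf mg f0 g0 fg h.
by apply/(aeiff a f fa); exact: eq_integral_null mg mf g0 f0 (esym fg) h.
Qed.

End null_transfer.

Section jump_measure_null.
Context {R : realType} {dE : measure_display} {E : measurableType dE}.
Variables (dy : R -> E) (zero : E).

Lemma jump_measure_eq0 C : jump_measure dy zero C = 0%E <->
  forall s, 0 < s -> dy s <> zero -> ~ C (s, dy s).
Proof.
split=> [h s s0 ys Cs|h]; last first.
  rewrite /jump_measure esum1// => s [s0 ys].
  by rewrite diracE memNset//; exact: h.
have : (1 <= jump_measure dy zero C)%E.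
  apply: esum_ge; exists [set s].
    by split; [exact: finite_set1|move=> _ ->].
  by rewrite fsbig_set1 diracE mem_set.
by rewrite h; rewrite lee_fin ler10.
Qed.

End jump_measure_null.

Section quasi_left_continuity.
Context {R : realType} {dO : measure_display} {Omega : measurableType dO}.
Variables (P : probability Omega R) (d : nat).
Local Notation E := 'rV[R]_d.
Variables (F G : R -> set (set Omega)) (X : R -> Omega -> E)
  (T : nat -> Omega -> \bar R) (N : set Omega)
  (nu : Omega -> {measure set (R * E) -> \bar R}).
Hypotheses (rcF : rc_filtration F) (rcG : rc_filtration G)
  (FG : forall t, 0 <= t -> F t `<=` G t)
  (sT : forall n, stopping_time F (T n))
  (mN : measurable N) (N0 : P N = 0%E)
  (Tle : forall w, ~ N w -> forall n, (T n w <= T n.+1 w)%E)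
  (Tlim : forall w, ~ N w -> T n w @[n --> \oo] --> +oo%E).

Let mu : Omega -> {measure set (R * E) -> \bar R} :=
  fun w => jump_measure (jump (X ^~ w)) (0 : E).

Hypotheses (hmu : locally_integrable_measure P T N mu)
  (hnu : locally_integrable_measure P T N nu)
  (pnu : predictable_process F (fun t w => nu w (`]0, t]%classic `*` setT)))
  (sameF : same_martingale_part P F T mu nu)
  (sameG : same_martingale_part P G T mu nu).

Let A (t : R) w := nu w (`]0, t]%classic `*` setT).

Let mA (t : R) : measurable (`]0, t]%classic `*` (setT : set E)).
Proof. by apply: measurableX => //; exact: measurable_itv. Qed.

Let ndA w s t : 0 <= s -> s <= t -> (A s w <= A t w)%E.
Proof.
move=> s0 st; apply: le_measure; rewrite ?inE; try exact: mA.
move=> [u x] [/=]; rewrite !in_itv/= => /andP[-> us] _.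
by rewrite (le_trans us st).
Qed.

Let A_fin w t : ~ N w -> 0 <= t -> (A t w < +oo)%E.
Proof.
move=> Nw t0; have /cvgeyPge/(_ t)[k _ /(_ k (leqnn k)) tT] := Tlim Nw.
have [_ _ _ /(_ k t w Nw t0)] := hnu.
by rewrite /stopped_mass min_l.
Qed.

Hypothesis qX : quasi_left_continuous P F X.

(** The level crossings of the predictable increasing process A exhaust its
    jumps, and they are predictable times, at which X does not jump. *)
Let crossing_null c :
  {ae P, forall w, nu w [set z : R * E | crossing_set A c (w, z.1)] = 0%E}.
Proof.
have pc := crossing_set_predictable c rcF pnu ndA.
have st := crossing_time_stopping c rcF pnu ndA.
have cP := @crossing_setP _ _ _ A c.
pose s := section_time (crossing_set A c) (crossing_time A c).
have pprod : predictable_prod F [set z : Omega * (R * E) |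
    crossing_set A c (z.1, z.2.1) /\ setT z.2.2] by exact: predictable_prod_rect.
have := (predictable_null_iff rcF sT mN N0 Tle Tlim hmu hnu sameF pprod).1.
have sec (m : Omega -> {measure set (R * E) -> \bar R}) w :
    m w [set z | [set z : Omega * (R * E) |
      crossing_set A c (z.1, z.2.1) /\ setT z.2.2] (w, z)] =
    m w [set z : R * E | crossing_set A c (w, z.1)].
  by apply: congr1; apply/seteqP; split=> z /= => [[]|].
move=> h.
suff /h : {ae P, forall w, mu w [set z | [set z : Omega * (R * E) |
      crossing_set A c (z.1, z.2.1) /\ setT z.2.2] (w, z)] = 0%E}.
  by apply: filterS => w; rewrite sec.
have : {ae P, forall w, forall n : nat,
    jump (X ^~ w) (fine (Order.min (s w) n%:R%:E)) = 0}.
  apply: ae_foralln => n; apply: qX.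
    exact: (section_time_truncated_predictable rcF pc st cP).
  by move=> w; rewrite gt_min ltry orbT.
apply: filterS => w jw; rewrite sec.
apply/jump_measure_eq0 => t t0 jt /= /(section_timeP cP) st'.
apply: jt; rewrite -(jw (Num.truncn t).+1) /s st' min_l//.
by rewrite lee_fin ltW// truncnS_gt.
Qed.

(** An atom of nu at time t is a jump of A at t, so A crosses some rational level
    at t; there are countably many of these levels. *)
Lemma compensator_no_atom :
  {ae P, forall w, forall t, 0 < t -> nu w ([set t] `*` setT) = 0%E}.
Proof.
have : {ae P, forall w, forall n : nat, forall q : rat, unpickle n = Some q ->
    nu w [set z : R * E | crossing_set A (ratr q : R)%:E (w, z.1)] = 0%E}.
  apply: ae_foralln => n; case: (unpickle n) => [q|]; last exact: aeW.
  by apply: filterS (crossing_null (ratr q)%:E) => w h _ [<-].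
have aeN : {ae P, forall w, ~ N w}.
  by exists N; split=> // w /= /contrapT.
apply: filterS2 aeN => w Nw hq t t0.
have mt : measurable ([set t] `*` (setT : set E)) by exact: measurableX.
pose I : set R := `]0, t[%classic.
have mo : measurable (I `*` (setT : set E)).
  by apply: measurableX => //; exact: measurable_itv.
have AE : (A t w = nu w (I `*` setT) + nu w ([set t] `*` setT))%E.
  rewrite -measureU//.
    rewrite /A; apply: congr1; apply/seteqP; split=> -[u y] /=; rewrite /I/= !in_itv/=.
      move=> [/andP[u0]]; rewrite le_eqVlt => /orP[/eqP ->|ut] _; first by right.
      by left; rewrite u0 ut.
    by move=> [[/andP[u0 ut] _]|[ut _]]; [rewrite u0 ltW|rewrite ut t0 lexx].
  apply/seteqP; split=> // -[u x] /= [[uI _] [ut _]].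
  by move: uI; rewrite ut /I/= in_itv/= ltxx andbF.
apply/eqP; rewrite eq_le measure_ge0 andbT leNgt; apply/negP => nt.
have Afin := A_fin Nw (ltW t0).
pose x := nu w (I `*` setT).
have xA : (x <= A t w)%E by rewrite AE leeDl.
have xfin : x \is a fin_num by rewrite ge0_fin_numE; [exact: le_lt_trans xA Afin|exact: measure_ge0].
have Afin' : A t w \is a fin_num by rewrite ge0_fin_numE.
have xltA : fine x < fine (A t w).
  rewrite -lte_fin !fineK// AE -/x.
  by rewrite lteDl.
have [q] := rat_in_itvoo xltA; rewrite in_itv/= => /andP[xq qA].
have := hq (pickle q) q (pickleK q).
have mcross : measurable [set z : R * E | crossing_set A (ratr q : R)%:E (w, z.1)].
  have pc := crossing_set_predictable (ratr q : R)%:E rcF pnu ndA.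
  have mc := predictable_prod_section w rcF (predictable_prod_rect pc (@measurableT _ E)).
  by apply: (set_system_ext mc) => z /=; split=> [[]|].
apply/eqP; rewrite gt_eqF//; apply: (lt_le_trans nt).
apply: le_measure; rewrite ?inE//.
move=> [u y] /= [-> _]; apply: crossing_set_jump; first exact: ltW.
  by rewrite -(fineK Afin') lee_fin ltW.
move=> s s0 st; apply: (@le_lt_trans _ _ x); last by rewrite -(fineK xfin) lte_fin.
apply: le_measure; rewrite ?inE//.
move=> [v z] [/=]; rewrite /I/= !in_itv/= => /andP[-> vs] _.
by rewrite (le_lt_trans vs st).
Qed.

(** The compensator has no atom, hence gives no mass to the graph of sigma; as
    it is also the compensator for G, neither does the jump measure. *)
Lemma quasi_left_continuous_enlarged : quasi_left_continuous P G X.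
Proof.
move=> sigma psigma sfin.
have pprod : predictable_prod G [set z : Omega * (R * E) |
    [set p | 0 <= p.2 /\ p.2%:E = sigma p.1] (z.1, z.2.1) /\ setT z.2.2].
  by apply: predictable_prod_rect => //; exact: predictable_graph.
have sTG n := stopping_time_le FG (sT n).
have := (predictable_null_iff rcG sTG mN N0 Tle Tlim hmu hnu sameG pprod).2.
have s0 w : (0 <= sigma w)%E by case: psigma => -[].
have sE w : (fine (sigma w))%:E = sigma w by rewrite fineK// ge0_fin_numE.
have aeN : {ae P, forall w, ~ N w}.
  by exists N; split=> // w /= /contrapT.
move=> h; have /h : {ae P, forall w, nu w [set z | [set z : Omega * (R * E) |
    [set p | 0 <= p.2 /\ p.2%:E = sigma p.1] (z.1, z.2.1) /\ setT z.2.2] (w, z)] = 0%E}.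
  apply: filterS2 compensator_no_atom aeN => w hw Nw.
  have [s0'|s0'] := ltP 0 (fine (sigma w)).
    rewrite -(hw _ s0'); apply: congr1; apply/seteqP; split=> -[u y] /=.
      by move=> [[_ us] _]; rewrite -us.
    by move=> [-> _]; split=> //; split; [exact: ltW|exact: sE].
  have [/(_ w Nw) h0 _ _ _] := hnu.
  apply/eqP; rewrite eq_le measure_ge0 andbT -h0; apply: le_measure; rewrite ?inE.
  - exact: (predictable_prod_section w rcG pprod).
  - rewrite (_ : [set z | _] = `]-oo, 0]%classic `*` setT).
      by apply: measurableX => //; exact: measurable_itv.
    by apply/seteqP; split=> z /=; rewrite in_itv/= => // -[].
  - move=> [u y] /= [[_ us] _]; rewrite (le_trans _ s0')//.
    by rewrite -lee_fin us sE.
apply: filterS => w /jump_measure_eq0 hw.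
have [s0'|s0'] := ltP 0 (fine (sigma w)); last by rewrite /jump ltNge s0'.
by apply: contrapT => /(hw _ s0'); apply; split=> //=; split=> //; exact: ltW.
Qed.

End quasi_left_continuity.

(** * The default process and measures on the product space *)

Section product_random_measures.
Context {R : realType} {d : nat}.
Local Notation E := 'rV[R]_d.

Lemma measurable_mark_pair (a : R) :
  measurable_fun setT (fun z : R * E => (z.1, (z.2, a))).
Proof.
apply/measurable_fun_pairP; split; first exact: measurable_fst.
apply/measurable_fun_pairP; split; first exact: measurable_snd.
exact: measurable_cst.
Qed.

Lemma measurable_mark_slice (a : R) (C : set (R * (E * R))) : measurable C ->
  measurable [set z : R * E | C (z.1, (z.2, a))].
Proof.
by move=> mC; rewrite -[X in measurable X]setTI; exact: measurable_mark_pair.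
Qed.

Lemma measurable_slice (a : R) (B : set (E * R)) : measurable B ->
  measurable [set x : E | B (x, a)].
Proof.
move=> mB; rewrite -[X in measurable X]setTI.
have : measurable_fun setT (fun x : E => (x, a)).
  by apply/measurable_fun_pairP; split; [exact: measurable_id|exact: measurable_cst].
exact.
Qed.

Lemma times_diracE (nu : {measure set (R * E) -> \bar R}) a C : measurable C ->
  times_dirac nu a C = nu [set z | C (z.1, (z.2, a))].
Proof.
move=> mC; rewrite /times_dirac /product_measure1.
have mS := measurable_mark_slice a mC.
rewrite -[X in _ = nu X]setIT -integral_indic//; apply: eq_integral => z _.
rewrite /= diracE indicE; congr (_%:R%:E).
rewrite (_ : (a \in _) = (z \in [set z | C (z.1, (z.2, a))]))//.
by rewrite mem_xsection; apply/idP/idP; rewrite !inE.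
Qed.

Lemma stieltjes_times_diracE (L : cumulative R R) (C : set (R * (E * R))) :
  measurable C ->
  times_dirac (stieltjes L \x \d_(0%R : E))%E 1 C =
  stieltjes L [set t | C (t, (0, 1))].
Proof.
move=> mC; rewrite times_diracE// /product_measure1.
have mS := measurable_mark_slice 1 mC.
have mt : measurable [set t : R | C (t, (0, 1))].
  have := measurable_ysection (0 : E) mS; congr measurable.
  by apply/seteqP; split=> t; rewrite /ysection/= inE.
rewrite -[X in _ = stieltjes L X]setIT -integral_indic//; apply: eq_integral => t _.
rewrite /= diracE indicE; congr (_%:R%:E).
rewrite (_ : ((0 : E) \in _) = (t \in [set t | C (t, (0, 1))]))//.
by rewrite mem_xsection; apply/idP/idP; rewrite !inE.
Qed.

Lemma stieltjes_oc (L : cumulative R R) (b : R) : L 0 = 0 -> 0 <= b ->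
  stieltjes L `]0, b]%classic = (L b)%:E.
Proof.
move=> L0 b0; rewrite /stieltjes /lebesgue_stieltjes_measure.
rewrite /measure_extension measurable_mu_extE/=; last exact: is_ocitv.
by rewrite wlength_itv_bnd// L0 subr0.
Qed.

(** Without common jumps, each jump of the pair is a jump of exactly one
    component. *)
Lemma jump_measure_pair (dx : R -> E) (dh : R -> R) (C : set (R * (E * R))) :
  measurable C -> (forall s, 0 < s -> dx s <> 0 -> dh s = 0) ->
  jump_measure (fun s => (dx s, dh s)) (0%R : E * R) C =
  (times_dirac (jump_measure dx (0%R : E)) 0%R C +
   jump_measure (fun s => ((0%R : E), dh s)) (0%R : E * R) C)%E.
Proof.
move=> mC disj; rewrite times_diracE// /jump_measure.
rewrite (esumID [set s | dx s <> 0]); last by [].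
congr (_ + _)%E.
- rewrite (_ : _ `&` _ = [set s | 0 < s /\ dx s <> 0]).
    apply: eq_esum => s [s0 xs]; rewrite disj//.
  apply/seteqP; split=> s /=; first by move=> [[s0 _] xs].
  by move=> [s0 xs]; split=> //; split=> // -[].
- rewrite (_ : _ `&` _ = [set s | 0 < s /\ ((0 : E), dh s) <> (0 : E * R)]).
    apply: eq_esum => s [s0 hs].
    rewrite (_ : dx s = 0)//; apply: contrapT => xs.
    by apply: hs; rewrite disj.
  apply/seteqP; split=> s /=.
    by move=> [[s0 h] /contrapT xs]; split=> //; rewrite -xs.
  move=> [s0 hs]; have xs : dx s = 0.
    by apply: contrapT => xs; apply: hs; rewrite disj.
  by split; [split=> //; rewrite xs|move=> /(_ xs)].
Qed.

End product_random_measures.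

Section transport.
Context {R : realType} {dO : measure_display} {Omega : measurableType dO}.
Variables (P : probability Omega R) (d : nat).
Local Notation E := 'rV[R]_d.
Variables (G : R -> set (set Omega)) (T : nat -> Omega -> \bar R) (N : set Omega).
Implicit Type a b : Omega -> {measure set (R * E) -> \bar R}.

Definition marked a (x : R) : Omega -> {measure set (R * (E * R)) -> \bar R} :=
  fun w => times_dirac (a w) x.

Lemma marked_mass a x n t w (B : set (E * R)) : measurable B ->
  stopped_mass T (marked a x) n t w B = stopped_mass T a n t w [set y | B (y, x)].
Proof.
move=> mB; apply: times_diracE.
by apply: measurableX => //; exact: measurable_itv.
Qed.

Lemma marked_negative a x w : a w [set z | z.1 <= 0] = 0%E ->
  marked a x w [set z | z.1 <= 0] = 0%E.
Proof.
move=> a0; apply: etrans a0; apply: times_diracE.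
rewrite (_ : [set z | _] = `]-oo, 0]%classic `*` setT).
  by apply: measurableX => //; exact: measurable_itv.
by apply/seteqP; split=> z /=; rewrite in_itv/= => // -[].
Qed.

Lemma marked_locally_integrable a x : locally_integrable_measure P T N a ->
  locally_integrable_measure P T N (marked a x).
Proof.
move=> [h1 h2 h3 h4]; split=> [w Nw|n t B t0 mB|n t t0|n t w Nw t0].
- exact/marked_negative/h1.
- under eq_fun do rewrite marked_mass//.
  by apply: h2 => //; exact: measurable_slice.
- by under eq_integral do rewrite marked_mass//; exact: h3.
- by rewrite marked_mass//; exact: h4.
Qed.

Lemma marked_same_martingale_part a b x : same_martingale_part P G T a b ->
  same_martingale_part P G T (marked a x) (marked b x).
Proof.
move=> h n B s t A mB s0 st GA.
have mE r w : fine (stopped_mass T (marked a x) n r w B) -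
      fine (stopped_mass T (marked b x) n r w B) =
    fine (stopped_mass T a n r w [set y | B (y, x)]) -
      fine (stopped_mass T b n r w [set y | B (y, x)]).
  by rewrite (marked_mass a x n r w mB) (marked_mass b x n r w mB).
have e r := @eq_integral _ _ _ P A _ _ (fun w _ => congr1 EFin (mE r w)).
apply: etrans (e t) _; apply: etrans _ (esym (e s)).
exact: (h n _ s t A (measurable_slice x mB) s0 st GA).
Qed.

End transport.

Section default_jump.
Context {R : realType} {dO : measure_display} {Omega : measurableType dO}.
Variables (tau : Omega -> \bar R) (w : Omega).
Hypothesis tau_gt0 : (0 < tau w)%E.

Local Notation H := (fun t => default_process tau t w : R).

(* The default process is a step path whose only finite jump time is tau. *)
Let times (n : nat) : \bar R := if n is 0%N then tau w else +oo%E.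
Let sizes (n : nat) : R := if n is 0%N then 1 else 0.

Let times_ge0 n : (0 <= times n)%E.
Proof. by case: n => [|n] /=; [exact: ltW|exact: leey]. Qed.

Let times_le n : (times n <= times n.+1)%E. Proof. by rewrite /= leey. Qed.

Let times_lt n : (times n < +oo)%E -> (times n < times n.+1)%E.
Proof. by case: n => [|n]. Qed.

Let times_lim : times n @[n --> \oo] --> +oo%E.
Proof.
rewrite -(cvg_shiftS times) (_ : (fun n => times n.+1) = cst +oo%E)//.
exact: cvg_cst.
Qed.

Let default_step t : 0 <= t ->
  (\sum_(0 <= n < M) (if (times n <= t%:E)%E then sizes n else 0))
    @[M --> \oo] --> H t.
Proof.
move=> t0; apply: cvg_near_cst; exists 1%N => // M /= M1.
rewrite big_ltn// [X in _ + X]big_nat_cond [X in _ + X]big1 ?addr0//.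
by move=> [|n] // _; rewrite /= if_same.
Qed.

Lemma default_cvg_left t : 0 < t -> cvg (H s @[s --> t^'-]).
Proof. exact: (step_cvg_left times_ge0 times_le times_lim default_step). Qed.

Lemma default_jumpE t : 0 < t -> jump H t = if tau w == t%:E then 1 else 0.
Proof.
move=> t0; case: eqP => [tt|tt].
  exact: (@step_jump_at _ _ times sizes H times_ge0 times_le times_lt times_lim
    default_step 0%N t t0 tt).
apply: (@step_jump_off _ _ times sizes H times_ge0 times_le times_lt times_lim
  default_step t t0) => -[|n] //=.
Qed.

End default_jump.

Section default_compensator.
Context {R : realType} {dO : measure_display} {Omega : measurableType dO}.
Variables (P : probability Omega R) (d : nat).
Local Notation E := 'rV[R]_d.
Variables (G : R -> set (set Omega)) (tau : Omega -> \bar R)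
  (Lambda : Omega -> cumulative R R).
Hypotheses (rcG : rc_filtration G) (mtau : measurable_fun setT tau)
  (tau_gt0 : forall w, (0 < tau w)%E)
  (L0 : forall w t, t <= 0 -> Lambda w t = 0)
  (pL : predictable_process G (fun t w => Lambda w t)).
Variables (T : nat -> Omega -> \bar R) (N : set Omega).
Hypotheses (sT : forall n, stopping_time G (T n))
  (mart : forall n, martingale P G (stopped_process (T n)
    (fun t w => default_process tau t w - Lambda w t))).

Definition default_jump_measure (w : Omega) :
    {measure set (R * (E * R)) -> \bar R} :=
  jump_measure (fun s => (0 : E, jump (default_process tau ^~ w : R -> R) s)) (0 : E * R).

Definition default_compensator (w : Omega) :
    {measure set (R * (E * R)) -> \bar R} :=
  times_dirac (stieltjes (Lambda w) \x \d_(0%R : E))%E 1.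

Let T_ge0 n w : (0 <= T n w)%E. Proof. by case: (sT n). Qed.

Let c n t w := fine (Order.min t%:E (T n w)).

Let cE n t w : 0 <= t -> (c n t w)%:E = Order.min t%:E (T n w).
Proof.
move=> t0; rewrite /c fineK// ge0_fin_numE ?le_min ?lee_fin ?t0 ?T_ge0//.
by rewrite gt_min ltry.
Qed.

Let c0 n t w : 0 <= t -> 0 <= c n t w.
Proof. by move=> t0; rewrite -lee_fin cE// le_min lee_fin t0 T_ge0. Qed.

Lemma default_jump_measureE w C : default_jump_measure w C =
  (if (tau w < +oo)%E then \d_(fine (tau w), (0%R : E, 1%R : R)) C else 0)%E.
Proof.
have support s : 0 < s /\ ((0 : E), jump (default_process tau ^~ w : R -> R) s) <> (0 : E * R)
    <-> tau w = s%:E.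
  split=> [[s0]|ts].
    rewrite default_jumpE//; case: eqP => // _ /(_ erefl) [].
  have s0 : 0 < s by rewrite -lte_fin -ts.
  split=> //; rewrite default_jumpE// ts eqxx => -[] /eqP; rewrite oner_eq0//.
rewrite /default_jump_measure/= /jump_measure.
have [ty|] := ltP (tau w) +oo%E; last first.
  rewrite leye_eq => /eqP ty; rewrite (_ : [set s | _] = set0) ?esum_set0//.
  by apply/seteqP; split=> // s /support; rewrite ty.
have tE : (fine (tau w))%:E = tau w by rewrite fineK// gt0_fin_numE.
have t0 : 0 < fine (tau w) by rewrite -lte_fin tE.
rewrite (_ : [set s | _] = [set fine (tau w)]).
  by rewrite esum_set1// default_jumpE// tE eqxx.
apply/seteqP; split=> s /=; first by move=> /support ->.
by move=> ->; apply/support; rewrite tE.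
Qed.

Let mass_default n t w B : 0 <= t ->
  stopped_mass T default_jump_measure n t w B =
  (\1_B (0 : E, 1 : R) * default_process tau (c n t w) w)%:E.
Proof.
move=> t0; rewrite /stopped_mass default_jump_measureE /default_process cE//.
case: ifPn => [ty|]; last first.
  rewrite -leNgt leye_eq => /eqP ->; rewrite leNgt gt_min ltry/= mulr0//.
have tE : (fine (tau w))%:E = tau w by rewrite fineK// gt0_fin_numE.
have t0' : 0 < fine (tau w) by rewrite -lte_fin tE.
rewrite diracE indicE; congr (_%:E); rewrite -tE.
have -> : ((fine (tau w), (0 : E, 1 : R)) \in
    `]0, fine (Order.min t%:E (T n w))]%classic `*` B) =
    ((fine (tau w))%:E <= Order.min t%:E (T n w))%E && ((0 : E, 1 : R) \in B).
  apply/idP/andP; rewrite !inE/=.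
    by rewrite in_itv/= t0' -lee_fin -/(c n t w) cE// => -[].
  by rewrite in_itv/= t0' -lee_fin -/(c n t w) cE// => -[? ?].
by case: ((_ <= _)%E) => /=; rewrite ?mulr1 ?mulr0.
Qed.

Lemma default_compensator_rect w x B : 0 <= x -> measurable B ->
  default_compensator w (`]0, x]%classic `*` B) =
  (\1_B (0 : E, 1 : R) * Lambda w x)%:E.
Proof.
move=> x0 mB; apply: etrans.
  apply: stieltjes_times_diracE.
  by apply: measurableX => //; exact: measurable_itv.
rewrite indicE.
have [B1|nB1] := pselect (B (0, 1)).
  rewrite mem_set// mul1r -stieltjes_oc ?L0//; congr (stieltjes _ _).
  by apply/seteqP; split=> s /= => [[]|].
rewrite memNset// mul0r (_ : [set s | _] = set0) ?measure0//.
by apply/seteqP; split=> // s [].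
Qed.

Let mass_compensator n t w B : 0 <= t -> measurable B ->
  stopped_mass T default_compensator n t w B =
  (\1_B (0 : E, 1 : R) * Lambda w (c n t w))%:E.
Proof. by move=> t0 mB; exact: default_compensator_rect (c0 n w t0) mB. Qed.

Let mH n t : 0 <= t -> measurable_fun setT (fun w => default_process tau (c n t w) w).
Proof.
move=> t0; rewrite (_ : (fun w => _) =
    \1_[set w | (tau w <= Order.min t%:E (T n w))%E]).
  apply: measurable_indic; rewrite -[X in measurable X]setTI.
  have mT := stopping_time_measurable rcG (sT n).
  by apply: measurable_lee => //; exact: measurable_mine.
apply/funext => w; rewrite /default_process indicE cE//.
by case: ifPn => h; [rewrite mem_set|rewrite memNset//; exact/negP].
Qed.

Let mL n t : 0 <= t -> measurable_fun setT (fun w => Lambda w (c n t w)).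
Proof.
move=> t0 _ B mB.
have := predictable_process_stopped rcG pL (sT n) t0 mB.
exact: (filt_meas rcG t0).
Qed.

Let indic01 (B : set (E * R)) z : (\1_B z : R) = 0 \/ (\1_B z : R) = 1.
Proof. by rewrite indicE; case: (_ \in _); [right|left]. Qed.

Lemma default_jump_locally_integrable :
  locally_integrable_measure P T N default_jump_measure.
Proof.
have ub n t w B : 0 <= t -> (stopped_mass T default_jump_measure n t w B <= 1)%E.
  move=> t0; rewrite mass_default// lee_fin /default_process.
  by have [->|->] := indic01 B (0, 1); case: ifP; rewrite ?mul0r ?mul1r.
have mm n t B : 0 <= t ->
    measurable_fun setT (fun w => stopped_mass T default_jump_measure n t w B).
  move=> t0; under eq_fun do rewrite mass_default//.
  by apply/measurable_EFinP/measurable_funM => //; exact: mH.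
split=> [w Nw|n t B t0 mB|n t t0|n t w Nw t0].
- rewrite default_jump_measureE; case: ifPn => // ty.
  rewrite diracE memNset//=; apply/negP; rewrite -ltNge.
  by rewrite -lte_fin fineK// gt0_fin_numE.
- exact: mm.
- apply: (@le_lt_trans _ _ (\int[P]_w (cst 1%:E w))%E).
    by apply: ge0_le_integral => //; [exact: mm|move=> w _; exact: ub].
  rewrite integral_cst//= [X in (_ * X)%E](_ : _ = 1%E) ?mule1 ?ltry//.
  exact: probability_setT.
- by apply: le_lt_trans (ub n t w setT t0) _; exact: ltry.
Qed.

Lemma default_compensator_negative w : default_compensator w [set z | z.1 <= 0] = 0%E.
Proof.
apply: etrans.
  apply: stieltjes_times_diracE.
  rewrite (_ : [set z | _] = `]-oo, 0]%classic `*` setT).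
    by apply: measurableX => //; exact: measurable_itv.
  by apply/seteqP; split=> z /=; rewrite in_itv/= => // -[].
pose I (k : nat) : set R := `](- k%:R), 0]%classic.
rewrite /= (_ : [set t | t <= 0] = \bigcup_k I k).
  apply/eqP; rewrite eq_le measure_ge0 andbT.
  apply: (@le_trans _ _ (\sum_(k <oo) stieltjes (Lambda w) (I k))%E).
    apply: measure_sigma_subadditive => // [k|].
      exact: measurable_itv.
    by apply: bigcup_measurable => k _; exact: measurable_itv.
  rewrite eseries0// => k _ _.
  rewrite /stieltjes /lebesgue_stieltjes_measure.
  rewrite /measure_extension measurable_mu_extE/=; last exact: is_ocitv.
  by rewrite wlength_itv_bnd ?oppr_le0// !L0 ?oppr_le0// subrr.
apply/seteqP; split=> r /=; last by move=> [k _]; rewrite /I/= in_itv/= => /andP[].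
move=> r0; exists (Num.truncn (- r)).+1 => //; rewrite /I/= in_itv/= r0 andbT.
by rewrite ltrNl truncnS_gt.
Qed.

Lemma default_compensator_locally_integrable :
  locally_integrable_measure P T N default_compensator.
Proof.
have mm n t B : 0 <= t -> measurable B ->
    measurable_fun setT (fun w => stopped_mass T default_compensator n t w B).
  move=> t0 mB; under eq_fun do rewrite mass_compensator//.
  by apply/measurable_EFinP/measurable_funM => //; exact: mL.
split=> [w Nw|n t B t0 mB|n t t0|n t w Nw t0].
- exact: default_compensator_negative.
- exact: mm.
- under eq_integral do rewrite mass_compensator// indicE mem_set// mul1r.
  have [_ /(_ t t0) iM _ _] := mart n.
  pose M := stopped_process (T n) (fun t w => default_process tau t w - Lambda w t) t.
  pose D w : R := default_process tau (c n t w) w.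
  have iH : P.-integrable setT (EFin \o D).
    apply: (@le_integrable _ _ _ _ _ measurableT _ (cst 1%E)).
    - by apply/measurable_EFinP; exact: mH.
    - move=> w _ /=; rewrite lee_fin /D /default_process normr1.
      by case: ifP => _; rewrite ?normr1 ?normr0.
    - exact: finite_measure_integrable_cst.
  have iL := integrableB measurableT iH iM.
  have : (\int[P]_w (Lambda w (c n t w))%:E = \int[P]_w ((D w)%:E - (M w)%:E))%E.
    apply: eq_integral => w _; rewrite /M /D /stopped_process -/(c n t w) -EFinB.
    by congr EFin; rewrite opprB addrC subrK.
  move=> ->.
  have := integrable_fin_num measurableT iL.
  by move=> /fin_numPlt/andP[].
- by rewrite mass_compensator// ltry.
Qed.

(** Up to the factor [\1_B (0, 1)] the difference of the stopped masses is the
    stopped process H - Lambda. *)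
Lemma default_same_martingale_part :
  same_martingale_part P G T default_jump_measure default_compensator.
Proof.
move=> n B s t A mB s0 st GA; have t0 := le_trans s0 st.
pose M := stopped_process (T n) (fun t w => default_process tau t w - Lambda w t).
have mE r w : 0 <= r -> fine (stopped_mass T default_jump_measure n r w B) -
    fine (stopped_mass T default_compensator n r w B) =
    \1_B (0 : E, 1 : R) * M r w.
  by move=> r0; rewrite (mass_default n w B r0) (mass_compensator n w r0 mB) -mulrBr.
have e r r0 := @eq_integral _ _ _ P A _ _ (fun w _ => congr1 EFin (mE r w r0)).
apply: etrans (e t t0) _; apply: etrans _ (esym (e s s0)).
have [->|->] := indic01 B (0, 1).
  by under eq_integral do rewrite mul0r; under [RHS]eq_integral do rewrite mul0r.
under eq_integral do rewrite mul1r; under [RHS]eq_integral do rewrite mul1r.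
by have [_ _ _ h] := mart n; exact: h.
Qed.

End default_compensator.

(** * The compensator of the pair *)

Section jump_of_pair.
Context {R : realType} {V1 V2 : normedModType R}.

Lemma jump_pair (y1 : R -> V1) (y2 : R -> V2) t :
  (0 < t -> cvg (y1 x @[x --> t^'-])) -> (0 < t -> cvg (y2 x @[x --> t^'-])) ->
  jump (fun s => (y1 s, y2 s)) t = (jump y1 t, jump y2 t).
Proof.
rewrite /jump; case: ifP => // t0 /(_ isT) c1 /(_ isT) c2.
pose l : V1 * V2 := (lim (y1 x @[x --> t^'-]), lim (y2 x @[x --> t^'-])).
have c : (y1 x, y2 x) @[x --> t^'-] --> l by exact: cvg_pair.
by have /= -> := @norm_cvg_lim _ (V1 * V2)%type _ _ l c.
Qed.

End jump_of_pair.

Lemma measurable_coincidence {R : realType} {dO : measure_display}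
    {Omega : measurableType dO} (f g : Omega -> \bar R) :
  measurable_fun setT f -> measurable_fun setT g ->
  measurable [set w | f w = g w /\ (f w < +oo)%E].
Proof.
move=> mf mg; have mlt := emeasurable_fun_infty_o measurableT mf +oo%E.
have mfg := measurableI _ _ (measurable_eqe measurableT mf mg) mlt.
by apply: (set_system_ext mfg) => w /=; split=> [[[_ ?] [_ ?]]|[? ?]].
Qed.

Theorem theorem4p7 (R : realType) (dO : measure_display)
    (Omega : measurableType dO) (P : probability Omega R) (d : nat)
    (RX : set (set Omega)) (X : R -> Omega -> 'rV[R]_d)
    (tau : Omega -> \bar R)
    (nuX : Omega -> {measure set (R * 'rV[R]_d) -> \bar R})
    (Lambda : Omega -> cumulative R R) :
  let F : R -> set (set Omega) :=
    initially_enlarged RX (natural_filtration X) in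
  let G : R -> set (set Omega) := progressive_enlargement F tau in
  let H : R -> Omega -> R := default_process tau in
  let Z : R -> Omega -> 'rV[R]_d * R := fun t w => (X t w, H t w) in
  let muX : Omega -> {measure set (R * 'rV[R]_d) -> \bar R} :=
    fun w => jump_measure (jump (X ^~ w)) (0 : 'rV[R]_d) in
  let muZ : Omega -> {measure set (R * ('rV[R]_d * R)) -> \bar R} :=
    fun w => jump_measure (jump (Z ^~ w)) (0 : 'rV[R]_d * R) in
  sigma_algebra setT RX -> RX `<=` measurable ->
  rc_filtration F ->
  step_process F X ->
  measurable_fun setT tau -> (forall w, (0 < tau w)%E) ->
  avoids_stopping_times P F tau ->
  immersed P F G ->
  dual_predictable_projection_measure P F muX nuX ->
  dual_predictable_projection P G H Lambda ->
  dual_predictable_projection_measure P G muZ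
    (fun w => joint_compensator (nuX w) (Lambda w)) /\
  (quasi_left_continuous P F X -> quasi_left_continuous P G Z).
Proof.
move=> F G H Z muX muZ _ _ rcF [T [xi [sT Tinc mxi xi0 XT]]] mtau tau0 avoid imm
  hnu [L0 pL _ [T' [sT' aeT'] mart]].
have rcG : rc_filtration G := progressive_enlargement_rc rcF mtau tau0.
have FG t : 0 <= t -> F t `<=` G t := @progressive_enlargement_le _ _ _ F tau t.
pose N1 := explosion_set T nuX.
have mN1 : measurable N1 := explosion_set_measurable rcF sT hnu.
have N10 : P N1 = 0%E := explosion_set_null rcF sT Tinc mxi xi0 XT hnu.
have T_ge0 n w : (0 <= T n w)%E by case: (sT n).
have Tle w n : (T n w <= T n.+1 w)%E by have [/(_ n)[]] := Tinc w.
have Tlt w n : (T n w < +oo)%E -> (T n w < T n.+1 w)%E.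
  by have [/(_ n)[]] := Tinc w.
have Tlim w : T n w @[n --> \oo] --> +oo%E by have [] := Tinc w.
have sTG n := stopping_time_le FG (sT n).
have hmu := jump_locally_integrable P nuX rcF sT Tinc mxi xi0 XT.
have hnuX := compensator_locally_integrable rcF sT Tinc mxi xi0 XT hnu.
have same K := jump_same_martingale_part rcF sT Tinc mxi xi0 XT hnu (G := K).
have Xleft w t : 0 < t -> cvg (X s w @[s --> t^'-]).
  exact: (step_cvg_left (fun n => T_ge0 n w) (Tle w) (Tlim w) (fun t => XT t w)).
have jumpZ w t : jump (Z ^~ w) t = (jump (X ^~ w) t, jump (H ^~ w) t).
  apply: jump_pair; first exact: Xleft.
  by move=> t0; exact: (default_cvg_left (tau0 w) t0).
split; last first.
  move=> qX sigma psigma sfin.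
  have pnu : predictable_process F (fun t w => nuX w (`]0, t]%classic `*` setT)).
    by have [_ + _] := hnu; apply.
  have qXG := quasi_left_continuous_enlarged rcF rcG FG sT mN1 N10
    (fun w _ => Tle w) (fun w _ => Tlim w) hmu hnuX pnu (same F (fun _ h => h))
    (same G imm) qX psigma sfin.
  have avoid_sigma : {ae P, forall w, tau w <> sigma w}.
    have s0 w : (0 <= sigma w)%E by case: psigma => -[].
    have ms := stopping_time_measurable rcG psigma.1.
    exists [set w | (tau w < +oo)%E /\ tau w = sigma w]; split.
    - apply: (set_system_ext (measurable_coincidence mtau ms)) => w /=.
      by split=> -[].
    - exact: (predictable_time_avoids rcF mtau tau0 avoid psigma).
    - by move=> w /= /contrapT ts; split=> //; rewrite ts.
  apply: filterS2 qXG avoid_sigma => w jX ts.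
  rewrite jumpZ jX; congr pair.
  have [s0|s0] := ltP 0 (fine (sigma w)); last by rewrite /jump ltNge s0.
  rewrite (default_jumpE (tau0 w) s0); case: eqP => // te.
  case: ts; rewrite te fineK// ge0_fin_numE//.
  by case: psigma => -[].
have [N2 [mN2 N20 N2P]] := aeT'.
have T'P w : ~ N2 w -> (forall n, (T' n w <= T' n.+1 w)%E) /\
    T' n w @[n --> \oo] --> +oo%E.
  by move=> Nw; apply: contrapT => h; apply: Nw; exact: N2P.
have T'le w : ~ N2 w -> forall n, (T' n w <= T' n.+1 w)%E by move=> /T'P[].
have T'lim w : ~ N2 w -> T' n w @[n --> \oo] --> +oo%E by move=> /T'P[].
pose dj := @default_jump_measure R dO Omega d tau.
pose dc := @default_compensator R dO Omega d Lambda.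
have hdj : locally_integrable_measure P T' N2 dj.
  exact: (default_jump_locally_integrable P d rcG mtau tau0 N2 sT').
have hdc : locally_integrable_measure P T' N2 dc.
  exact: (default_compensator_locally_integrable d rcG mtau L0 pL N2 sT' mart).
have sdj : same_martingale_part P G T' dj dc.
  exact: (default_same_martingale_part tau0 L0 sT' mart).
(* Off N3, which is null by avoidance, X and H never jump together. *)
pose N3 := \bigcup_n [set w | tau w = T n w /\ (tau w < +oo)%E].
have mTn n : measurable [set w | tau w = T n w /\ (tau w < +oo)%E].
  exact: (measurable_coincidence mtau (stopping_time_measurable rcF (sT n))).
have mN3 : measurable N3 by exact: bigcup_measurable.
have N30 : P N3 = 0%E.
  apply/negligibleP => //; apply: negligible_bigcup => n.
  by apply/negligibleP => //; exact: avoid (sT n).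
have mD : measurable [set z : R * ('rV[R]_d * R) | 0 <= z.1].
  rewrite (_ : [set z | _] = `[0, +oo[%classic `*` setT).
    by apply: measurableX => //; exact: measurable_itv.
  by apply/seteqP; split=> z /=; rewrite in_itv/= andbT// => -[].
have jointE w C : joint_compensator (nuX w) (Lambda w) C =
    (marked nuX 0 w C + dc w C)%E by exact: measure_addE.
split.
- move=> w; rewrite jointE default_compensator_negative// adde0.
  by apply: marked_negative; case: hnu => ->.
- move=> B mB; have sG := predictable_salg G.
  pose B0 : set 'rV[R]_d := [set x | B (x, 0)].
  pose i : R := \1_B (0 : 'rV[R]_d, 1 : R).
  pose nuB t w := nuX w (`]0, t]%classic `*` B0).
  have pnuB : predictable_process G nuB.
    apply: (predictable_process_le FG); have [_ h _] := hnu.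
    by apply: h; exact: measurable_slice.
  pose J (p : Omega * R) := (nuB p.2 p.1 + (i * Lambda p.1 p.2)%:E)%E.
  have mJ : measurable_wrt [set p : Omega * R | 0 <= p.2] (predictable G) J.
    have wrtP dU (U : measurableType dU) (f : Omega * R -> U) :=
      measurable_wrtP f sG (@predictable_sub _ _ _ G).
    apply/wrtP; apply: emeasurable_funD; first exact/wrtP.
    by apply/measurable_EFinP/measurable_funM => //; exact/wrtP.
  have JE p : 0 <= p.2 -> J p =
      joint_compensator (nuX p.1) (Lambda p.1) (`]0, p.2]%classic `*` B).
    move=> p0; rewrite jointE; congr (_ + _)%E.
      by apply/esym/times_diracE; apply: measurableX => //; exact: measurable_itv.
    by apply/esym; apply: default_compensator_rect.
  move=> C mC; apply: (set_system_ext (mJ C mC)) => p /=.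
  by split=> -[p0]; rewrite JE.
- move=> W W0 pW.
  have [f1 [g1 [mf1 mg1 f1E g1E [f10 g10 fg1]]]] := predictable_integral_eq rcG sTG
    mN1 N10 (fun w _ => Tle w) (fun w _ => Tlim w)
    (marked_locally_integrable 0 hmu) (marked_locally_integrable 0 hnuX)
    (marked_same_martingale_part 0 (same G imm)) W0 pW.
  have [f2 [g2 [mf2 mg2 f2E g2E [f20 g20 fg2]]]] := predictable_integral_eq rcG sT'
    mN2 N20 T'le T'lim hdj hdc sdj W0 pW.
  pose N := N1 `|` N2 `|` N3.
  have mN : measurable N by do !apply: measurableU.
  have N0 : P N = 0%E.
    by apply: null_set_setU => //; [exact: measurableU|exact: null_set_setU].
  have mWw w : measurable_fun [set z : R * ('rV[R]_d * R) | 0 <= z.1] (fun z => W (w, z)).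
    exact: (predictable_function_section rcG w pW).
  transitivity (\int[P]_w (g1 w + g2 w))%E.
    apply: (integral_null_ext mN N0).
    + by move=> w; apply: integral_ge0 => z _; exact: W0.
    + by move=> w; exact: adde_ge0.
    + move=> w Nw; rewrite ge0_integral_measure_add//.
      by rewrite g1E ?g2E// => h; apply: Nw; [left; right|left; left].
  rewrite ge0_integralD// -fg1 -fg2 -ge0_integralD//.
  apply: (integral_null_ext mN N0).
  + by move=> w; exact: adde_ge0.
  + by move=> w; apply: integral_ge0 => z _; exact: W0.
  + move=> w Nw; rewrite f1E ?f2E//; last 2 first.
      by move=> h; apply: Nw; left; right.
      by move=> h; apply: Nw; left; left.
    rewrite -ge0_integral_measure_add//; apply: eq_measure_integral => C mC _.
    apply: etrans (measure_addE _ _ _) _; apply/esym.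
    rewrite /muZ (_ : jump (Z ^~ w) =
      (fun s => (jump (X ^~ w) s, jump (H ^~ w) s))); last exact/funext/jumpZ.
    apply: jump_measure_pair => // s s0 jX.
    have [n Tn] : exists n, T n w = s%:E.
      apply: contrapT => /forallNP h; apply: jX.
      exact: (step_jump_off (fun n => T_ge0 n w) (Tle w) (Tlt w) (Tlim w)
        (fun t => XT t w) s0 h).
    rewrite (default_jumpE (tau0 w) s0); case: eqP => // ts.
    by case: Nw; right; exists n => //=; rewrite ts Tn ltry.
Qed.
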